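(* Let $n\ge 2$. The following results hold: 1. Normal mean family $\mathcal{P}=\{\mathcal{N}(\theta,1):|\theta|\le\mu\}$: $$\chi^2(\mathcal{P},n)=\begin{cases}\Theta(\mu^4) & \text{if } \mu\le 1,\\ \exp(\Theta(\mu^2)) & \text{if } 1<\mu\le\sqrt{\log n},\\ \exp(\Theta(\mu\sqrt{\log n})) & \text{if } \sqrt{\log n}<\mu\le n^{0.99}.\end{cases}$$ 2. Poisson family $\mathcal{P}=\{\mathrm{Poi}(\lambda):0\le\lambda\le M\}$: $$\chi^2(\mathcal{P},n)=\begin{cases}\Theta(M^2) & \text{if } M\le 1,\\ \exp(\Theta(M)) & \text{if } 1<M\le\log n,\\ \exp(\Theta(\sqrt{M\log n})) & \text{if } \log n<M\le n^{1.99}.\end{cases}$$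
   Context: All logarithms are natural. For probability measures $P,Q$ on the same space, $\chi^2(P\|Q)=\int \frac{(dP-dQ)^2}{dQ}$. For a family $\mathcal{P}$ of probability distributions on a common space and $P_1,\dots,P_m\in\mathcal{P}$, let $\mathbb{P}_m=\frac{1}{m!}\sum_{\pi\in S_m}\bigotimes_{i=1}^m P_{\pi(i)}$ (the permutation mixture, $S_m$ being the symmetric group on $\{1,\dots,m\}$) and $\mathbb{Q}_m=\bigl(\frac1m\sum_{i=1}^m P_i\bigr)^{\otimes m}$ (the i.i.d. mean-field approximation), and define $\chi^2(\mathcal{P},n)=\max_{m\le n}\sup_{P_1,\dots,P_m\in\mathcal{P}}\chi^2(\mathbb{P}_m\|\mathbb{Q}_m)$. $\mathcal{N}(\theta,1)$ is the normal distribution with mean $\theta$ and variance $1$, and $\mathrm{Poi}(\lambda)$ is the Poisson distribution with rate $\lambda$ ($\mathrm{Poi}(0)$ is the point mass at $0$). Asymptotic notation: for non-negative sequences, $a_n=O(b_n)$ means $\limsup_{n\to\infty}a_n/b_n<\infty$, and $a_n=\Theta(b_n)$ means both $a_n=O(b_n)$ and $b_n=O(a_n)$; a dependence of the hidden factors on an external parameter would be indicated by a subscript, and none is present here.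
   Formalization: In the exp(Θ(g)) cases the lower bound is exp(c g − K) with an absolute constant K, since with K = 0 the claim fails where g is bounded (for n = 2 the divergence never exceeds 1); once g is large enough it gives exp(Θ(g)) literally. μ and M are taken nonnegative. *)

(* Defs.v *)
From HB Require Import structures.
From mathcomp Require Import all_boot all_order all_algebra all_fingroup.
From mathcomp Require Import all_classical all_reals all_analysis.
From mathcomp Require Import lra.

Set Implicit Arguments.
Unset Strict Implicit.
Unset Printing Implicit Defensive.

Import Order.TTheory GRing.Theory Num.Def Num.Theory.
Import numFieldNormedType.Exports.

Local Open Scope classical_set_scope.
Local Open Scope charge_scope.
Local Open Scope ring_scope.

(** Uniform mixtures. The inhabitant [i0] only witnesses that the index type is
    nonempty. *)
Definition mixture d (T : measurableType d) (R : realType) (I : finType)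
    (i0 : I) (P : I -> probability T R) : set T -> \bar R :=
  fun A => ((#|I|%:R^-1)%:E * \sum_(i : I) P i A)%E.

Section mixture_probability.
Local Open Scope ereal_scope.
Context d (T : measurableType d) (R : realType) (I : finType) (i0 : I).
Variable P : I -> probability T R.

Let mixture0 : mixture i0 P set0 = 0.
Proof. by rewrite /mixture big1 ?mule0// => i _; rewrite measure0. Qed.

Let mixture_ge0 A : 0 <= mixture i0 P A.
Proof.
by rewrite /mixture mule_ge0 ?lee_fin ?invr_ge0//; apply: sume_ge0.
Qed.

Let mixture_sigma_additive : semi_sigma_additive (mixture i0 P).
Proof.
move=> F mF tF mUF; rewrite /mixture.
rewrite [X in X @ _ --> _](_ : _ = fun n =>
    (#|I|%:R^-1)%:E * \sum_(i : I) \sum_(0 <= k < n) P i (F k)); last first.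
  apply/funext => n; rewrite -ge0_sume_distrr; last by move=> *; exact: sume_ge0.
  by rewrite exchange_big.
apply: cvgeZl => //.
apply: cvg_nnesum => [i _|i _]; first by apply: nearW => n; exact: sume_ge0.
exact: measure_semi_sigma_additive.
Qed.

HB.instance Definition _ := isMeasure.Build _ _ _ (mixture i0 P)
  mixture0 mixture_ge0 mixture_sigma_additive.

Let mixture_setT : mixture i0 P setT = 1.
Proof.
rewrite /mixture (eq_bigr (fun=> 1)); last by move=> i _; rewrite probability_setT.
rewrite sumEFin -EFinM sumr_const mulVf// pnatr_eq0 -lt0n.
by apply/card_gt0P; exists i0.
Qed.

HB.instance Definition _ :=
  Measure_isProbability.Build _ _ _ (mixture i0 P) mixture_setT.

End mixture_probability.

Section tuple_product.
Context d (T : measurableType d).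

Definition tcons n (p : T * n.-tuple T) : n.+1.-tuple T := [tuple of p.1 :: p.2].

Lemma measurable_tcons n : measurable_fun [set: T * n.-tuple T] (@tcons n).
Proof. exact: measurable_cons. Qed.

HB.instance Definition _ n := isMeasurableFun.Build _ _ _ _
  (@tcons n) (@measurable_tcons n).

End tuple_product.

(** The product probability measure P_0 (x) ... (x) P_(n-1) on n-tuples. *)
Fixpoint tuple_prob d (T : measurableType d) (R : realType) n :
    ('I_n -> probability T R) -> probability (n.-tuple T) R :=
  match n with
  | 0 => fun _ => dirac [tuple]
  | n'.+1 => fun P => distribution
      ((P ord0 \x tuple_prob (fun i => P (lift ord0 i)))%E : probability _ R)
      (@tcons _ T n')
  end.

Lemma tuple_prob_box d (T : measurableType d) (R : realType) n
    (P : 'I_n -> probability T R) (A : 'I_n -> set T) :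
  (forall i, measurable (A i)) ->
  tuple_prob P [set x | forall i, A i (tnth x i)] = (\prod_(i < n) P i (A i))%E.
Proof.
elim: n P A => [|n IH] P A mA /=.
  rewrite big_ord0 diracE mem_set//=.
  by move=> -[].
rewrite /distribution /pushforward big_ord_recl.
rewrite -(IH (fun i => P (lift ord0 i)) (fun i => A (lift ord0 i)))//.
rewrite -product_measure1E//; last first.
  rewrite [X in measurable X](_ : _ = \big[setI/setT]_(i < n)
      ((fun x => tnth x i) @^-1` A (lift ord0 i))).
    apply: bigsetI_measurable => i _.
    by rewrite -[X in measurable X]setTI; exact: measurable_tnth.
  apply/seteqP; split => x /=.
    by move=> Ax; rewrite -bigcap_seq => i _; exact: Ax.
  by rewrite -bigcap_seq => Ax i; apply: Ax; rewrite /= mem_index_enum.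
congr (_ _); apply/seteqP; split => -[a x] /=.
  move=> H; split; first exact: (H ord0).
  by move=> i /=; have := H (lift ord0 i); rewrite tnthS.
move=> [Aa Ax] i; case: (unliftP ord0 i) => [j ->|->//].
by rewrite tnthS; exact: Ax.
Qed.

Section permutation_mixture.
Context d (T : measurableType d) (R : realType) (m : nat).
Variable P : 'I_m.+1 -> probability T R.

Definition perm_mixture : probability (m.+1.-tuple T) R :=
  mixture (1%g : 'S_m.+1) (fun s => tuple_prob (fun i => P (s i))).

Definition mean_field : probability (m.+1.-tuple T) R :=
  tuple_prob (fun _ : 'I_m.+1 => mixture ord0 P : probability T R).

End permutation_mixture.

(** The chi-square divergence; [(dP - dQ)^2 / dQ] is [(dP/dQ - 1)^2 dQ], and the
    divergence is infinite when [P] is not absolutely continuous w.r.t. [Q]. *)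
Definition chi2_div d (T : measurableType d) (R : realType)
    (P Q : probability T R) : \bar R :=
  if pselect (P `<< Q) then
    (\int[Q]_x (('d (charge_of_finite_measure P) '/d Q) x - 1) ^+ 2)%E
  else +oo%E.

(** Maximum over 1 <= m' <= n, with m' = m.+1. *)
Definition chi2_family d (T : measurableType d) (R : realType)
    (F : set (probability T R)) (n : nat) : \bar R :=
  (\big[maxe/-oo]_(m < n)
     ereal_sup [set chi2_div (perm_mixture P) (mean_field P) |
                P in [set P : 'I_m.+1 -> probability T R | forall i, F (P i)]])%E.

Definition normal_family (R : realType) (mu : R) :=
  [set (normal_prob theta 1 : probability _ R) | theta in [set t : R | `|t| <= mu]].

(** The second argument of [poisson_prob] is a dummy; [poisson_prob 0 _] is the
    point mass at 0. *)
Definition poisson_family (R : realType) (M : R) :=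
  [set (poisson_prob lambda 0%N : probability _ R) |
   lambda in [set l : R | 0 <= l <= M]].

(** [f = Theta(g)] with constants uniform over all indices n and parameters t in
    the regime [D]. *)
Definition Theta_on (R : realType) (D : nat -> R -> Prop)
    (f : nat -> R -> \bar R) (g : nat -> R -> R) :=
  exists c C : R, [/\ 0 < c, 0 < C &
    forall n t, D n t ->
      ((c * g n t)%:E <= f n t)%E /\ (f n t <= (C * g n t)%:E)%E].

(** [f = exp(Theta(g))], again uniformly over [D]. The lower bound on the
    exponent allows for an additive constant [K], which is immaterial as [g]
    grows (see [exp_Theta_on_large]) and only matters where [g] is bounded. It
    cannot be dropped for the families below: for n = 2 the divergence never
    exceeds 1, and for N(theta,1), |theta| <= mu, it is below 1 for every n when
    mu is close to 1, whereas exp(c g) > 1. *)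
Definition exp_Theta_on (R : realType) (D : nat -> R -> Prop)
    (f : nat -> R -> \bar R) (g : nat -> R -> R) :=
  exists c C K : R, [/\ 0 < c, 0 < C &
    forall n t, D n t ->
      ((expR (c * g n t - K))%:E <= f n t)%E /\
      (f n t <= (expR (C * g n t))%:E)%E].

Lemma exp_Theta_on_large (R : realType) (D : nat -> R -> Prop)
    (f : nat -> R -> \bar R) (g : nat -> R -> R) :
  exp_Theta_on D f g ->
  exists c C x0 : R, [/\ 0 < c, 0 < C &
    forall n t, D n t -> x0 <= g n t ->
      ((expR (c * g n t))%:E <= f n t)%E /\
      (f n t <= (expR (C * g n t))%:E)%E].
Proof.
move=> [c [C [K [c0 C0 H]]]]; exists (c / 2), C, (2 * K / c); split=> //.
  by rewrite divr_gt0.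
move=> n t Dnt; rewrite ler_pdivrMr// => Kg.
have [lo up] := H _ _ Dnt; split=> //.
by apply: le_trans lo; rewrite lee_fin ler_expR; lra.
Qed.

(* Main.v *)
From HB Require Import structures.
Require Import Defs.
From mathcomp Require Import all_boot all_order all_algebra all_fingroup.
From mathcomp Require Import complex spectral polyrcf.
From mathcomp Require Import all_classical all_reals all_analysis.
From mathcomp Require Import measurable_realfun.
From mathcomp Require Import ring lra zify.

(** Let p_1, ..., p_m be densities of P_1, ..., P_m, let S be their sum, and
    let A be the overlap matrix, A i j = \int p_i p_j / S. The likelihood ratio
    of the permutation mixture to the mean field is an average, over the
    permutations, of products of the functions m p_i / S, and its second moment
    is per(m A) / m!. So the divergence is per(m A) / m! - 1
    ([chi2_div_permanent]), and everything is about this permanent. The matrix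
    A is symmetric, positive semidefinite, with row sums 1, so that m A = J + B
    where J is the all-ones matrix and B is positive semidefinite with row
    sums 0.

    Upper bounds. Factor J + B as a Gram matrix over the column of ones and the
    eigenvectors of B, and expand the permanent: it is a sum over maps f from
    rows to columns, in which each f is weighted by the product of the
    factorials of its fibre sizes. Without the factorials, and with formal
    variables x_k on the columns, AM-GM and an average over phases bound the sum
    by a power of x_0 + sum_k mu_k x_k, for all x >= 0, where the mu_k are the
    eigenvalues of B / m. The functional that sends x^a to a! is positive, being
    integration against exp(-x); applying it to both sides gives

      per(J + B) / m! <= 1 / det(1 - B / m)        ([permanent_le_det]).

    The determinant is compared along a chain of partitions of the index set by
    dyadic cells of the parameter line. Refining a partition increases the
    overlap form; up to this, passing from K classes to 2 K classes is an update
    of rank 2 K, and each rank-one update costs a bounded factor because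
    densities of one class overlap ([lapl_refine]). In cells of length 1/6 the
    determinant is bounded below through the trace ([lapl_base]). With one cell
    of length B this gives exp(O(B^2)). For a longer parameter segment B is
    first multiplied by 1 - 1/n, which costs a constant; then each of the
    B / sqrt(ln n) cells of length sqrt(ln n) costs at most a power of n
    ([second_moment_le_long]). For a short segment the permanent of J + t B has
    no linear term in t, so the divergence is quadratic in the trace of B / m
    ([second_moment_le_small]).

    Lower bounds. Two parameters give the order B^4. Otherwise, take k well
    separated parameters, s times each, and keep only the permutations that
    preserve the groups: the permanent is at least of the order of
    k^(k s) (s!)^k / (k s)!, which is at least (2 s)^((k - 1) / 2) when k is a
    power of 2 ([block_ratio_pow2], [second_moment_groups]). The two ends of the
    segment yield exp(c B^2), and about B / sqrt(ln n) points at mutual distance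
    2 sqrt(ln n) yield exp(c B sqrt(ln n)).

    The two families. Both N(2 u - mu, 1) and Poi(u^2), with 0 <= u <= B and
    B = mu or B = sqrt M, have affinity \int sqrt(p_u p_v) = exp(-(u - v)^2 / 2),
    and the trace of the overlap matrix of a class of diameter L is at most
    1 + 18 L^2. The argument uses only these two facts
    ([segment_family_regimes]). *)

Set Implicit Arguments.
Unset Strict Implicit.
Unset Printing Implicit Defensive.

Import Order.TTheory GRing.Theory Num.Def Num.Theory.

Local Open Scope classical_set_scope.
Local Open Scope ring_scope.

(** * Permutations, fibre sizes and permanents *)

Lemma sum_perm_recl (V : nmodType) n (F : 'S_n.+1 -> V) :
  \sum_s F s = \sum_(j < n.+1) \sum_(s : 'S_n) F (lift_perm ord0 j s).
Proof.
rewrite pair_big (reindex (fun p : 'I_n.+1 * 'S_n => lift_perm ord0 p.1 p.2))//=.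
apply/onW_bij/inj_card_bij; last first.
  by rewrite card_prod card_ord !card_Sn factS.
move=> [j s] [j' s'] /= E; have jj' : j = j'.
  by have := congr1 (fun t : 'S_n.+1 => t ord0) E; rewrite !lift_perm_id.
rewrite -jj' in E *; congr pair; apply/permP => i; apply: (@lift_inj _ j).
by have := congr1 (fun t : 'S_n.+1 => t (lift ord0 i)) E; rewrite !lift_perm_lift.
Qed.

Section FiberCount.
Variable K : finType.
Implicit Type k : K.

Definition mult m (f : 'I_m -> K) k : nat := \sum_(i < m) (f i == k).

Definition same_type m (f g : 'I_m -> K) := [forall k, mult f k == mult g k].

Lemma mult_recl m (f : 'I_m.+1 -> K) j k :
  mult f k = ((f j == k) + mult (f \o lift j) k)%N.
Proof.
rewrite /mult (bigD1 j) //=; congr (_ + _)%N.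
rewrite (eq_bigl (fun i => j != i)); last by move=> i; rewrite eq_sym.
rewrite big_mkcond /=.
case: m f j => [|m] f j.
  by rewrite big_ord0 big_ord_recl big_ord0 !ord1 eqxx.
rewrite -big_mkcond /= (reindex (lift j)) /=.
  by apply: eq_bigl => i; rewrite neq_lift.
exists (fun i => odflt ord0 (unlift j i)) => i; first by rewrite liftK.
by rewrite inE => /unlift_some[i' -> ->].
Qed.

(** The permutations that carry [g] to [f] are assembled fibre by fibre, with
    [(mult f k)`!] choices over [k]. *)
Lemma card_matching m (f g : 'I_m -> K) :
  (\sum_(s : 'S_m) \prod_(i < m) (g (s i) == f i))%N =
  (if same_type f g then \prod_k (mult f k)`! else 0)%N.
Proof.
elim: m f g => [|m IH] f g.
  have -> : same_type f g by apply/forallP => k; rewrite /mult !big_ord0.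
  rewrite [RHS]big1 => [|k _]; last by rewrite /mult big_ord0.
  rewrite (big_pred1 (1%g : 'S_0)) ?big_ord0 // => s; symmetry; apply/eqP.
  by apply/permP => -[].
rewrite sum_perm_recl.
pose f' := f \o lift ord0.
transitivity (\sum_(j < m.+1) (g j == f ord0) *
    (if same_type f g then \prod_k (mult f' k)`! else 0))%N.
  apply: eq_bigr => j _.
  transitivity ((g j == f ord0) * (if same_type f' (g \o lift j)
      then \prod_k (mult f' k)`! else 0))%N; last first.
    case: eqP => [gj|]; last by rewrite !mul0n.
    congr (_ * (if _ then _ else _))%N; apply: eq_forallb => k.
    by rewrite (mult_recl f ord0) (mult_recl g j) gj eqn_add2l.
  rewrite -IH big_distrr /=; apply: eq_bigr => s _.
  rewrite big_ord_recl lift_perm_id; congr (_ * _)%N.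
  by apply: eq_bigr => i _; rewrite lift_perm_lift.
rewrite -big_distrl /=; case: ifP => [/forallP fg|_]; last by rewrite muln0.
rewrite -/(mult g (f ord0)) -(eqP (fg _)).
rewrite [RHS](bigD1 (f ord0)) //= [in LHS](bigD1 (f ord0)) //= mulnA.
congr (_ * _)%N.
  by rewrite (mult_recl f ord0) eqxx add1n factS.
apply: eq_bigr => k kf; rewrite (mult_recl f ord0) eq_sym (negPf kf).
by rewrite add0n.
Qed.

End FiberCount.

Section Permanent.
Variable R : comNzRingType.

Definition permanent m (A : 'M[R]_m) := \sum_(s : 'S_m) \prod_i A i (s i).

End Permanent.

(** * Factorials as a positive functional on polynomials *)

(** The value q(0) is the integral of p(x) exp(-x) over the half-line. Without
    integrals: if q(0) < 0 then q, whose leading coefficient is that of p and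
    thus positive, has a least positive root y; by the mean value theorem q' is
    positive somewhere before y, where q is still negative, so p is negative
    there. *)
Lemma sum_derivn_ge0 (R : rcfType) (p q : {poly R}) :
  q - q^`() = p -> (forall x, 0 <= x -> 0 <= p.[x]) -> 0 <= q.[0].
Proof.
move=> qp p_ge0; have [->|q0] := eqVneq q 0; first by rewrite horner0.
have lcE : lead_coef q = lead_coef p.
  by rewrite -qp lead_coefDl// size_polyN lt_size_deriv.
have lc_gt0 : 0 < lead_coef q.
  rewrite lt_neqAle eq_sym lead_coef_eq0 q0 /= lcE leNgt; apply/negP => lcN.
  have [|n] := @poly_pinfty_gt_lc _ (- p); first by rewrite lead_coefN oppr_gt0.
  rewrite lead_coefN => /(_ (Num.max n 0)).
  rewrite le_max lexx => /(_ isT); rewrite hornerN.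
  have := p_ge0 (Num.max n 0); rewrite le_max lexx orbT => /(_ isT); lra.
rewrite leNgt; apply/negP => q_lt0.
have [n Hn] := poly_pinfty_gt_lc lc_gt0.
pose b := Num.max n 1.
have b_gt0 : 0 < b by rewrite lt_max ltr01 orbT.
have qb : 0 < q.[b] by apply: lt_le_trans lc_gt0 (Hn _ _); rewrite le_max lexx.
have [y0 y0in ry0] : {x | x \in `]0, b[ & root q x}.
  by apply: poly_ivtoo; rewrite ?(ltW b_gt0)// nmulr_rlt0.
have : q.[next_root q 0 b] = 0 /\ next_root q 0 b \in `]0, b[.
  case: next_rootP => [/eqP|y _ -> //|c _ _ /(_ _ y0in)].
    by rewrite (negPf q0).
  by rewrite ry0.
move: (@next_noroot _ q 0 b); set y := next_root q 0 b => noroot_y [qy0 yin].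
have y_gt0 : 0 < y by rewrite (itvP yin).
have [c cin] := poly_mvt q y_gt0.
rewrite qy0 sub0r subr0 => qc.
have c_gt0 : 0 < c by rewrite (itvP cin).
have qc_lt0 : q.[c] < 0.
  rewrite ltNge; apply/negP => qc_ge0.
  have qc0 : q.[c] != 0 by have := noroot_y _ cin; rewrite rootE.
  have [z zin rz] : {x | x \in `]0, c[ & root q x}.
    apply: poly_ivtoo; rewrite ?(ltW c_gt0)// nmulr_rlt0//.
    by rewrite lt_neqAle eq_sym qc0.
  have : z \in `]0, y[.
    by move: zin cin; rewrite !in_itv /= => /andP[-> zc] /andP[_ /(lt_trans zc)].
  by move=> /noroot_y; rewrite rz.
have := p_ge0 _ (ltW c_gt0); rewrite -qp hornerD hornerN => pc.
have : 0 < q^`().[c] * y by rewrite -qc oppr_gt0.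
rewrite pmulr_lgt0// ltNge => /negP; apply.
by apply: ltW; apply: le_lt_trans qc_lt0; rewrite -subr_ge0.
Qed.

(** Positivity of the functional that sends x^a to a!, realized as the value at
    0 of the sum of all derivatives. *)
Lemma sum_factorial_ge0 (R : rcfType) (I : finType) (c : I -> R)
    (e : I -> nat) :
  (forall x, 0 <= x -> 0 <= \sum_i c i * x ^+ e i) ->
  0 <= \sum_i c i * (e i)`!%:R.
Proof.
move=> c_ge0; pose N := (\sum_i e i).+1.
have eN i : (e i < N)%N by rewrite ltnS (bigD1 i)//= leq_addr.
pose p : {poly R} := \sum_i c i *: 'X^(e i).
pose q : {poly R} := \sum_(n < N) p^`(n).
have hornerp x : p.[x] = \sum_i c i * x ^+ e i.
  by rewrite horner_sum; apply: eq_bigr => i _; rewrite hornerZ hornerXn.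
have derivnp n : p^`(n) = \sum_i c i *: 'X^(e i)^`(n).
  rewrite /p; elim/big_rec2: _ => [|i y1 y2 _ <-]; first by rewrite derivnC if_same.
  by rewrite derivnD derivnZ.
have pN0 : p^`(N) = 0.
  rewrite derivnp big1// => i _; rewrite derivn_poly0 ?scaler0//.
  by rewrite size_polyXn.
have -> : \sum_i c i * (e i)`!%:R = q.[0].
  rewrite horner_sum.
  under [RHS]eq_bigr => n _ do rewrite derivnp horner_sum.
  rewrite exchange_big /=; apply: eq_bigr => i _.
  rewrite (bigD1 (Ordinal (eN i)))//= big1 ?addr0.
    by rewrite hornerZ derivnXn subnn hornerMn expr0 hornerC ffactnn.
  move=> n nei; rewrite hornerZ derivnXn hornerMn hornerXn.
  have [lt_ne|le_en] := ltnP (e i) n.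
    by rewrite ffact_small ?mulr0n ?mulr0.
  have : (e i - n != 0)%N.
    rewrite subn_eq0 -ltnNge ltn_neqAle le_en andbT.
    by apply: contraNN nei => /eqP ne; apply/eqP/val_inj.
  by case: (_ - _)%N => // k _; rewrite expr0n mul0rn mulr0.
apply: (@sum_derivn_ge0 _ p q) => [|x x0]; last by rewrite hornerp; exact: c_ge0.
rewrite /q; have -> : (\sum_(n < N) p^`(n))^`() = \sum_(n < N) p^`(n.+1).
  by rewrite raddf_sum; apply: eq_bigr => n _; rewrite derivnS.
rewrite big_ord_recl [X in _ - X]big_ord_recr [p^`(ord_max.+1)]pN0 Monoid.mulm1.
exact: addrK.
Qed.

(** The variables are replaced by factorials one at a time. *)
Lemma prod_factorial_ge0 (R : rcfType) (I K : finType) (c : I -> R)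
    (e : I -> K -> nat) :
  (forall x : K -> R, (forall k, 0 <= x k) ->
     0 <= \sum_i c i * \prod_k x k ^+ e i k) ->
  0 <= \sum_i c i * \prod_k (e i k)`!%:R.
Proof.
move=> c_ge0.
suff H (r : seq K) (x : K -> R) : (forall k, 0 <= x k) ->
    0 <= \sum_i c i * \prod_k (if k \in r then (e i k)`!%:R else x k ^+ e i k).
  have := H (enum K) (fun=> 0) (fun=> lexx 0); congr (0 <= _).
  apply: eq_bigr => i _; congr (_ * _); apply: eq_bigr => k _.
  by rewrite mem_enum inE.
elim: r x => [|k0 r IH] x x_ge0; first exact: c_ge0.
have [k0r|k0r] := boolP (k0 \in r).
  have := IH x x_ge0; congr (0 <= _); apply: eq_bigr => i _; congr (_ * _).
  apply: eq_bigr => k _; rewrite inE; case: (eqVneq k k0) => //= ->.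
  by rewrite k0r.
pose d i := c i *
  \prod_(k | k != k0) (if k \in r then (e i k)`!%:R else x k ^+ e i k).
have -> : \sum_i c i * \prod_k
    (if k \in k0 :: r then (e i k)`!%:R else x k ^+ e i k) =
    \sum_i d i * (e i k0)`!%:R.
  apply: eq_bigr => i _; rewrite (bigD1 k0)//= inE eqxx /= mulrCA mulrC.
  congr (_ * _ * _); apply: eq_bigr => k kk0.
  by rewrite inE (negPf kk0).
apply: sum_factorial_ge0 => y y_ge0.
have -> : \sum_i d i * y ^+ e i k0 = \sum_i c i * \prod_k (if k \in r
    then (e i k)`!%:R else (if k == k0 then y else x k) ^+ e i k).
  apply: eq_bigr => i _; rewrite [in RHS](bigD1 k0)//= (negPf k0r) eqxx /d.
  rewrite -mulrA [_ * y ^+ _]mulrC; congr (_ * (_ * _)).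
  by apply: eq_bigr => k kk0; rewrite (negPf kk0).
by apply: IH => k; case: ifP.
Qed.

(** * Permanents of Gram matrices *)

Lemma prod_mult (R : comNzRingType) (K : finType) m (f : 'I_m -> K)
    (y : K -> R) :
  \prod_i y (f i) = \prod_k y k ^+ mult f k.
Proof.
under [RHS]eq_bigr => k _ do rewrite /mult -prodrXr.
rewrite exchange_big /=; apply: eq_bigr => i _.
rewrite (bigD1 (f i))//= eqxx expr1 big1 ?mulr1// => k kf.
by rewrite eq_sym (negPf kf) expr0.
Qed.

Lemma mult_le m (K : finType) (f : 'I_m -> K) k : (mult f k <= m)%N.
Proof.
rewrite -[leqRHS]card_ord -sum1_card; apply: leq_sum => i _.
by case: (_ == _).
Qed.

(** A power of 2 suffices: a 2^n-th root of -1 has order 2^(n+1). *)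
Lemma exists_primitive_root (C : numClosedFieldType) n :
  exists2 N, (n < N)%N & exists z : C, N.-primitive_root z.
Proof.
pose N := (2 ^ n)%N; have N_gt0 : (0 < N)%N by rewrite expn_gt0.
exists (2 ^ n.+1)%N; first by apply: ltn_trans (ltn_expl _ _); rewrite ?ltnS.
pose z : C := N.-root (-1).
have zN : z ^+ N = -1 by rewrite rootCK.
have z1 : z ^+ (2 ^ n.+1) = 1 by rewrite expnSr exprM zN -signr_odd.
have [|M primz] := prim_order_exists _ z1; first by rewrite expn_gt0.
move=> /(dvdn_pfactor _ _ (isT : prime 2))[e].
rewrite leq_eqVlt => /orP[/eqP -> <-|en ME]; first by exists z.
have : z ^+ N = 1.
  have /dvdnP[c ->] : (M %| N)%N by rewrite ME dvdn_exp2l.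
  by rewrite mulnC exprM (prim_expr_order primz) expr1n.
rewrite zN => /eqP; rewrite eq_sym -addr_eq0.
by rewrite (_ : 1 + 1 = 2%:R)// pnatr_eq0.
Qed.

Lemma sum_phases (C : numClosedFieldType) N (z : C) a b :
  N.-primitive_root z -> (a < N)%N -> (b < N)%N ->
  \sum_(j < N) (z ^+ j) ^+ a * ((z ^+ j) ^+ b)^* = (a == b)%:R * N%:R.
Proof.
move=> primz aN bN; have N0 : (0 < N)%N by exact: leq_ltn_trans aN.
have zz : z * z^* = 1.
  rewrite -normCK; have : `|z| ^+ N = 1.
    by rewrite -normrX (prim_expr_order primz) normr1.
  by move/eqP; rewrite pexprn_eq1// gtn_eqF//= => /eqP ->; rewrite expr1n.
pose u := z ^+ a * (z ^+ b)^*.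
have uj (j : nat) : (z ^+ j) ^+ a * ((z ^+ j) ^+ b)^* = u ^+ j.
  by rewrite exprAC [X in _ * X^*]exprAC rmorphXn -exprMn.
under eq_bigr do rewrite uj.
have uE : u * z ^+ b = z ^+ a.
  by rewrite -mulrA rmorphXn/= -exprMn [_^* * _]mulrC zz expr1n mulr1.
have [ab|ab] := eqVneq a b.
  have -> : u = 1.
    by rewrite /u ab rmorphXn/= -exprMn zz expr1n.
  under eq_bigr do rewrite expr1n.
  by rewrite sumr_const card_ord mul1r.
rewrite mul0r; have u1 : u - 1 != 0.
  rewrite subr_eq0; apply: contra_neq ab => u1.
  move: uE; rewrite u1 mul1r => /eqP; rewrite (eq_prim_root_expr primz).
  by rewrite !modn_small// => /eqP.
apply: (mulfI u1); rewrite mulr0 -subrX1; apply/eqP; rewrite subr_eq0.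
rewrite exprMn -rmorphXn/= -!exprM ![(_ * N)%N]mulnC !exprM.
by rewrite (prim_expr_order primz) !expr1n conjC1 mulr1.
Qed.

Section Gram.
Variables (C : numClosedFieldType) (m : nat) (K : finType).
Variable G : 'I_m -> K -> C.
Implicit Types (f g : {ffun 'I_m -> K}).

(** The monomial of the map [f] from rows to columns, and below its
    symmetrization over the rows. *)
Definition monom f := \prod_i G i (f i).

Lemma prod_sum_monom (y : K -> C) :
  \prod_i \sum_k G i k * y k = \sum_(f : {ffun _ -> K}) monom f * \prod_k y k ^+ mult f k.
Proof.
rewrite bigA_distr_bigA/=; apply: eq_bigr => f _.
by rewrite big_split/= prod_mult.
Qed.

Definition monom_sym f := \sum_(s : 'S_m) \prod_i G i (f (s i)).

(** With weights [y] on the columns, the permanent of a Gram matrix is a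
    polynomial in [y] whose coefficients are indexed by maps from rows to
    columns. *)
Lemma gram_permanentE (y : K -> C) :
  \sum_(s : 'S_m) \prod_i \sum_k y k * (G i k * (G (s i) k)^*) =
  \sum_(f : {ffun _ -> K}) (\prod_i y (f i)) * (monom f * (monom_sym f)^*).
Proof.
under eq_bigr => s _ do rewrite bigA_distr_bigA/=.
rewrite exchange_big/=; apply: eq_bigr => f _.
rewrite /monom_sym rmorph_sum/= !mulr_sumr (reindex_inj (@invg_inj _))/=.
apply: eq_bigr => s _; rewrite big_split/= big_split/=; congr (_ * (_ * _)).
rewrite rmorph_prod/= (reindex_inj (@perm_inj _ s))/=.
by apply: eq_bigr => i _; rewrite permK.
Qed.

Lemma monom_symE f :
  monom_sym f = \sum_(g : {ffun _ -> K} | same_type f g) monom g * (\prod_k (mult f k)`!)%:R.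
Proof.
transitivity (\sum_(g : {ffun 'I_m -> K}) monom g *
    (\sum_(s : 'S_m) \prod_(i < m) (f (s i) == g i))%:R).
  under [RHS]eq_bigr => g _ do rewrite natr_sum mulr_sumr.
  rewrite exchange_big/=; apply: eq_bigr => s _.
  rewrite (bigD1 [ffun i => f (s i)])//= [X in _ + X]big1 ?addr0.
    rewrite [X in X%:R]big1; last by move=> i _; rewrite ffunE eqxx.
    by rewrite mulr1; apply: eq_bigr => i _; rewrite ffunE.
  move=> g gf; have [i gi] : exists i, f (s i) != g i.
    apply/existsP; apply: contraNT gf; rewrite negb_exists => /forallP fg.
    by apply/eqP/ffunP => i; rewrite ffunE; apply/esym/eqP; have := fg i; rewrite negbK.
  by rewrite (bigD1 i)//= (negPf gi) mul0n mulr0.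
rewrite [RHS]big_mkcond/=; apply: eq_bigr => g _; rewrite card_matching.
have -> : same_type g f = same_type f g by apply: eq_forallb => k; rewrite eq_sym.
case: ifPn => [/forallP fg|]; last by rewrite mulr0.
by congr (_ * _%:R); apply: eq_bigr => k _; rewrite (eqP (fg k)).
Qed.

(** Averaging the expansion over row permutations turns its coefficients into
    squares, which shows that they are nonnegative. *)
Lemma sum_sqr_monom_sym (y : K -> C) :
  (m`!)%:R * (\sum_(f : {ffun _ -> K}) (\prod_i y (f i)) * (monom f * (monom_sym f)^*)) =
  \sum_(f : {ffun _ -> K}) (\prod_i y (f i)) * `|monom_sym f| ^+ 2.
Proof.
have symM f (s : 'S_m) : monom_sym [ffun i => f (s i)] = monom_sym f.
  rewrite /monom_sym [RHS](reindex_inj (@mulIg _ s))/=.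
  by apply: eq_bigr => t _; apply: eq_bigr => i _; rewrite ffunE permM.
transitivity (\sum_(s : 'S_m) \sum_(f : {ffun _ -> K}) (\prod_i y (f (s i))) *
    ((\prod_i G i (f (s i))) * (monom_sym f)^*)).
  rewrite mulr_natl -card_Sn -sumr_const; apply: eq_bigr => s _.
  pose h f : {ffun 'I_m -> K} := [ffun i => f (s i)].
  have hI : injective h.
    move=> f1 f2 /ffunP E; apply/ffunP => i.
    by have := E ((s^-1)%g i); rewrite !ffunE permKV.
  rewrite (reindex_inj hI)/=; apply: eq_bigr => f _.
  rewrite symM /monom; congr (_ * (_ * _)).
  - by apply: eq_bigr => i _; rewrite ffunE.
  - by apply: eq_bigr => i _; rewrite ffunE.
rewrite exchange_big/=; apply: eq_bigr => f _.
rewrite normCK /monom_sym mulr_suml mulr_sumr; apply: eq_bigr => s _.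
by rewrite [in RHS](reindex_inj (@perm_inj _ s)).
Qed.

End Gram.

Section GramBound.
Variables (C : numClosedFieldType) (m : nat) (K : finType).
Variable G : 'I_m.+1 -> K -> C.
Variable mu : K -> C.
Hypothesis G_orth : forall k l,
  \sum_i G i k * (G i l)^* = (k == l)%:R * (m.+1%:R * mu k).

(** AM-GM for the squared moduli of the [m] factors; their mean is computed from
    the orthogonality of the columns. *)
Lemma sqr_prod_gram_le (y : K -> C) :
  `|\prod_i \sum_k G i k * y k| ^+ 2 <= (\sum_k mu k * `|y k| ^+ 2) ^+ m.+1.
Proof.
rewrite normr_prod -prodrXl.
have E_ge0 : {in 'I_m.+1, forall i, 0 <= `|\sum_k G i k * y k| ^+ 2}.
  by move=> i _; rewrite exprn_ge0.
have := (leif_AGM E_ge0).1.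
rewrite card_ord.
rewrite (eq_bigl xpredT) => [|i]; last by rewrite inE.
rewrite [X in X / _](eq_bigl xpredT) => [|i]; last by rewrite inE.
move/le_trans; apply; rewrite le_eqVlt; apply/orP; left.
apply/eqP; congr (_ ^+ _).
apply: (@mulIf _ m.+1%:R); first by rewrite pnatr_eq0.
rewrite divfK ?pnatr_eq0//.
under eq_bigr => i _ do rewrite normCK rmorph_sum/= big_distrlr/=.
rewrite exchange_big/= mulr_suml; apply: eq_bigr => k _.
rewrite exchange_big/= (bigD1 k)//= [X in _ + X]big1 ?addr0.
  under eq_bigr => i _ do rewrite rmorphM/= mulrACA.
  by rewrite -mulr_suml G_orth eqxx mul1r normCK -mulrA mulrC mulrA.
move=> l lk; under eq_bigr => i _ do rewrite rmorphM/= mulrACA.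
by rewrite -mulr_suml G_orth eq_sym (negPf lk) !mul0r.
Qed.

(** Take y_k = sqrt x_k times an independent random N-th root of unity with
    N > m. The expectation of the left-hand side of [sqr_prod_gram_le] retains
    exactly the products of monomials of the same type. *)
Lemma sum_same_type_le (x : K -> C) : (forall k, 0 <= x k) ->
  \sum_(f : {ffun 'I_m.+1 -> K}) (\prod_k x k ^+ mult f k) *
    (monom G f * (\sum_(g : {ffun _ -> K} | same_type f g) monom G g)^*)
  <= (\sum_k mu k * x k) ^+ m.+1.
Proof.
move=> x_ge0; have [N mN [z primz]] := exists_primitive_root C m.+1.
pose y (j : {ffun K -> 'I_N}) k := sqrtC (x k) * z ^+ j k.
have z1 : `|z| = 1.
  have : `|z| ^+ N = 1 by rewrite -normrX (prim_expr_order primz) normr1.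
  move/eqP; rewrite pexprn_eq1// gtn_eqF//= ?(leq_ltn_trans _ mN)//.
  by move=> /eqP.
have yx j k : `|y j k| ^+ 2 = x k.
  by rewrite normrM normrX z1 expr1n mulr1 ger0_norm ?sqrtC_ge0// sqrtCK.
have N_gt0 : 0 < (N ^ #|K|)%:R :> C.
  by rewrite ltr0n expn_gt0 (leq_ltn_trans _ mN).
rewrite -(ler_pM2l N_gt0).
rewrite [leRHS](_ : _ = \sum_(j : {ffun K -> 'I_N})
    (\sum_k mu k * x k) ^+ m.+1); last first.
  by rewrite sumr_const card_ffun card_ord mulr_natl.
rewrite [leLHS](_ : _ = \sum_(j : {ffun K -> 'I_N})
    `|\prod_i \sum_k G i k * y j k| ^+ 2); last first.
  under [RHS]eq_bigr => j _.
    rewrite prod_sum_monom normCK rmorph_sum/= big_distrlr/=; over.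
  rewrite exchange_big/= mulr_sumr; apply: eq_bigr => f _.
  rewrite exchange_big/= rmorph_sum/= !mulr_sumr big_mkcond/=.
  apply: eq_bigr => g _.
  transitivity (monom G f * (monom G g)^* *
      (\sum_(j : {ffun K -> 'I_N}) \prod_k
         (y j k ^+ mult f k * (y j k ^+ mult g k)^*))); last first.
    rewrite mulr_sumr; apply: eq_bigr => j _.
    rewrite [in RHS]rmorphM/= [RHS]mulrACA rmorph_prod [in RHS]rmorph_prod/=.
    by rewrite big_split.
  pose F k (j : 'I_N) := (sqrtC (x k)) ^+ (mult f k + mult g k) *
    ((z ^+ j) ^+ mult f k * ((z ^+ j) ^+ mult g k)^*).
  have -> : \sum_(j : {ffun K -> 'I_N}) \prod_k
         (y j k ^+ mult f k * (y j k ^+ mult g k)^*) =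
      \prod_k \sum_(j < N) F k j.
    rewrite bigA_distr_bigA/=; apply: eq_bigr => j _; apply: eq_bigr => k _.
    rewrite /F /y !exprMn rmorphM/= mulrACA; congr (_ * _).
    by rewrite exprD conj_Creal ?rpredX ?ger0_real ?sqrtC_ge0.
  under [in RHS]eq_bigr => k _ do
    rewrite -mulr_sumr (sum_phases primz) ?(leq_ltn_trans (mult_le _ _))//.
  case: ifPn => [/forallP fg|].
    under [in RHS]eq_bigr => k _ do
      rewrite fg mul1r -(eqP (fg k)) addnn -mul2n exprM sqrtCK.
    rewrite big_split/= prodr_const natrX.
    rewrite [RHS]mulrC -[RHS]mulrA [RHS]mulrCA.
    by congr (_ ^+ _ * _).
  rewrite negb_forall => /existsP[k kfg].
  by rewrite (bigD1 k)//= (negPf kfg) mul0r mulr0 mul0r mulr0.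
by apply: ler_sum => j _; apply: le_trans (sqr_prod_gram_le _) _;
  under eq_bigr do rewrite yx.
Qed.

End GramBound.

Lemma sum_mult (K : finType) m (f : 'I_m -> K) : (\sum_k mult f k = m)%N.
Proof.
rewrite exchange_big/= -[RHS]card_ord -sum1_card; apply: eq_bigr => i _.
rewrite (bigD1 (f i))//= eqxx big1// => k kf.
by rewrite eq_sym (negPf kf).
Qed.

Lemma big_optionE (R : Type) (idx : R) (op : Monoid.com_law idx) (K : finType)
    (F : option K -> R) :
  \big[op/idx]_k F k = op (F None) (\big[op/idx]_k F (Some k)).
Proof.
rewrite (bigD1 None)//=; congr (op _ _).
rewrite (reindex_omap Some id)/=; first by apply: eq_bigl => k; rewrite eqxx.
by case.
Qed.

Lemma card_same_type (K : finType) m (f0 : {ffun 'I_m -> K}) :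
  (\sum_(f : {ffun 'I_m -> K} | same_type f f0) \prod_k (mult f k)`! = m`!)%N.
Proof.
transitivity (\sum_(f : {ffun 'I_m -> K}) \sum_(s : 'S_m)
    \prod_(i < m) (f0 (s i) == f i))%N.
  by rewrite big_mkcond/=; apply: eq_bigr => f _; rewrite card_matching.
rewrite exchange_big/= -card_Sn -sum1_card; apply: eq_bigr => s _.
rewrite (bigD1 [ffun i => f0 (s i)])//= [X in (X + _)%N]big1; last first.
  by move=> i _; rewrite ffunE eqxx.
rewrite big1// => f ff0.
have [i fi] : exists i, f0 (s i) != f i.
  apply/existsP; apply: contraNT ff0; rewrite negb_exists => /forallP ff0.
  apply/eqP/ffunP => i; rewrite ffunE; apply/esym/eqP.
  by have := ff0 i; rewrite negbK.
by rewrite (bigD1 i)//= (negPf fi) mul0n.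
Qed.

Lemma sum_geometric_le (R : realFieldType) n (x : R) : 0 <= x -> x < 1 ->
  \sum_(a < n) x ^+ a <= (1 - x)^-1.
Proof.
move=> x0 x1; have x1' : 0 < 1 - x by rewrite subr_gt0.
rewrite -(ler_pM2l x1') mulfV ?gt_eqF// -opprB mulNr -subrX1 opprB.
by rewrite gerBl exprn_ge0.
Qed.

(** The maps of a given type number m! divided by the product of the factorials
    ([card_same_type]), so each type contributes m! times a monomial in [mu].
    The multiplicity of [None], which has weight 1, is determined by the others,
    and the sum over types is a product of truncated geometric series. *)
Lemma sum_monom_factorial_le (R : realFieldType) (K : finType) m (mu : K -> R) :
  (forall k, 0 <= mu k < 1) ->
  \sum_(f : {ffun 'I_m -> option K}) (\prod_i oapp mu 1 (f i)) *
    (\prod_k (mult f k)`!)%:R <= m`!%:R * \prod_k (1 - mu k)^-1.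
Proof.
move=> mu01; pose key (f : {ffun 'I_m -> option K}) : {ffun K -> 'I_m.+1} :=
  [ffun k => inord (mult f (Some k))].
have keyE f k : key f k = mult f (Some k) :> nat.
  by rewrite ffunE inordK// ltnS mult_le.
apply: (@le_trans _ _ (m`!%:R * \prod_k \sum_(a < m.+1) mu k ^+ a)); last first.
  rewrite ler_wpM2l// ler_prod// => k _; have /andP[? ?] := mu01 k.
  by rewrite sum_geometric_le// andbT sumr_ge0// => a _; rewrite exprn_ge0.
rewrite bigA_distr_bigA/= mulr_sumr (partition_big key xpredT)//=.
apply: ler_sum => al _.
have mu_key f : key f == al ->
    \prod_i oapp mu 1 (f i) = \prod_k mu k ^+ al k.
  move=> /eqP <-; rewrite (prod_mult f (oapp mu 1)) big_optionE/= expr1n mul1r.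
  by apply: eq_bigr => k _; rewrite keyE.
under eq_bigr => f /mu_key E do rewrite E.
rewrite -mulr_sumr mulrC ler_wpM2r//.
  by apply: prodr_ge0 => k _; rewrite exprn_ge0//; case/andP: (mu01 k).
rewrite -natr_sum ler_nat.
have [f0 f0al|no] := pickP (fun f => key f == al); last by rewrite big_pred0.
rewrite -(card_same_type f0) [leqRHS]big_mkcond [leqLHS]big_mkcond/=.
apply: leq_sum => f _; case: ifP => // fal; rewrite ifT//.
have E k : mult f (Some k) = mult f0 (Some k).
  by rewrite -!keyE (eqP fal) (eqP f0al).
apply/forallP => -[k|]; first by rewrite E.
have := etrans (sum_mult f) (esym (sum_mult f0)).
rewrite !big_optionE/= (eq_bigr _ (fun k _ => E k)) => /eqP.
by rewrite eqn_add2r.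
Qed.

Section RealGram.
Local Open Scope complex_scope.
Variables (R : rcfType).
Implicit Types z : R[i].

Lemma Re_sum (I : Type) (r : seq I) (P : pred I) (F : I -> R[i]) :
  complex.Re (\sum_(i <- r | P i) F i) = \sum_(i <- r | P i) complex.Re (F i).
Proof. by apply: (big_morph (@complex.Re R)) => // -[a b] [c d]. Qed.

Lemma Re_mulRc (x : R) z : complex.Re (x%:C * z) = x * complex.Re z.
Proof. by case: z => a b; rewrite /= mul0r subr0. Qed.

Variables (K : finType) (m : nat) (G : 'I_m.+1 -> option K -> R[i]).
Variable mu : K -> R.
Hypothesis mu01 : forall k, 0 <= mu k < 1.
Hypothesis G_orth : forall k l, \sum_i G i k * ((G i l)^*)%R =
  (k == l)%:R * (m.+1%:R * (oapp mu 1 k)%:C).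

(** The polynomial inequality [sum_same_type_le] is pushed through the positive
    functional that sends x^a to a!. *)
Lemma gram_permanent_le :
  complex.Re (\sum_(s : 'S_m.+1) \prod_i \sum_k G i k * ((G (s i) k)^*)%R)
  <= m.+1`!%:R * \prod_k (1 - mu k)^-1.
Proof.
apply: le_trans (sum_monom_factorial_le m.+1 mu01).
pose r (f : {ffun 'I_m.+1 -> option K}) := complex.Re (monom G f *
  ((\sum_(g : {ffun _ -> option K} | same_type f g) monom G g)^*)%R).
have -> : complex.Re (\sum_(s : 'S_m.+1)
      \prod_i \sum_k G i k * ((G (s i) k)^*)%R) =
    \sum_(f : {ffun _ -> option K}) r f * (\prod_k (mult f k)`!)%:R.
  transitivity (complex.Re (\sum_(s : 'S_m.+1)
      \prod_i \sum_k 1 * (G i k * ((G (s i) k)^*)%R))).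
    congr complex.Re; apply: eq_bigr => s _; apply: eq_bigr => i _.
    by apply: eq_bigr => k _; rewrite mul1r.
  rewrite (gram_permanentE G (fun=> 1)) Re_sum; apply: eq_bigr => f _.
  rewrite big1// mul1r monom_symE -mulr_suml rmorphM/= mulrA mulrC.
  by rewrite conjC_nat -(rmorph_nat (real_complex R)) Re_mulRc mulrC.
rewrite -subr_ge0 -sumrB.
under eq_bigr => f _ do rewrite -mulrBl natr_prod.
apply: (prod_factorial_ge0
  (c := fun f : {ffun 'I_m.+1 -> option K} => \prod_i oapp mu 1 (f i) - r f)
  (e := fun f => mult f)) => x x_ge0.
have x_ge0' k : 0 <= (x k)%:C by rewrite ler0c.
have := sum_same_type_le G_orth x_ge0'.
rewrite lecE => /andP[_].
have -> : \sum_k (oapp mu 1 k)%:C * (x k)%:C =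
    (\sum_k oapp mu 1 k * x k)%:C.
  by rewrite rmorph_sum/=; apply: eq_bigr => k _; rewrite rmorphM.
rewrite -rmorphXn/= Re_sum => le_sum.
under eq_bigr => f _ do rewrite mulrBl; rewrite sumrB subr_ge0.
apply: le_trans (le_trans le_sum _).
  rewrite le_eqVlt; apply/orP; left; apply/eqP; apply: eq_bigr => f _.
  under [in RHS]eq_bigr => k _ do rewrite -rmorphXn.
  by rewrite -rmorph_prod Re_mulRc mulrC.
rewrite -[m.+1 in X in X <= _]card_ord -prodr_const bigA_distr_bigA/=.
rewrite le_eqVlt; apply/orP; left; apply/eqP; apply: eq_bigr => f _.
by rewrite big_split/= (prod_mult f x).
Qed.
End RealGram.

(** * Permanents of positive semidefinite perturbations of the all-ones matrix *)

Section Spectral.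
Local Open Scope complex_scope.
Variable R : rcfType.

Definition quad m (B : 'M[R]_m) (v : 'I_m -> R) :=
  \sum_i \sum_j v i * B i j * v j.

Variables (m : nat) (B : 'M[R]_m).
Hypothesis B_sym : forall i j, B i j = B j i.

(** The eigenvectors are taken complex. Their real and imaginary parts express
    each eigenvalue by values of the real form, so that bounds on the form bound
    the spectrum. *)
Lemma sym_spectral : exists U : 'M[R[i]]_m, exists d : 'I_m -> R,
  [/\ forall k l, \sum_i U k i * ((U l i)^*)%R = (k == l)%:R,
      forall i j, (B i j)%:C = \sum_k ((U k i)^*)%R * (d k)%:C * U k j,
      forall a b, \det (a%:M + b *: B) = \prod_k (a + b * d k) &
      forall k, d k = quad B (fun i => complex.Re (U k i)) +
                      quad B (fun i => complex.Im (U k i)) /\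
        \sum_i (complex.Re (U k i) ^+ 2 + complex.Im (U k i) ^+ 2) = 1].
Proof.
pose Bc := map_mx (real_complex R) B.
have Bc_herm : Bc \is hermsymmx.
  apply: realsym_hermsym; last first.
    by apply/mxOverP => i j; rewrite mxE; apply/complex_realP; exists (B i j).
  apply/is_hermitianmxP; rewrite /= expr0 scale1r map_mx_id//.
  by apply/matrixP => i j; rewrite !mxE B_sym.
have /orthomx_spectralP spE := hermitian_normalmx Bc_herm.
have sp_real := hermitian_spectral_diag_real Bc_herm.
have Uu := spectral_unitarymx Bc.
rewrite (invmx_unitary Uu) in spE.
set U := spectralmx Bc in spE Uu; set sp := spectral_diag Bc in spE sp_real.
pose d k := complex.Re (sp 0 k).
have dE k : (d k)%:C = sp 0 k.
  by rewrite RRe_real//; move/mxOverP: sp_real; apply.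
have /unitarymxP UUt := Uu.
have UtU : map_mx Num.conj U^T *m U = 1%:M by exact: mulmx1C.
have UU k l : \sum_i U k i * ((U l i)^*)%R = (k == l)%:R.
  have /matrixP/(_ k l) := UUt; rewrite !mxE => <-.
  by apply: eq_bigr => i _; rewrite !mxE.
have BE i j : (B i j)%:C = \sum_k ((U k i)^*)%R * (d k)%:C * U k j.
  have /matrixP/(_ i j) := spE; rewrite !mxE => ->; apply: eq_bigr => k _.
  by rewrite mul_mx_diag !mxE dE.
exists U, d; split=> // [a b|k].
  have -> : \det (a%:M + b *: B) = complex.Re (\det (map_mx (real_complex R) (a%:M + b *: B))).
    by rewrite det_map_mx.
  have -> : map_mx (real_complex R) (a%:M + b *: B) =
      (map_mx Num.conj U^T) *m diag_mx (\row_k (a + b * d k)%:C) *m U.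
    rewrite (_ : diag_mx _ = (a%:C)%:M + (b%:C) *: diag_mx sp); last first.
      apply/matrixP => i j; rewrite !mxE -!dE; case: eqP => [->|_].
        by rewrite !mulr1n rmorphD rmorphM.
      by rewrite !mulr0n mulr0 addr0.
    rewrite mulmxDr mulmxDl -scalemxAr -scalemxAl -spE mul_mx_scalar.
    rewrite -scalemxAl UtU scalemx1 map_mxD map_scalar_mx map_mxZ.
    by [].
  rewrite !det_mulmx det_diag mulrAC -det_mulmx.
  rewrite UtU det1 mul1r; under eq_bigr => k _ do rewrite mxE.
  by rewrite -rmorph_prod.
have normE (z : R[i]) : z * (z^*)%R = (complex.Re z ^+ 2 + complex.Im z ^+ 2)%:C.
  by rewrite -normCK add_Re2_Im2.
split.
  have : (d k)%:C = \sum_i \sum_j U k i * (B i j)%:C * ((U k j)^*)%R.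
    transitivity (\sum_l (\sum_i U k i * ((U l i)^*)%R) * (d l)%:C *
        (\sum_j U l j * ((U k j)^*)%R)).
      rewrite (bigD1 k)//= !UU eqxx mul1r mulr1 big1 ?addr0// => l lk.
      by rewrite !UU eq_sym (negPf lk) !mul0r.
    under [RHS]eq_bigr => i _ do under eq_bigr => j _ do
      rewrite BE mulr_sumr mulr_suml.
    under [LHS]eq_bigr => l _ do rewrite mulr_suml mulr_suml.
    rewrite exchange_big/=; apply: eq_bigr => i _.
    rewrite [RHS]exchange_big/=; apply: eq_bigr => l _.
    by rewrite mulr_sumr; apply: eq_bigr => j _; rewrite !mulrA.
  move=> /(congr1 (@complex.Re R)) /= ->.
  rewrite Re_sum /quad -big_split; apply: eq_bigr => i _.
  rewrite Re_sum -big_split; apply: eq_bigr => j _.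
  case: (U k i) => a b; case: (U k j) => a' b' /=; ring.
have := UU k k; rewrite eqxx; under eq_bigr do rewrite normE.
by move=> /(congr1 (@complex.Re R)); rewrite Re_sum.
Qed.

End Spectral.

Section PermanentPSD.
Local Open Scope complex_scope.
Variables (R : rcfType) (m : nat) (B : 'M[R]_m.+1).
Hypothesis B_sym : forall i j, B i j = B j i.
Hypothesis B_sum0 : forall i, \sum_j B i j = 0.
Hypothesis B_ge0 : forall v, 0 <= quad B v.

(** Column [None] is the vector of ones and accounts for the all-ones matrix.
    Column [Some k] is an eigenvector of [B] scaled by the root of its
    eigenvalue; if this eigenvalue is not 0, the eigenvector is orthogonal to
    the vector of ones, which [B] annihilates. *)
Lemma psd_gram : exists G : 'I_m.+1 -> option 'I_m.+1 -> R[i],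
  exists d : 'I_m.+1 -> R,
  [/\ forall i, G i None = 1,
      forall i j, \sum_k G i (Some k) * ((G j (Some k))^*)%R = (B i j)%:C,
      forall k l, \sum_i G i k * ((G i l)^*)%R =
        (k == l)%:R * (m.+1%:R * (oapp (fun k => d k / m.+1%:R) 1 k)%:C),
      \det (1%:M - m.+1%:R^-1 *: B) = \prod_k (1 - d k / m.+1%:R) &
      forall k, 0 <= d k /\
        forall c, (forall v, quad B v <= c * \sum_i v i ^+ 2) -> d k <= c].
Proof.
have [U [d [UU BE detE dE]]] := sym_spectral B_sym.
have d_ge0 k : 0 <= d k by rewrite (dE k).1 addr_ge0.
pose G i k := oapp (fun k => (Num.sqrt (d k))%:C * ((U k i)^*)%R) 1 k.
have sqC k : ((Num.sqrt (d k))%:C^*)%R = (Num.sqrt (d k))%:C.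
  by apply: conj_Creal; apply/complex_realP; exists (Num.sqrt (d k)).
have GB i j : \sum_k G i (Some k) * ((G j (Some k))^*)%R = (B i j)%:C.
  rewrite BE; apply: eq_bigr => k _ /=.
  rewrite rmorphM/= conjCK sqC.
  rewrite mulrACA [RHS]mulrAC -rmorphM/= -expr2 sqr_sqrtr// mulrC.
  by rewrite mulrC.
have U0 k : d k != 0 -> \sum_i U k i = 0.
  move=> dk0; apply: (@mulfI _ ((d k)%:C)).
    by apply: contra_neq dk0 => /complexI.
  rewrite mulr0 mulr_sumr.
  have UB j : (d k)%:C * U k j = \sum_i U k i * (B i j)%:C.
    under eq_bigr => i _ do rewrite BE mulr_sumr.
    rewrite exchange_big/= (bigD1 k)//= [X in _ + X]big1 ?addr0.
      under eq_bigr => i _ do rewrite !mulrA.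
      by rewrite -!mulr_suml UU eqxx mul1r.
    move=> l lk; under eq_bigr => i _ do rewrite !mulrA.
    by rewrite -!mulr_suml UU eq_sym (negPf lk) !mul0r.
  under eq_bigr => j _ do rewrite UB.
  rewrite exchange_big/= big1// => i _.
  by rewrite -mulr_sumr -rmorph_sum B_sum0 mulr0.
have GS0 k : \sum_i G i (Some k) = 0.
  rewrite /G/= -mulr_sumr -rmorph_sum/=.
  have [->|/U0 ->] := eqVneq (d k) 0; first by rewrite sqrtr0 mul0r.
  by rewrite conjC0 mulr0.
exists G, d; split=> //.
- move=> [k|] [l|].
  + transitivity ((Num.sqrt (d k))%:C * (Num.sqrt (d l))%:C *
        \sum_i U l i * ((U k i)^*)%R).
      rewrite mulr_sumr; apply: eq_bigr => i _ /=.
      by rewrite rmorphM/= conjCK sqC mulrACA [X in _ * X]mulrC.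
    rewrite UU eq_sym (inj_eq Some_inj); case: eqP => [->|_] /=.
      rewrite mulr1 mul1r -rmorphM/= -expr2 sqr_sqrtr//.
      by rewrite -[m.+1%:R](rmorph_nat (real_complex R)) -rmorphM/= mulrC divfK ?pnatr_eq0.
    by rewrite mulr0 mul0r.
  + by under eq_bigr => i _ do rewrite conjC1 mulr1; rewrite GS0 mul0r.
  + under eq_bigr => i _ do rewrite mul1r.
    by rewrite -rmorph_sum/= (GS0 l) conjC0 mul0r.
  + under eq_bigr => i _ do rewrite conjC1 mulr1.
    by rewrite sumr_const card_ord eqxx mul1r mulr1.
- have := detE 1 (- m.+1%:R^-1); rewrite scaleNr => ->.
  by apply: eq_bigr => k _; rewrite mulNr mulrC.
move=> k; split=> // c Hc; have [-> n1] := dE k.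
by rewrite -[leRHS]mulr1 -n1 big_split/= mulrDr lerD.
Qed.

Lemma permanent_le_det c : c < m.+1%:R ->
  (forall v, quad B v <= c * \sum_i v i ^+ 2) ->
  permanent (const_mx 1 + B) <=
    m.+1`!%:R / \det (1%:M - m.+1%:R^-1 *: B).
Proof.
move=> cm Bc; have [G [d [G0 GB G_orth -> dE]]] := psd_gram.
rewrite -prodfV.
have mu01 k : 0 <= d k / m.+1%:R < 1.
  have [d0 dc] := dE k; rewrite divr_ge0//= ltr_pdivrMr// mul1r.
  exact: le_lt_trans (dc _ Bc) cm.
apply: le_trans (gram_permanent_le mu01 G_orth).
rewrite Re_sum /permanent; apply: ler_sum => s _.
rewrite le_eqVlt; apply/orP; left; apply/eqP.
under [in RHS]eq_bigr => i _ do
  rewrite big_optionE/= !G0 conjC1 mulr1 GB -(rmorph1 (real_complex R)) -rmorphD.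
by rewrite -rmorph_prod/=; apply: eq_bigr => i _; rewrite !mxE.
Qed.

(** The permanent of J + t B is a polynomial in t with nonnegative coefficients
    and no linear term: a map that takes exactly one value other than [None]
    contributes a column sum of the factor, which is 0. *)
Lemma permanent_scaleE : exists w : {ffun 'I_m.+1 -> option 'I_m.+1} -> R,
  [/\ forall f, 0 <= w f,
      forall f : {ffun 'I_m.+1 -> option 'I_m.+1}, (\sum_i (f i != None) = 1)%N -> w f = 0 &
      forall t, permanent (const_mx 1 + t *: B) =
        \sum_(f : {ffun 'I_m.+1 -> option 'I_m.+1}) w f * t ^+ (\sum_i (f i != None))].
Proof.
have [G [d [G0 GB G_orth _ _]]] := psd_gram.
exists (fun f => (m.+1`!%:R)^-1 * complex.Re (`|monom_sym G f| ^+ 2)); split.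
- move=> f; rewrite mulr_ge0 ?invr_ge0//.
  have : 0 <= `|monom_sym G f| ^+ 2 by rewrite exprn_ge0.
  by rewrite lecE => /andP[].
- move=> f f1; suff -> : monom_sym G f = 0 by rewrite normr0 expr0n mulr0.
  have [i0 fi0] : exists i0, f i0 != None.
    apply/existsP; apply: contraT; rewrite negb_exists => /forallP H.
    by move: f1; rewrite big1// => i _; rewrite (negPf (H i)).
  have fN i : i != i0 -> f i = None.
    move=> ii0; apply/eqP; have := f1; rewrite (bigD1 i0)//= fi0.
    by rewrite (bigD1 i)//=; case: (f i == None).
  case E : (f i0) fi0 => [k|] // _.
  have monomE (s : 'S_m.+1) : \prod_i G i (f (s i)) = G ((s^-1)%g i0) (Some k).
    rewrite (bigD1 ((s^-1)%g i0))//= permKV E big1 ?mulr1// => i si.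
    rewrite fN ?G0//; apply: contra_neq si => <-.
    by rewrite permK.
  rewrite /monom_sym; under eq_bigr => s _ do rewrite monomE.
  rewrite (reindex_inj (@invg_inj _))/=.
  under eq_bigr => s _ do rewrite invgK.
  pose X j := \sum_(s : 'S_m.+1) G (s j) (Some k).
  have XE j : X j = X i0.
    rewrite /X (reindex_inj (mulgI (tperm j i0)))/=; apply: eq_bigr => s _.
    by rewrite permM tpermL.
  rewrite -/(X i0); apply: (@mulfI _ m.+1%:R); first by rewrite pnatr_eq0.
  rewrite mulr0 mulr_natl -[X in _ *+ X]card_ord -sumr_const.
  under eq_bigr => j _ do rewrite -(XE j).
  rewrite /X exchange_big/= big1// => s _.
  transitivity (\sum_i G i (Some k) * ((G i None)^*)%R); last first.
    by rewrite G_orth mul0r.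
  rewrite [RHS](reindex_inj (@perm_inj _ s))/=.
  by apply: eq_bigr => j _; rewrite G0 conjC1 mulr1.
- move=> t; transitivity (complex.Re (\sum_(s : 'S_m.+1) \prod_i \sum_k
    (if k != None then t else 1)%:C * (G i k * ((G (s i) k)^*)%R))).
    rewrite Re_sum; apply: eq_bigr => s _.
    under [in RHS]eq_bigr => i _ do
      rewrite big_optionE/= !G0 conjC1 !mulr1 -mulr_sumr GB -rmorphM -rmorphD.
    by rewrite -rmorph_prod/=; apply: eq_bigr => i _; rewrite !mxE.
  rewrite (gram_permanentE G (fun k => (if k != None then t else 1)%:C)).
  have := sum_sqr_monom_sym G (fun k => (if k != None then t else 1)%:C).
  move/(congr1 (@complex.Re R)).
  rewrite -(rmorph_nat (real_complex R)) Re_mulRc => E.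
  apply: (@mulfI _ m.+1`!%:R); first by rewrite pnatr_eq0 -lt0n fact_gt0.
  rewrite E Re_sum mulr_sumr; apply: eq_bigr => f _.
  rewrite -rmorph_prod Re_mulRc !mulrA mulfV ?mul1r; last first.
    by rewrite pnatr_eq0 -lt0n fact_gt0.
  rewrite mulrC -prodrXr; congr (_ * _); apply: eq_bigr => i _.
  by case: (f i != None).
Qed.

Lemma permanent_shrink r : 0 <= r <= 1 ->
  r ^+ m.+1 * permanent (const_mx 1 + B) <= permanent (const_mx 1 + r *: B).
Proof.
move=> /andP[r0 r1]; have [w [w0 _ wE]] := permanent_scaleE.
rewrite -[B in leLHS]scale1r !wE mulr_sumr; apply: ler_sum => f _.
rewrite expr1n mulr1 mulrC ler_wpM2l// ler_wiXn2l//.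
by rewrite -[leqRHS]card_ord -sum1_card leq_sum// => i _; case: (_ != _).
Qed.

(** Without constant and linear terms, a polynomial with nonnegative
    coefficients grows at least like t^2 from 1 on. *)
Lemma permanent_expand t : 1 <= t ->
  t ^+ 2 * (permanent (const_mx 1 + B) - m.+1`!%:R) <=
  permanent (const_mx 1 + t *: B) - m.+1`!%:R.
Proof.
move=> t1; have t0 : 0 <= t by exact: le_trans t1.
have [w [w0 w1 wE]] := permanent_scaleE.
have perm0 : permanent (const_mx 1 + 0 *: B) = m.+1`!%:R.
  rewrite /permanent -card_Sn -sumr_const; apply: eq_big => [s|s _].
    by [].
  by rewrite big1// => i _; rewrite !mxE mul0r addr0.
rewrite -perm0 -[B in permanent (_ + B)]scale1r !wE -!sumrB mulr_sumr.
apply: ler_sum => f _; move: (w1 f).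
case: (\sum_i _)%N => [|[|n]] wf.
- by rewrite !expr0 subrr mulr0.
- by rewrite wf// !mul0r subrr mulr0.
rewrite expr1n expr0n/= !mulr0 !subr0 mulr1 mulrC ler_wpM2l//.
by rewrite ler_weXn2l.
Qed.

End PermanentPSD.

(** * Determinants and the Loewner order *)

Section Determinant.
Variable R : rcfType.
Implicit Types (m : nat).

(** The matrix inequality X >= c in the Loewner order. *)
Definition above m (X : 'M[R]_m) (c : R) :=
  forall v, c * \sum_i v i ^+ 2 <= quad X v.

Lemma det_sylvester (F : comNzRingType) m (u : 'cV[F]_m) (v : 'rV[F]_m) :
  \det (1%:M + u *m v) = 1 + (v *m u) 0 0.
Proof.
have E : block_mx (1%:M : 'M[F]_1) 0 u 1%:M *m
      block_mx 1%:M (- v) 0 (1%:M + u *m v) =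
    block_mx (1%:M + v *m u) (- v) 0 1%:M *m block_mx 1%:M 0 u 1%:M.
  rewrite !mulmx_block !mul1mx !mulmx1 !mul0mx !mulmx0 !addr0 !add0r.
  by rewrite mulNmx addrK mulmxN addrC addrK.
have /(congr1 determinant) := E; rewrite !det_mulmx.
rewrite !det_lblock !det_ublock !det1 !mul1r !mulr1 => ->.
by rewrite det_mx11 !mxE.
Qed.

Lemma det_above_gt0 m (X : 'M[R]_m) c : (forall i j, X i j = X j i) ->
  0 < c -> above X c -> 0 < \det X.
Proof.
move=> X_sym c0 Xc; have [U [d [_ _ detE dE]]] := sym_spectral X_sym.
have := detE 0 1; rewrite scale1r raddf0 add0r => ->.
apply: prodr_gt0 => k _; rewrite add0r mul1r.
apply: (lt_le_trans c0); have [-> n1] := dE k.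
by rewrite -[leLHS]mulr1 -n1 big_split/= mulrDr lerD.
Qed.

Lemma quadE m (X : 'M[R]_m) v :
  quad X v = ((\col_i v i)^T *m X *m \col_i v i) 0 0.
Proof.
rewrite /quad exchange_big/= mxE; apply: eq_bigr => j _.
rewrite !mxE mulr_suml; apply: eq_bigr => i _; by rewrite !mxE.
Qed.

Definition rank1 m (u : 'I_m -> R) : 'M[R]_m := \matrix_(i, j) (u i * u j).

(** The matrix determinant lemma: q is u^T X^-1 u. *)
Lemma det_rank1 m (X : 'M[R]_m) c (u : 'I_m -> R) :
  (forall i j, X i j = X j i) -> 0 < c -> above X c ->
  exists q, [/\ \det (X + rank1 u) = \det X * (1 + q), 0 <= q &
    q <= (\sum_i u i ^+ 2) / c].
Proof.
move=> X_sym c0 Xc; have detX := det_above_gt0 X_sym c0 Xc.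
have Xu : X \in unitmx by rewrite unitmxE unitfE gt_eqF.
pose U : 'cV[R]_m := \col_i u i; pose Y := invmx X *m U.
pose y i := Y i 0; have YE : Y = \col_i y i.
  by apply/matrixP => i j; rewrite [RHS]mxE ord1.
have XY : X *m Y = U by rewrite mulmxA mulmxV// mul1mx.
have qE : (U^T *m Y) 0 0 = quad X y.
  rewrite quadE -YE -mulmxA XY [LHS]mxE [RHS]mxE; apply: eq_bigr => i _.
  by rewrite [U^T _ _]mxE [Y^T _ _]mxE mulrC.
have yq : (U^T *m Y) 0 0 = \sum_i u i * y i.
  rewrite mxE; apply: eq_bigr => i _.
  by rewrite [U^T _ _]mxE [U _ _]mxE.
exists ((U^T *m Y) 0 0); split.
- have -> : X + rank1 u = X *m (1%:M + Y *m U^T).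
    rewrite mulmxDr mulmx1 mulmxA XY; congr (_ + _).
    by apply/matrixP => i j; rewrite !mxE big_ord1 !mxE.
  by rewrite det_mulmx det_sylvester.
- rewrite qE; apply: le_trans (Xc y); apply: mulr_ge0; first exact: ltW.
  by apply: sumr_ge0 => i _; exact: sqr_ge0.
(* with q = u.y and c|y|^2 <= q: 0 <= |u - c y|^2 <= |u|^2 - c q *)
rewrite ler_pdivlMr// -subr_ge0.
have uy_ge0 : 0 <= \sum_i (u i - c * y i) ^+ 2.
  by apply: sumr_ge0 => i _; exact: sqr_ge0.
have E : \sum_i (u i - c * y i) ^+ 2 = \sum_i u i ^+ 2 - c * (\sum_i u i * y i) *+ 2
    + c * (c * \sum_i y i ^+ 2).
  rewrite mulrA !mulr_sumr -sumrMnl -sumrB -big_split; apply: eq_bigr => i _ /=.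
  by ring.
have := Xc y; rewrite -qE yq => yq'.
have := ler_wpM2l (ltW c0) yq'; move: uy_ge0; rewrite E; lra.
Qed.

Lemma rank1_sym m (u : 'I_m -> R) i j : rank1 u i j = rank1 u j i.
Proof. by rewrite !mxE mulrC. Qed.

Lemma quadD m (X Y : 'M[R]_m) v : quad (X + Y) v = quad X v + quad Y v.
Proof.
rewrite /quad -big_split; apply: eq_bigr => i _; rewrite -big_split/=.
by apply: eq_bigr => j _; rewrite mxE mulrDr mulrDl.
Qed.

Lemma quadZ m c (X : 'M[R]_m) v : quad (c *: X) v = c * quad X v.
Proof.
rewrite /quad mulr_sumr; apply: eq_bigr => i _; rewrite mulr_sumr.
by apply: eq_bigr => j _; rewrite mxE mulrCA !mulrA.
Qed.

Lemma quad1 m v : quad (1%:M : 'M[R]_m) v = \sum_i v i ^+ 2.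
Proof.
apply: eq_bigr => i _; rewrite (bigD1 i)//= mxE eqxx mulr1 big1 ?addr0// => j ji.
by rewrite mxE eq_sym (negPf ji) mulr0 mul0r.
Qed.

Lemma quad_rank1 m (u v : 'I_m -> R) :
  quad (rank1 u) v = (\sum_i u i * v i) ^+ 2.
Proof.
rewrite expr2 big_distrlr/=; apply: eq_bigr => i _; apply: eq_bigr => j _.
by rewrite mxE; ring.
Qed.

Lemma above_rank1 m (X : 'M[R]_m) c u : above X c -> above (X + rank1 u) c.
Proof.
by move=> Xc v; rewrite quadD (le_trans (Xc v))// lerDl quad_rank1 sqr_ge0.
Qed.

(** By [det_rank1], each update multiplies the determinant by a number between 1
    and 1 + |u|^2 / c. *)
Lemma det_sum_rank1 m (X : 'M[R]_m) c n (u : 'I_n -> 'I_m -> R) :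
  (forall i j, X i j = X j i) -> 0 < c -> above X c ->
  [/\ forall i j, (X + \sum_k rank1 (u k)) i j = (X + \sum_k rank1 (u k)) j i,
      above (X + \sum_k rank1 (u k)) c,
      \det X <= \det (X + \sum_k rank1 (u k)) &
      (forall k, \sum_i u k i ^+ 2 <= 1) ->
      \det (X + \sum_k rank1 (u k)) <= (1 + c^-1) ^+ n * \det X].
Proof.
move=> X_sym c0 Xc; elim: n u => [|n IH] u.
  by rewrite big_ord0 addr0 expr0 mul1r; split.
have [sym ab lo up] := IH (fun k => u (widen_ord (leqnSn n) k)).
rewrite big_ord_recr/= addrA.
set Y := X + _ in sym ab lo up *.
have [q [-> q0 qu]] := det_rank1 (u ord_max) sym c0 ab.
have detX : 0 <= \det X by exact/ltW/(det_above_gt0 X_sym c0 Xc).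
split.
- by move=> i j; rewrite mxE sym [RHS]mxE rank1_sym.
- exact: above_rank1.
- by apply: (le_trans lo); rewrite ler_peMr ?lerDl// (le_trans detX).
- move=> u1; have c1 : 0 <= 1 + c^-1 by rewrite addr_ge0 ?invr_ge0 ?ltW.
  rewrite exprS -mulrA mulrC; apply: ler_pM.
  + by rewrite addr_ge0.
  + exact: le_trans lo.
  + by rewrite lerD2l (le_trans qu)// ler_pdivrMr// mulVf ?gt_eqF.
  + exact: up.
Qed.

(** The real and imaginary parts of the eigenvectors write Y - X as a sum of
    rank-one matrices. *)
Lemma le_det m (X Y : 'M[R]_m) c :
  (forall i j, X i j = X j i) -> (forall i j, Y i j = Y j i) ->
  0 < c -> above X c -> (forall v, quad X v <= quad Y v) ->
  \det X <= \det Y.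
Proof.
move=> X_sym Y_sym c0 Xc XY; pose B := Y - X.
have B_sym i j : B i j = B j i by rewrite !mxE X_sym Y_sym.
have B_ge0 v : 0 <= quad B v.
  by rewrite quadD -scaleN1r quadZ mulN1r subr_ge0.
have [U [d [_ BE _ dE]]] := sym_spectral B_sym.
have d_ge0 k : 0 <= d k by rewrite (dE k).1 addr_ge0.
pose a k i := Num.sqrt (d k) * complex.Re (U k i).
pose b k i := Num.sqrt (d k) * complex.Im (U k i).
have YE : Y = X + \sum_k rank1 (a k) + \sum_k rank1 (b k).
  rewrite -addrA -big_split/= -[LHS](subrK X) addrC; congr (_ + _).
  apply/matrixP => i j; rewrite summxE.
  have /(congr1 (@complex.Re R)) /= := BE i j; rewrite -/B => ->.
  rewrite Re_sum; apply: eq_bigr => k _; rewrite !mxE.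
  have := sqr_sqrtr (d_ge0 k); rewrite /a /b.
  set s := Num.sqrt _ => <-.
  case: (U k i) => x1 y1; case: (U k j) => x2 y2 /=; ring.
have [sym ab lo _] := det_sum_rank1 a X_sym c0 Xc.
by have [_ _ lo' _] := det_sum_rank1 b sym c0 ab; rewrite YE (le_trans lo).
Qed.

(** The largest eigenvalue is at most the trace, also for a principal
    submatrix. *)
Lemma quad_le_trace m (B : 'M[R]_m) (A : {set 'I_m}) v :
  (forall i j, B i j = B j i) -> (forall w, 0 <= quad B w) ->
  (forall i, i \notin A -> v i = 0) ->
  quad B v <= (\sum_(i in A) B i i) * \sum_(i in A) v i ^+ 2.
Proof.
move=> B_sym B_ge0 vA.
(* positivity of the form at v_j e_i - v_i e_j *)
have pair i j : v i * B i j * v j *+ 2 <= B i i * v j ^+ 2 + B j j * v i ^+ 2.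
  have [->|ij] := eqVneq i j; first by rewrite mulr2n lerD// expr2 mulrAC mulrA mulrC mulrA.
  have ji : j != i by rewrite eq_sym.
  have := B_ge0 (fun k => v j * (k == i)%:R - v i * (k == j)%:R).
  have -> : quad B (fun k => v j * (k == i)%:R - v i * (k == j)%:R) =
      B i i * v j ^+ 2 + B j j * v i ^+ 2 - v i * B i j * v j *+ 2.
    rewrite /quad (bigD1 i)//= [X in _ + X](bigD1 j)//=.
    rewrite [X in _ + (_ + X)]big1 ?addr0; last first.
      move=> k /andP[ki kj]; apply: big1 => l _.
      by rewrite (negPf ki) (negPf kj) !mulr0 subrr !mul0r.
    have inner (x : 'I_m) : \sum_l (v j * (x == i)%:R - v i * (x == j)%:R) * B x l *
        (v j * (l == i)%:R - v i * (l == j)%:R) =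
        (v j * (x == i)%:R - v i * (x == j)%:R) * (B x i * v j - B x j * v i).
      rewrite (bigD1 i)//= [X in _ + X](bigD1 j)//=.
      rewrite [X in _ + (_ + X)]big1 ?addr0; last first.
        move=> l /andP[li lj].
        by rewrite (negPf li) (negPf lj) !mulr0 subrr mulr0.
      by rewrite !eqxx (negPf ij) (negPf ji) !mulr0 !mulr1; ring.
    rewrite !inner !eqxx (negPf ij) (negPf ji) (B_sym j i) /= !mulr1n !mulr0n; ring.
  by rewrite subr_ge0.
have -> : quad B v = \sum_(i in A) \sum_(j in A) v i * B i j * v j.
  rewrite /quad [RHS]big_mkcond; apply: eq_bigr => i _; case: ifPn => iA.
    rewrite [RHS]big_mkcond; apply: eq_bigr => j _; case: ifPn => // jA.
    by rewrite (vA j jA) mulr0.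
  by apply: big1 => j _; rewrite (vA i iA) !mul0r.
rewrite big_distrlr/= -(@ler_pMn2r _ 2)//.
rewrite [leRHS]mulr2n [X in _ <= _ + X]exchange_big/= -big_split -sumrMnl.
apply: ler_sum => i _; rewrite -big_split -sumrMnl/=; apply: ler_sum => j _.
exact: pair.
Qed.

End Determinant.

(** Each eigenvalue d lies in [0, 1/2], where 1 - d >= exp(-2 d). *)
Lemma det_ge_expR_trace (R : realType) m (B : 'M[R]_m) :
  (forall i j, B i j = B j i) -> (forall v, 0 <= quad B v) ->
  (forall v, quad B v <= 2^-1 * \sum_i v i ^+ 2) ->
  expR (- (2 * \sum_i B i i)) <= \det (1%:M - B).
Proof.
move=> B_sym B_ge0 B_half; have [U [d [UU BE detE dE]]] := sym_spectral B_sym.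
have -> : \sum_i B i i = \sum_k d k.
  apply: (@complexI R); rewrite !rmorph_sum/=.
  under eq_bigr => i _ do rewrite BE.
  rewrite exchange_big/=; apply: eq_bigr => k _.
  under eq_bigr => i _ do rewrite mulrAC [_ * U k i]mulrC.
  by rewrite -mulr_suml UU eqxx mul1r.
have := detE 1 (-1); rewrite scaleN1r => ->.
rewrite mulr_sumr -sumrN expR_sum; apply: ler_prod => k _.
rewrite expR_ge0/= mulN1r.
have d0 : 0 <= d k by rewrite (dE k).1 addr_ge0.
have d1 : d k <= 2^-1.
  have [-> n1] := dE k; apply: le_trans (lerD (B_half _) (B_half _)) _.
  by rewrite -mulrDr -big_split/= n1 mulr1.
have := expR_ge1Dx (2 * d k); rewrite expRN.
have e0 := expR_gt0 (2 * d k).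
move=> e1; rewrite -[leLHS]mul1r ler_pdivrMr//.
have : (1 - d k) * (1 + 2 * d k) <= (1 - d k) * expR (2 * d k).
  by rewrite ler_wpM2l// subr_ge0; lra.
apply: le_trans; nra.
Qed.

(** * Stochastic matrices and class averages *)

Section ClassAverage.
Variables (R : rcfType) (m : nat).
Implicit Types (v : 'I_m -> R) (A J : 'M[R]_m).

Definition stochastic A :=
  (forall i j, A i j = A j i) /\ forall i, \sum_j A i j = 1.

Lemma stochastic_dirichlet A v : stochastic A ->
  \sum_i v i ^+ 2 - quad A v =
  2^-1 * \sum_i \sum_j A i j * (v i - v j) ^+ 2.
Proof.
move=> [A_sym A1].
have E1 : \sum_i \sum_j A i j * v i ^+ 2 = \sum_i v i ^+ 2.
  by apply: eq_bigr => i _; rewrite -mulr_suml A1 mul1r.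
have E2 : \sum_i \sum_j A i j * v j ^+ 2 = \sum_i v i ^+ 2.
  rewrite exchange_big -[RHS]E1; apply: eq_bigr => i _.
  by apply: eq_bigr => j _; rewrite A_sym.
have -> : \sum_i \sum_j A i j * (v i - v j) ^+ 2 =
    \sum_i \sum_j A i j * v i ^+ 2 + \sum_i \sum_j A i j * v j ^+ 2 -
    2 * quad A v.
  rewrite /quad mulr_sumr -big_split -sumrB; apply: eq_bigr => i _ /=.
  rewrite mulr_sumr -big_split -sumrB; apply: eq_bigr => j _ /=; ring.
by rewrite E1 E2; lra.
Qed.

Lemma stochastic_quad_le A v : stochastic A -> (forall i j, 0 <= A i j) ->
  quad A v <= \sum_i v i ^+ 2.
Proof.
move=> sA A0; rewrite -subr_ge0 stochastic_dirichlet// mulr_ge0 ?invr_ge0//.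
by rewrite sumr_ge0// => i _; rewrite sumr_ge0// => j _; rewrite mulr_ge0 ?sqr_ge0.
Qed.

Lemma quadB A J v : quad (A - J) v = quad A v - quad J v.
Proof. by rewrite quadD -scaleN1r quadZ mulN1r. Qed.

(** A Poincare inequality: comparing the two Dirichlet forms entrywise. *)
Lemma stochastic_above A J (e : R) : stochastic A -> stochastic J ->
  (forall v, 0 <= quad J v) -> e <= 1 ->
  (forall i j, e * J i j <= A i j) -> above (1%:M - A + J) e.
Proof.
move=> sA sJ J0 e1 eJA v; rewrite quadD quadB quad1 stochastic_dirichlet//.
have := stochastic_dirichlet v sJ.
have : e * (2^-1 * \sum_i \sum_j J i j * (v i - v j) ^+ 2) <=
    2^-1 * \sum_i \sum_j A i j * (v i - v j) ^+ 2.
  rewrite mulrCA ler_wpM2l ?invr_ge0// mulr_sumr; apply: ler_sum => i _.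
  rewrite mulr_sumr; apply: ler_sum => j _.
  by rewrite mulrA ler_wpM2r ?sqr_ge0.
have := J0 v; set q := quad J v; set DJ := 2^-1 * _; set DA := 2^-1 * _.
set n := \sum_i _ => q0 le_D nE.
have : 0 <= (1 - e) * q by rewrite mulr_ge0// subr_ge0.
nra.
Qed.

Section Coloring.
Variable K : finType.
Implicit Types (c : 'I_m -> K).

Definition class_size c i := #|[pred j | c j == c i]|.

Lemma class_size_gt0 c i : (0 < class_size c i)%N.
Proof. by apply/card_gt0P; exists i; rewrite inE. Qed.

Definition avgmx c : 'M[R]_m :=
  \matrix_(i, j) ((c i == c j)%:R / (class_size c i)%:R).

Lemma class_size_eq c i j : c i = c j -> class_size c i = class_size c j.
Proof. by rewrite /class_size => ->. Qed.

Lemma avgmx_stochastic c : stochastic (avgmx c).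
Proof.
split=> [i j|i].
  rewrite !mxE eq_sym; case: eqP => [/class_size_eq ->//|_].
  by rewrite !mul0r.
under eq_bigr => j _ do rewrite mxE eq_sym.
rewrite -mulr_suml -natr_sum.
have -> : (\sum_j (c j == c i) = class_size c i)%N.
  rewrite /class_size -sum1_card [RHS]big_mkcond; apply: eq_bigr => j _.
  by rewrite inE; case: (_ == _).
by rewrite mulfV// pnatr_eq0 -lt0n class_size_gt0.
Qed.

Definition class_vec c (k : K) i : R :=
  if c i == k then (Num.sqrt (class_size c i)%:R)^-1 else 0.

Lemma avgmxE c : avgmx c = \sum_k rank1 (class_vec c k).
Proof.
apply/matrixP => i j; rewrite summxE (bigD1 (c i))//= big1 ?addr0.
  rewrite !mxE /class_vec eqxx eq_sym; case: eqP => [/class_size_eq ->|_].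
    by rewrite mul1r -invfM -expr2 sqr_sqrtr.
  by rewrite mul0r mulr0.
by move=> k kc; rewrite mxE /class_vec eq_sym (negPf kc) mul0r.
Qed.

Lemma class_vec_norm c k : \sum_i class_vec c k i ^+ 2 <= 1.
Proof.
have [i0 /eqP ck|no] := pickP (fun i => c i == k); last first.
  by rewrite big1// => i _; rewrite /class_vec no expr0n.
rewrite (eq_bigr (fun i => (c i == c i0)%:R / (class_size c i0)%:R)).
  rewrite -[leRHS]((avgmx_stochastic c).2 i0) le_eqVlt; apply/orP; left.
  by apply/eqP/eq_bigr => j _; rewrite mxE eq_sym.
move=> i _; rewrite /class_vec -ck; case: eqP => [/class_size_eq ->|_].
  by rewrite mul1r exprVn sqr_sqrtr.
by rewrite mul0r expr0n.
Qed.

Lemma avgmx_ge0 c v : 0 <= quad (avgmx c) v.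
Proof.
rewrite avgmxE; elim/big_ind: _ => [|X Y X0 Y0|k _].
- rewrite /quad big1// => i _; rewrite big1// => j _.
  by rewrite mxE mulr0 mul0r.
- by rewrite quadD addr_ge0.
- by rewrite quad_rank1 sqr_ge0.
Qed.

(** With J = [avgmx c], a projection, A J = J A = J; so A - J is the compression
    of A to the kernel of J. *)
Lemma quad_sub_avgmx_ge0 c A v : stochastic A ->
  (forall i j, c i != c j -> A i j = 0) -> (forall w, 0 <= quad A w) ->
  0 <= quad (A - avgmx c) v.
Proof.
move=> [A_sym A1] Ac A0; pose J := avgmx c; pose V : 'cV[R]_m := \col_i v i.
have [J_sym J1] := avgmx_stochastic c.
have mulJ (X : 'M[R]_m) : (forall i, \sum_j X i j = 1) ->
    (forall i j, c i != c j -> X i j = 0) -> X *m J = J.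
  move=> X1 Xc; apply/matrixP => i j; rewrite mxE -[RHS]mul1r -(X1 i) mulr_suml.
  apply: eq_bigr => k _; have [ik|/Xc ->] := eqVneq (c i) (c k); last first.
    by rewrite !mul0r.
  by rewrite !mxE ik (class_size_eq ik).
have JT : J^T = J by apply/matrixP => i j; rewrite mxE J_sym.
have AT : A^T = A by apply/matrixP => i j; rewrite mxE A_sym.
have AJ : A *m J = J by exact: mulJ.
have JA : J *m A = J by rewrite -[LHS]trmxK trmx_mul JT AT AJ JT.
have JJ : J *m J = J.
  by apply: mulJ => // i j ij; rewrite mxE (negPf ij) mul0r.
have := A0 (fun i => ((1%:M - J) *m V) i 0).
rewrite !quadE; congr (0 <= _).
have -> : \col_i ((1%:M - J) *m V) i 0 = (1%:M - J) *m V.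
  by apply/matrixP => i j; rewrite mxE ord1.
rewrite trmx_mul linearB/= trmx1 JT -!mulmxA; congr ((_ *m _) 0 0).
rewrite !mulmxA; congr (_ *m _).
by rewrite mulmxBl mul1mx JA mulmxBr mulmx1 mulmxBl AJ JJ subrr subr0.
Qed.

End Coloring.
End ClassAverage.

(** * Projections onto the classes of a partition *)

Section WeightedProjection.
Variables (R : realType) (m : nat) (w : 'I_m -> R).
Hypothesis w_ge0 : forall i, 0 <= w i.
Variable K : eqType.
Implicit Types (c : 'I_m -> K) (v y : 'I_m -> R).

Definition class_mass c i := \sum_(j | c j == c i) w j.

(** In L^2(w) this is the form of the projection onto functions of the class:
    [class_proj] below is the conditional expectation given the class. *)
Definition class_kernel c i j :=
  if c i == c j then w i * w j / class_mass c i else 0.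

Definition class_proj c v i := (\sum_(j | c j == c i) w j * v j) / class_mass c i.

Lemma class_mass_ge0 c i : 0 <= class_mass c i.
Proof. by apply: sumr_ge0. Qed.

Lemma le_class_mass c i j : c j = c i -> w j <= class_mass c i.
Proof.
by move=> cij; rewrite /class_mass (bigD1 j) ?cij//= lerDl sumr_ge0.
Qed.

Lemma class_mass_eq c i j : c i = c j -> class_mass c i = class_mass c j.
Proof. by rewrite /class_mass => ->. Qed.

Lemma weight_mulfV c i : w i * (class_mass c i / class_mass c i) = w i.
Proof.
have [S0|S0] := eqVneq (class_mass c i) 0; last by rewrite divff ?mulr1.
have : w i <= 0 by rewrite -S0; exact: le_class_mass.
by rewrite le_eqVlt ltNge w_ge0 orbF => /eqP ->; rewrite !mul0r.
Qed.

Lemma class_kernel_sym c i j : class_kernel c i j = class_kernel c j i.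
Proof.
rewrite /class_kernel eq_sym; case: eqP => // /class_mass_eq ->.
by rewrite [w i * _]mulrC.
Qed.

Lemma class_kernel_ge0 c i j : 0 <= class_kernel c i j.
Proof.
rewrite /class_kernel; case: ifP => // _.
by rewrite divr_ge0 ?mulr_ge0// class_mass_ge0.
Qed.

Lemma class_kernel_sum c i : \sum_j class_kernel c i j = w i.
Proof.
transitivity (w i * ((\sum_(j | c j == c i) w j) / class_mass c i)); last first.
  exact: weight_mulfV.
rewrite mulr_suml mulr_sumr.
rewrite [RHS]big_mkcond; apply: eq_bigr => j _; rewrite /class_kernel eq_sym.
by case: ifP => // _; rewrite mulrA.
Qed.

Lemma class_kernel_le c i j : class_kernel c i j <= w i.
Proof.
rewrite -[leRHS](class_kernel_sum c) (bigD1 j)//= lerDl sumr_ge0// => k _.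
exact: class_kernel_ge0.
Qed.

Lemma class_proj_adjoint c v y : (forall i j, c i = c j -> y i = y j) ->
  \sum_i w i * y i * class_proj c v i = \sum_i w i * y i * v i.
Proof.
move=> yc.
transitivity (\sum_i \sum_(j | c j == c i)
    (w j * y j * v j) * (w i / class_mass c j)).
  apply: eq_bigr => i _; rewrite /class_proj mulr_suml mulr_sumr.
  apply: eq_bigr => j /eqP cji; rewrite (class_mass_eq cji) (yc _ _ cji); ring.
rewrite (exchange_big_dep xpredT)//=; apply: eq_bigr => j _.
rewrite -mulr_sumr -mulr_suml.
rewrite (eq_bigl (fun i => c i == c j)); last by move=> i; rewrite eq_sym.
rewrite -/(class_mass c j) -[in RHS](weight_mulfV c j).
by rewrite mulrC !mulrA [_ / _ * w j]mulrC !mulrA.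
Qed.

Definition class_form c v := \sum_i \sum_j v i * class_kernel c i j * v j.

Lemma class_formE c v :
  class_form c v = \sum_i w i * v i * class_proj c v i.
Proof.
apply: eq_bigr => i _; rewrite /class_proj mulr_suml mulr_sumr.
rewrite [RHS]big_mkcond; apply: eq_bigr => j _; rewrite /class_kernel eq_sym.
case: ifP => _; last by rewrite mulr0 mul0r.
by ring.
Qed.

Lemma class_proj_eq c v i j : c i = c j -> class_proj c v i = class_proj c v j.
Proof.
by rewrite /class_proj => cij; rewrite (class_mass_eq cij) cij.
Qed.

Lemma class_form_sqr c v :
  class_form c v = \sum_i w i * class_proj c v i ^+ 2.
Proof.
rewrite class_formE; have := class_proj_adjoint v (@class_proj_eq c v).
under eq_bigr do rewrite -mulrA -expr2.
by move=> ->; apply: eq_bigr => i _; rewrite mulrAC.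
Qed.

Lemma class_form_ge0 c v : 0 <= class_form c v.
Proof.
by rewrite class_form_sqr sumr_ge0// => i _; rewrite mulr_ge0 ?sqr_ge0.
Qed.

End WeightedProjection.

(** Conditioning on a finer partition enlarges the projection of [v]; the
    difference is the squared distance between the two projections. *)
Lemma class_form_le (R : realType) m (w : 'I_m -> R) (K K' : eqType)
    (c : 'I_m -> K) (c' : 'I_m -> K') v :
  (forall i, 0 <= w i) -> (forall i j, c' i = c' j -> c i = c j) ->
  class_form w c v <= class_form w c' v.
Proof.
move=> w0 c'c; pose p := class_proj w c v; pose p' := class_proj w c' v.
have E1 : \sum_i w i * p i * p' i = class_form w c v.
  rewrite class_proj_adjoint//; last by move=> i j /c'c; exact: class_proj_eq.
  by rewrite class_formE; apply: eq_bigr => i _; rewrite mulrAC.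
have : 0 <= \sum_i w i * (p' i - p i) ^+ 2.
  by rewrite sumr_ge0// => i _; rewrite mulr_ge0 ?sqr_ge0.
suff -> : \sum_i w i * (p' i - p i) ^+ 2 = class_form w c' v - class_form w c v.
  by rewrite subr_ge0.
transitivity (\sum_i w i * p' i ^+ 2 - (\sum_i w i * p i * p' i) *+ 2 +
    \sum_i w i * p i ^+ 2).
  by rewrite -sumrMnl -sumrB -big_split; apply: eq_bigr => i _ /=; ring.
by rewrite -!class_form_sqr// E1; ring.
Qed.

(** * Overlap matrices *)

Section RealIntegral.
Context d (T : measurableType d) (R : realType).
Variable nu : {measure set T -> \bar R}.
Implicit Types (f g : T -> R).

Definition intble f := nu.-integrable setT (EFin \o f).

Lemma intbleD f g : intble f -> intble g -> intble (fun x => f x + g x).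
Proof.
by move=> If Ig; have := integrableD measurableT If Ig; apply: eq_integrable.
Qed.

Lemma intbleZ c f : intble f -> intble (fun x => c * f x).
Proof.
by move=> If; have := integrableZl measurableT c If; apply: eq_integrable.
Qed.

Lemma intble0 : intble (fun=> 0).
Proof. exact: integrable0. Qed.

Lemma intble_sum (I : Type) (r : seq I) (P : pred I) (F : I -> T -> R) :
  (forall i, intble (F i)) -> intble (fun x => \sum_(i <- r | P i) F i x).
Proof.
move=> IF; elim: r => [|i r IH].
  by apply: eq_integrable intble0 => // x _ /=; rewrite big_nil.
have [Pi|Pi] := boolP (P i).
  apply: eq_integrable (intbleD (IF i) IH) => // x _ /=.
  by rewrite big_cons Pi.
by apply: eq_integrable IH => // x _ /=; rewrite big_cons (negPf Pi).
Qed.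

Lemma Rintegral_sum (I : Type) (r : seq I) (P : pred I) (F : I -> T -> R) :
  (forall i, intble (F i)) ->
  \int[nu]_x (\sum_(i <- r | P i) F i x) =
  \sum_(i <- r | P i) \int[nu]_x F i x.
Proof.
move=> IF; elim: r => [|i r IH].
  under eq_Rintegral do rewrite big_nil.
  by rewrite big_nil Rintegral_cst// mul0r.
rewrite big_cons; case: ifPn => Pi.
  under eq_Rintegral do rewrite big_cons Pi.
  by rewrite RintegralD ?IH//; [exact: IF|exact: intble_sum].
by under eq_Rintegral do rewrite big_cons (negPf Pi).
Qed.

Lemma intble_le f g : measurable_fun setT f -> intble g ->
  (forall x, `|f x| <= g x) -> intble f.
Proof.
move=> mf Ig fg; apply: le_integrable Ig => //.
  exact/measurable_EFinP.
by move=> x _ /=; rewrite lee_fin (le_trans (fg x)) ?ler_norm.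
Qed.

Lemma le_Rint f g : intble f -> intble g -> (forall x, f x <= g x) ->
  \int[nu]_x f x <= \int[nu]_x g x.
Proof. by move=> If Ig fg; apply: le_Rintegral. Qed.

End RealIntegral.

Section Overlap.
Context d (T : measurableType d) (R : realType).
Variable nu : {measure set T -> \bar R}.
Variables (m : nat) (q : 'I_m -> T -> R).
Hypothesis q_ge0 : forall i x, 0 <= q i x.
Hypothesis q_meas : forall i, measurable_fun setT (q i).
Hypothesis q_int : forall i, (\int[nu]_x (q i x)%:E = 1)%E.

Lemma q_intble i : intble nu (q i).
Proof.
apply/integrableP; split; first exact/measurable_EFinP.
under eq_integral do rewrite /= ger0_norm//.
by rewrite q_int ltry.
Qed.

Lemma q_Rint i : \int[nu]_x q i x = 1.
Proof. by rewrite /Rintegral q_int. Qed.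

Section Coloring.
Variables (K : finType) (c : 'I_m -> K).

Lemma mass_meas i : measurable_fun setT (fun x => class_mass (q ^~ x) c i).
Proof.
rewrite /class_mass; under eq_fun do rewrite big_mkcond/=.
by apply: measurable_sum => k; case: (c k == c i).
Qed.

Lemma kernel_meas i j :
  measurable_fun setT (fun x => class_kernel (q ^~ x) c i j).
Proof.
rewrite /class_kernel; case: (c i == c j) => //; apply: measurable_funM.
  exact: measurable_funM.
under eq_fun do rewrite -powR_inv1 ?class_mass_ge0//.
apply: (measurableT_comp (measurable_powR _)) => //.
exact: mass_meas.
Qed.

Lemma kernel_intble i j : intble nu (fun x => class_kernel (q ^~ x) c i j).
Proof.
apply: (intble_le (kernel_meas i j) (q_intble i)) => x.
by rewrite ger0_norm ?class_kernel_ge0// class_kernel_le.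
Qed.

(** The overlap matrix of the partition [c]: block diagonal, each block being
    the overlap matrix of the densities of one class. *)
Definition overlap : 'M[R]_m :=
  \matrix_(i, j) \int[nu]_x class_kernel (q ^~ x) c i j.

Lemma overlap_stochastic : stochastic overlap.
Proof.
split=> [i j|i].
  by rewrite !mxE; apply: eq_Rintegral => x _; rewrite class_kernel_sym.
under eq_bigr => j _ do rewrite mxE.
rewrite -Rintegral_sum; last by move=> j; exact: kernel_intble.
by under eq_Rintegral do rewrite class_kernel_sum//; exact: q_Rint.
Qed.

Lemma overlap_ge0 i j : 0 <= overlap i j.
Proof.
by rewrite mxE Rintegral_ge0// => x _; rewrite class_kernel_ge0.
Qed.

Lemma overlap_eq0 i j : c i != c j -> overlap i j = 0.
Proof.
move=> cij; rewrite mxE /class_kernel (negPf cij).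
by rewrite Rintegral_cst// mul0r.
Qed.

Lemma form_intble v : intble nu (fun x => class_form (q ^~ x) c v).
Proof.
apply: intble_sum => i; apply: intble_sum => j.
have := intbleZ (v i * v j) (kernel_intble i j).
by apply: eq_integrable => // x _ /=; rewrite mulrAC.
Qed.

Lemma quad_overlapE v :
  quad overlap v = \int[nu]_x class_form (q ^~ x) c v.
Proof.
have I1 i j : intble nu (fun x => v i * class_kernel (q ^~ x) c i j * v j).
  have := intbleZ (v i * v j) (kernel_intble i j).
  by apply: eq_integrable => // x _ /=; rewrite mulrAC.
rewrite /class_form Rintegral_sum; last by move=> i; apply: intble_sum.
apply: eq_bigr => i _; rewrite Rintegral_sum//; apply: eq_bigr => j _.
rewrite mxE mulrAC -RintegralZl//; last exact: kernel_intble.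
by apply: eq_Rintegral => x _; rewrite mulrAC.
Qed.

Lemma quad_overlap_ge0 v : 0 <= quad overlap v.
Proof.
by rewrite quad_overlapE Rintegral_ge0// => x _; rewrite class_form_ge0.
Qed.

(** Cauchy-Schwarz, in the form 2 t sqrt(q_i q_j) <= q_i q_j / S + t^2 S. *)
Lemma affinity_le_overlap i j : c i = c j ->
  (\int[nu]_x Num.sqrt (q i x * q j x)) ^+ 2 / (class_size c i)%:R
  <= overlap i j.
Proof.
move=> cij; set a := \int[nu]_x _; set s : R := (class_size c i)%:R.
have s0 : 0 < s by rewrite ltr0n class_size_gt0.
pose t := a / s.
have Im : intble nu (fun x => class_mass (q ^~ x) c i).
  by apply: intble_sum => k; exact: q_intble.
have mass_int : \int[nu]_x class_mass (q ^~ x) c i = s.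
  rewrite Rintegral_sum; last exact: q_intble.
  by under eq_bigr do rewrite q_Rint; rewrite sumr_const.
have S_ge0 x : 0 <= class_mass (q ^~ x) c i by exact: class_mass_ge0.
have Is : intble nu (fun x => Num.sqrt (q i x * q j x)).
  apply: (intble_le _ Im) => [|x].
    apply: measurableT_comp.
      by apply: continuous_measurable_fun; exact: sqrt_continuous.
    exact: measurable_funM.
  rewrite ger0_norm ?sqrtr_ge0//.
  have := sqrtr_sqr (class_mass (q ^~ x) c i); rewrite ger0_norm// => <-.
  by rewrite ler_wsqrtr// expr2 ler_pM// le_class_mass.
have AM x : 2 * t * Num.sqrt (q i x * q j x) <=
    class_kernel (q ^~ x) c i j + t ^+ 2 * class_mass (q ^~ x) c i.
  rewrite /class_kernel cij eqxx /=.
  set S := class_mass _ _ _; have S0 : 0 <= S := S_ge0 x.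
  have p0 : 0 <= q i x * q j x by exact: mulr_ge0.
  have [E|SN0] := eqVneq S 0.
    have -> : q i x = 0.
      apply/eqP; rewrite eq_le q_ge0 andbT -E; exact: le_class_mass.
    by rewrite !mul0r sqrtr0 mulr0 E mulr0 addr0.
  have S_gt0 : 0 < S by rewrite lt_neqAle eq_sym SN0.
  rewrite -(ler_pM2r S_gt0) [leRHS]mulrDl divfK// -[X in _ <= X + _](sqr_sqrtr p0).
  rewrite -subr_ge0; set r := Num.sqrt _.
  have -> : r ^+ 2 + t ^+ 2 * S * S - 2 * t * r * S = (r - t * S) ^+ 2 by ring.
  exact: sqr_ge0.
have := le_Rint (intbleZ (2 * t) Is)
  (intbleD (kernel_intble i j) (intbleZ (t ^+ 2) Im)) AM.
rewrite RintegralZl// RintegralD//; [|exact: kernel_intble|exact: intbleZ].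
rewrite RintegralZl// mass_int mxE -/a -lerBlDr; congr (_ <= _).
by rewrite /t; field; rewrite gt_eqF.
Qed.

End Coloring.

(** Integrated form of [class_form_le]. *)
Lemma quad_overlap_le (K K' : finType) (c : 'I_m -> K) (c' : 'I_m -> K') v :
  (forall i j, c' i = c' j -> c i = c j) ->
  quad (overlap c) v <= quad (overlap c') v.
Proof.
move=> c'c; rewrite !quad_overlapE.
apply: le_Rint => [||x]; try exact: form_intble.
exact: class_form_le.
Qed.

End Overlap.

(** * Upper bounds on the permanent of an overlap matrix *)

Section UpperBound.
Context d (T : measurableType d) (R : realType).
Variable nu : {measure set T -> \bar R}.
Variables (m : nat) (q : 'I_m.+1 -> T -> R) (u : 'I_m.+1 -> R).
Hypothesis q_ge0 : forall i x, 0 <= q i x.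
Hypothesis q_meas : forall i, measurable_fun setT (q i).
Hypothesis q_int : forall i, (\int[nu]_x (q i x)%:E = 1)%E.
Hypothesis q_aff : forall i j,
  \int[nu]_x Num.sqrt (q i x * q j x) = expR (- ((u i - u j) ^+ 2 / 2)).
Hypothesis q_trace : forall (K : finType) (c : 'I_m.+1 -> K) (k : K) (L : R),
  0 <= L <= 6^-1 -> (forall i j, c i = k -> c j = k -> `|u i - u j| <= L) ->
  \sum_(i | c i == k) overlap nu q c i i <= 1 + 18 * L ^+ 2.

Local Notation ov := (overlap nu q).

(** The overlap matrix has eigenvalue 1 on the vectors that are constant on the
    classes; adding the averaging matrix makes [lapl] positive definite. *)
Definition lapl (K : finType) (c : 'I_m.+1 -> K) := 1%:M - ov c + avgmx R c.

Lemma avgmx_sym (K : finType) (c : 'I_m.+1 -> K) i j :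
  avgmx R c i j = avgmx R c j i.
Proof. exact: (avgmx_stochastic R c).1. Qed.

Lemma overlap_sym (K : finType) (c : 'I_m.+1 -> K) i j : ov c i j = ov c j i.
Proof. exact: (overlap_stochastic q_ge0 q_meas q_int c).1. Qed.

Lemma lapl_sym (K : finType) (c : 'I_m.+1 -> K) i j : lapl c i j = lapl c j i.
Proof.
rewrite [LHS]mxE [RHS]mxE avgmx_sym; congr (_ + _).
rewrite [LHS]mxE [RHS]mxE; congr (_ + _); first by rewrite !mxE eq_sym.
by rewrite [LHS]mxE [RHS]mxE overlap_sym.
Qed.

Lemma quad_lapl (K : finType) (c : 'I_m.+1 -> K) v : quad (lapl c) v =
  \sum_i v i ^+ 2 - quad (ov c) v + quad (avgmx R c) v.
Proof. by rewrite /lapl quadD quadB quad1. Qed.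

(** By Cauchy-Schwarz the affinities bound the overlaps below by a multiple of
    the averaging matrix, and [stochastic_above] applies. *)
Lemma lapl_above (K : finType) (c : 'I_m.+1 -> K) (e L : R) :
  e = expR (- L ^+ 2) -> (forall i j, c i = c j -> `|u i - u j| <= L) ->
  above (lapl c) e.
Proof.
move=> -> cL; apply: stochastic_above.
- exact: overlap_stochastic.
- exact: avgmx_stochastic.
- exact: avgmx_ge0.
- by rewrite -expR0 ler_expR oppr_le0 sqr_ge0.
move=> i j; rewrite mxE; have [cij|cij] := eqVneq (c i) (c j); last first.
  by rewrite mul0r mulr0 overlap_ge0.
apply: le_trans (affinity_le_overlap q_ge0 q_meas q_int cij).
rewrite mulrA mulr1 ler_wpM2r ?invr_ge0// q_aff -expRM_natr ler_expR.
rewrite mulNr lerN2 divfK ?pnatr_eq0// -real_normK ?num_real//.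
by rewrite lerXn2r ?nnegrE// ?cL// (le_trans _ (cL _ _ cij)).
Qed.

(** Refinement increases the overlap form, so [lapl c'] is at most [lapl c] plus
    the averaging matrix of [c'], which is a sum of one rank-one term per
    class. *)
Lemma lapl_refine (K K' : finType) (c : 'I_m.+1 -> K) (c' : 'I_m.+1 -> K')
    (e : R) : 0 < e -> above (lapl c) e -> above (lapl c') e ->
  (forall i j, c' i = c' j -> c i = c j) ->
  \det (lapl c') <= (1 + e^-1) ^+ #|K'| * \det (lapl c).
Proof.
move=> e0 ce c'e c'c.
have [sym ab _ up] := det_sum_rank1
  (fun k : 'I_#|K'| => class_vec R c' (enum_val k)) (lapl_sym c) e0 ce.
apply: le_trans (up (fun k => class_vec_norm _ _ _)).
apply: (le_det (c := e)) => // [|v]; first exact: lapl_sym.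
have -> : \sum_(k < #|K'|) rank1 (class_vec R c' (enum_val k)) = avgmx R c'.
  rewrite avgmxE (reindex (@enum_val _ (mem K')))/=.
    by apply: eq_bigl.
  by apply: onW_bij; exact: enum_val_bij.
rewrite quadD !quad_lapl lerD2r.
have := quad_overlap_le q_ge0 q_meas q_int v c'c.
have := avgmx_ge0 c v; lra.
Qed.

Lemma trace_class_le (K : finType) (c : 'I_m.+1 -> K) (k : K) (L : R) :
  0 <= L <= 6^-1 -> (forall i j, c i = k -> c j = k -> `|u i - u j| <= L) ->
  \sum_(i | c i == k) (ov c - avgmx R c) i i <= 18 * L ^+ 2.
Proof.
move=> L01 cL; have [i0 /eqP ck|no] := pickP (fun i => c i == k); last first.
  by rewrite big_pred0// mulr_ge0// sqr_ge0.
have tr := q_trace L01 cL.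
under eq_bigr => i _ do rewrite mxE [X in _ + X]mxE.
rewrite sumrB lerBlDr addrC (le_trans tr)// lerD2r.
have := (avgmx_stochastic R c).2 i0 => E.
rewrite -[leLHS]E [leRHS]big_mkcond; apply: ler_sum => i _.
rewrite mxE eq_sym -ck; case: eqP => [cii|_]; last by rewrite mul0r.
by rewrite mxE eqxx !mul1r (class_size_eq cii).
Qed.

Lemma sub_avgmx_sym (K : finType) (c : 'I_m.+1 -> K) i j :
  (ov c - avgmx R c) i j = (ov c - avgmx R c) j i.
Proof.
rewrite [LHS]mxE [RHS]mxE overlap_sym; congr (_ + _).
by rewrite [LHS]mxE [RHS]mxE avgmx_sym.
Qed.

(** In cells of length 1/6 the overlap matrix minus the averaging matrix has
    trace, and therefore norm, at most 1/2 on each class. *)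
Lemma lapl_base (K : finType) (c : 'I_m.+1 -> K) :
  (forall i j, c i = c j -> `|u i - u j| <= 6^-1) ->
  expR (- #|K|%:R) <= \det (lapl c).
Proof.
move=> cL; pose B := ov c - avgmx R c.
have B_sym : forall i j, B i j = B j i by exact: sub_avgmx_sym.
have B_ge0 v : 0 <= quad B v.
  apply: quad_sub_avgmx_ge0.
  - exact: overlap_stochastic.
  - exact: overlap_eq0.
  - exact: quad_overlap_ge0.
have tr_half k : \sum_(i | c i == k) B i i <= 2^-1.
  apply: (le_trans (trace_class_le (L := 6^-1) _ _)) => [|i j <- /esym|].
  - by lra.
  - exact: cL.
  - by lra.
have -> : lapl c = 1%:M - B by rewrite /lapl /B opprB addrA addrAC.
apply: le_trans (det_ge_expR_trace B_sym B_ge0 _).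
  rewrite ler_expR lerN2 (partition_big c xpredT)//=.
  rewrite mulr_sumr -sum1_card natr_sum; apply: ler_sum => k _.
  by rewrite -(@ler_pM2l _ 2^-1) ?invr_gt0// mulKf// mulr1 tr_half.
move=> v; pose vk k i := if c i == k then v i else 0.
have -> : quad B v = \sum_k quad B (vk k).
  rewrite /quad [RHS]exchange_big/=; apply: eq_bigr => i _.
  rewrite [RHS]exchange_big/=; apply: eq_bigr => j _.
  rewrite (bigD1 (c i))//= /vk eqxx big1 ?addr0; last first.
    by move=> k ki; rewrite eq_sym (negPf ki) !mul0r.
  case: (eqVneq (c j) (c i)) => // cji.
  have -> : B i j = 0.
    rewrite /B [LHS]mxE overlap_eq0; last by rewrite eq_sym.
    by rewrite add0r !mxE eq_sym (negPf cji) mul0r oppr0.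
  by rewrite !mulr0 mul0r.
rewrite (partition_big c xpredT)//= mulr_sumr; apply: ler_sum => k _.
have := @quad_le_trace _ _ B [set i | c i == k]%SET (vk k) B_sym B_ge0.
move=> /(_ _)/le_trans; apply.
  by move=> i; rewrite inE /vk => /negPf ->.
rewrite [X in X * _ <= _](eq_bigl (fun i => c i == k)) => [|i]; last by rewrite inE.
rewrite [X in _ * X <= _](eq_bigl (fun i => c i == k)) => [|i]; last by rewrite inE.
rewrite [X in _ * X <= _](eq_bigr (fun i => v i ^+ 2)); last by move=> i ci; rewrite /vk ci.
by rewrite ler_wpM2r// sumr_ge0// => i _; exact: sqr_ge0.
Qed.

(** The logarithmic cost per class, obtained from
    dyadic_cost (J + 1) = 2 (dyadic_cost J + 1 + L^2) where L = 2^(J + 1) / 6 is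
    the length of the cells. *)
Definition dyadic_cost (J : nat) : R := 3 * 2 ^+ J + 4 * (6^-1 * 2 ^+ J) ^+ 2 - 2.

(** [a i] is the number of the cell of length 1/6 that contains [u i]. *)
Variable a : 'I_m.+1 -> nat.
Hypothesis a_close : forall i j n, (a i < a j + n)%N -> (a j < a i + n)%N ->
  `|u i - u j| <= 6^-1 * n%:R.

Lemma lapl_dyadic J (K : nat) (c : 'I_m.+1 -> 'I_K) :
  (forall i, c i = (a i %/ 2 ^ J)%N :> nat) ->
  expR (- (K%:R * dyadic_cost J)) <= \det (lapl c).
Proof.
elim: J K c => [|J IH] K c cE.
  apply: le_trans (lapl_base _); last first.
    move=> i j /(congr1 (@nat_of_ord _)); rewrite !cE expn0 !divn1 => aij.
    by have := @a_close i j 1; rewrite mulr1; apply; rewrite aij addn1.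
  by rewrite card_ord ler_expR lerN2 ler_peMr// /dyadic_cost expr0; lra.
have cP i : (a i %/ 2 ^ J < K * 2)%N.
  have := ltn_ord (c i); rewrite cE expnSr divnMA => H.
  by rewrite -ltn_divLR// H.
pose c' i := Ordinal (cP i).
have c'c i j : c' i = c' j -> c i = c j.
  by move=> /(congr1 (@nat_of_ord _)) /= E; apply/ord_inj; rewrite !cE expnSr !divnMA E.
have cL i j : c i = c j -> `|u i - u j| <= 6^-1 * 2 ^+ J.+1.
  move=> /(congr1 (@nat_of_ord _)); rewrite !cE -natrX => E.
  have p2 : (0 < 2 ^ J.+1)%N by rewrite expn_gt0.
  apply: a_close.
    rewrite [ltnLHS](divn_eq _ (2 ^ J.+1)) E [X in (_ < X + _)%N](divn_eq _ (2 ^ J.+1)).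
    by rewrite -addnA ltn_add2l ltn_addl// ltn_mod.
  rewrite [ltnLHS](divn_eq _ (2 ^ J.+1)) -E [X in (_ < X + _)%N](divn_eq _ (2 ^ J.+1)).
  by rewrite -addnA ltn_add2l ltn_addl// ltn_mod.
pose L : R := 6^-1 * 2 ^+ J.+1.
have e0 : 0 < expR (- L ^+ 2) := expR_gt0 _.
have := lapl_refine e0 (lapl_above erefl cL)
  (lapl_above erefl (fun i j E => cL i j (c'c i j E))) c'c.
rewrite card_ord expRN invrK => ref.
have p0 : 0 < (1 + expR (L ^+ 2)) ^+ (K * 2).
  by rewrite exprn_gt0// addr_gt0 ?expR_gt0.
have := le_trans (IH _ c' (fun i => erefl)) ref.
rewrite -/L -ler_pdivrMl//; apply: le_trans; rewrite ler_pdivlMl//.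
have le1 : 1 + expR (L ^+ 2) <= expR (1 + L ^+ 2).
  rewrite expRD; have := @expR_ge1Dx R 1; have : 1 <= expR (L ^+ 2).
    by rewrite -expR0 ler_expR sqr_ge0.
  nra.
apply: (@le_trans _ _ (expR (1 + L ^+ 2) ^+ (K * 2) * expR (- (K%:R * dyadic_cost J.+1)))).
  by rewrite ler_wpM2r ?expR_ge0// lerXn2r ?nnegrE ?addr_ge0 ?expR_ge0.
have EL : 2 ^+ J = 3 * L by rewrite /L exprS; field.
rewrite -expRM_natl -expRD ler_expR natrM /dyadic_cost -/L [2 ^+ J.+1]exprS EL.
by rewrite le_eqVlt; apply/orP; left; apply/eqP; field.
Qed.

Definition one_class : 'I_m.+1 -> 'I_1 := fun=> ord0.

(** The second moment of the likelihood ratio of the permutation mixture to the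
    mean field; see [chi2_div_permanent]. *)
Definition second_moment := permanent (m.+1%:R *: ov one_class) / m.+1`!%:R.

Let B := m.+1%:R *: (ov one_class - avgmx R one_class).

Lemma one_classE : m.+1%:R *: ov one_class = const_mx 1 + B.
Proof.
have -> : const_mx 1 = m.+1%:R *: avgmx R one_class :> 'M[R]_m.+1.
  apply/matrixP => i j; rewrite !mxE (_ : class_size _ _ = m.+1).
    by rewrite eqxx mul1r mulfV// pnatr_eq0.
  by rewrite -[RHS]card_ord; apply: eq_card => k; rewrite !inE eqxx.
by rewrite /B scalerBr addrC subrK.
Qed.

Let B_sym i j : B i j = B j i.
Proof. by rewrite [LHS]mxE [RHS]mxE sub_avgmx_sym. Qed.

Let B_sum0 i : \sum_j B i j = 0.
Proof.
under eq_bigr => j _ do rewrite mxE [X in _ * X]mxE [X in _ * (_ + X)]mxE.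
rewrite -mulr_sumr sumrB (overlap_stochastic q_ge0 q_meas q_int one_class).2.
by rewrite (avgmx_stochastic R one_class).2 subrr mulr0.
Qed.

Let B_ge0 v : 0 <= quad B v.
Proof.
rewrite quadZ mulr_ge0// quad_sub_avgmx_ge0//.
- exact: overlap_stochastic.
- exact: quad_overlap_ge0.
Qed.

Let lapl1E : 1%:M - m.+1%:R^-1 *: B = lapl one_class.
Proof.
by rewrite /B scalerA mulVf ?pnatr_eq0// scale1r /lapl opprB addrA addrAC.
Qed.

Lemma fact_gt0R : 0 < m.+1`!%:R :> R.
Proof. by rewrite ltr0n fact_gt0. Qed.

Lemma second_moment_ge0 : 0 <= second_moment.
Proof.
rewrite /second_moment divr_ge0// sumr_ge0// => s _; apply: prodr_ge0 => i _.
by rewrite mxE mulr_ge0// overlap_ge0.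
Qed.

Lemma second_moment_le_det e : 0 < e -> above (lapl one_class) e ->
  second_moment <= (\det (lapl one_class))^-1.
Proof.
move=> e0 ae; rewrite /second_moment one_classE ler_pdivrMr ?fact_gt0R// mulrC -lapl1E.
apply: (permanent_le_det B_sym B_sum0 B_ge0 (c := (1 - e) * m.+1%:R)).
  by rewrite gtr_pMl ?ltr0n//; lra.
move=> v; rewrite quadZ mulrAC mulrC ler_wpM2r//.
by have := ae v; rewrite -lapl1E quadB quad1 quadZ quadZ mulKf ?pnatr_eq0//; lra.
Qed.

Lemma second_moment_le_short J : (forall i, (a i < 2 ^ J)%N) -> second_moment <= expR (dyadic_cost J).
Proof.
move=> aJ.
have L1 i j : one_class i = one_class j -> `|u i - u j| <= 6^-1 * 2 ^+ J.
  by move=> _; rewrite -natrX a_close// ltn_addl.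
apply: (le_trans (second_moment_le_det (expR_gt0 _) (lapl_above erefl L1))).
have := @lapl_dyadic J 1 one_class _.
rewrite mul1r expRN => /(_ _)/le_trans H.
rewrite invf_ple ?posrE ?expR_gt0//.
  by apply: H => // i; rewrite divn_small.
by apply: det_above_gt0 (expR_gt0 _) (lapl_above erefl L1); exact: lapl_sym.
Qed.

(** Multiplying [B] by r = 1 - 1/n costs r^-m <= exp 2 and makes 1 - r B / m at
    least 1/n, whatever the length of the parameter segment. The one-class
    determinant is then reached from the [K]-class one by [K] updates of cost
    at most 1 + n. *)
Lemma second_moment_le_long J K n : (m < n)%N -> (1 < n)%N ->
  (forall i, (a i < K * 2 ^ J)%N) ->
  second_moment <= expR 2 * (1 + n%:R) ^+ K * expR (K%:R * dyadic_cost J).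
Proof.
move=> mn n1 aKJ.
have n0 : 0 < n%:R :> R by rewrite ltr0n ltnW.
pose r : R := 1 - n%:R^-1.
have n12 : n%:R^-1 <= 2^-1 :> R by rewrite lef_pV2 ?posrE// ler_nat.
have nV0 : 0 < n%:R^-1 :> R by rewrite invr_gt0.
have r01 : 0 <= r <= 1 by rewrite /r; apply/andP; split; lra.
have [r0 r1] := andP r01.
have rn : expR (- 2) <= r ^+ m.+1.
  have rx : expR (- (2 * n%:R^-1)) <= r.
    have := @expR_ge1Dx R (2 * n%:R^-1); rewrite expRN.
    have := expR_gt0 (2 * n%:R^-1 : R) => e0 e1.
    rewrite -[leLHS]mul1r ler_pdivrMr//.
    have : r * (1 + 2 * n%:R^-1) <= r * expR (2 * n%:R^-1) by rewrite ler_wpM2l.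
    by apply: le_trans; rewrite /r; nra.
  apply: (@le_trans _ _ (r ^+ n)); last by rewrite ler_wiXn2l.
  apply: (@le_trans _ _ (expR (- (2 * n%:R^-1)) ^+ n)); last first.
    by rewrite lerXn2r ?nnegrE ?expR_ge0.
  by rewrite -expRM_natl ler_expR mulrN lerN2 mulrCA mulfV ?mulr1 ?gt_eqF.
pose X := 1%:M - m.+1%:R^-1 *: (r *: B).
have XE : X = 1%:M - r *: (ov one_class - avgmx R one_class).
  by rewrite /X /B !scalerA mulrA mulrAC mulVf ?pnatr_eq0// mul1r.
have X_sym i j : X i j = X j i.
  rewrite [LHS]mxE [RHS]mxE; congr (_ + _); first by rewrite !mxE eq_sym.
  rewrite [LHS]mxE [RHS]mxE; congr (- _).
  rewrite [LHS]mxE [RHS]mxE; congr (_ * _).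
  by rewrite [LHS]mxE [RHS]mxE B_sym.
have quadX v : quad X v = \sum_i v i ^+ 2 -
    r * (quad (ov one_class) v - quad (avgmx R one_class) v).
  by rewrite XE quadB quad1 quadZ quadB.
have ov_le v : quad (ov one_class) v <= \sum_i v i ^+ 2.
  apply: stochastic_quad_le; first exact: overlap_stochastic.
  by move=> i j; exact: overlap_ge0.
have sum_ge0 (v : 'I_m.+1 -> R) : 0 <= \sum_i v i ^+ 2.
  by rewrite sumr_ge0// => i _; exact: sqr_ge0.
have aX : above X n%:R^-1.
  move=> v; rewrite quadX /r; have := ov_le v; have := avgmx_ge0 one_class v.
  have := sum_ge0 v; nra.
have detX := det_above_gt0 X_sym nV0 aX.
have shrunk_le : r ^+ m.+1 * second_moment <= (\det X)^-1.
  rewrite /second_moment one_classE mulrA ler_pdivrMr ?fact_gt0R//.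
  apply: le_trans (permanent_shrink B_sym B_sum0 B_ge0 r01) _.
  rewrite mulrC; apply: (permanent_le_det _ _ _ (c := r * m.+1%:R)).
  - by move=> i j; rewrite [LHS]mxE [RHS]mxE B_sym.
  - by move=> i; under eq_bigr => j _ do rewrite mxE; rewrite -mulr_sumr B_sum0 mulr0.
  - by move=> v; rewrite quadZ mulr_ge0// B_ge0.
  - by rewrite gtr_pMl ?ltr0n// /r; lra.
  move=> v; rewrite quadZ -mulrA ler_wpM2l// quadZ ler_wpM2l// quadB.
  have := ov_le v; have := avgmx_ge0 one_class v; lra.
have cP i : (a i %/ 2 ^ J < K)%N by rewrite ltn_divLR ?expn_gt0.
pose c i := Ordinal (cP i).
have ndet : \det (lapl c) <= (1 + n%:R) ^+ K * \det X.
  have [sym ab _ up] := det_sum_rank1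
    (fun k : 'I_K => class_vec R c k) X_sym nV0 aX.
  rewrite -[n%:R in X in _ <= X]invrK.
  apply: le_trans (up (fun k => class_vec_norm _ _ _)).
  have cL i j : c i = c j -> `|u i - u j| <= 6^-1 * (K * 2 ^ J)%:R.
    by move=> _; rewrite a_close// ltn_addl.
  apply: (le_det (lapl_sym c) sym (expR_gt0 _) (lapl_above erefl cL)) => v.
  rewrite -avgmxE quadD quadX quad_lapl lerD2r.
  have := quad_overlap_le q_ge0 q_meas q_int v
    (fun i j (_ : c i = c j) => erefl : one_class i = one_class j).
  have := avgmx_ge0 one_class v.
  have := quad_overlap_ge0 q_ge0 q_meas q_int one_class v; nra.
have lo : expR (- (K%:R * dyadic_cost J)) <= \det (lapl c) by exact: lapl_dyadic.
have n1K : 0 <= (1 + n%:R) ^+ K :> R by rewrite exprn_ge0// addr_ge0// ltW.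
have step : expR (- 2) * second_moment <= (\det X)^-1.
  by apply: le_trans shrunk_le; rewrite ler_wpM2r// second_moment_ge0.
have e2 : 0 < expR (- 2) :> R := expR_gt0 _.
rewrite -(ler_pM2l e2) (le_trans step)// !mulrA -expRD addNr expR0 mul1r.
rewrite -[leLHS]mul1r ler_pdivrMr// -mulrA [expR _ * _]mulrC mulrA.
rewrite -ler_pdivrMr ?expR_gt0// mul1r -expRN.
exact: le_trans lo ndet.
Qed.

(** [permanent_expand] with t of the order of the inverse of the trace, for which
    the bound by the determinant is a constant. *)
Lemma second_moment_le_small L t : 0 <= L <= 6^-1 -> 1 <= t -> 36 * L ^+ 2 * t <= 1 ->
  (forall i j, `|u i - u j| <= L) -> second_moment - 1 <= expR 1 / t ^+ 2.
Proof.
move=> L01 t1 tL uL; have t0 : 0 < t by exact: lt_le_trans t1.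
have L2 : 0 <= L ^+ 2 by exact: sqr_ge0.
pose D := ov one_class - avgmx R one_class.
have trD : \sum_i D i i <= 18 * L ^+ 2.
  have := @trace_class_le _ one_class ord0 L L01 (fun i j _ _ => uL i j).
  by rewrite big_mkcond.
have D_ge0 v : 0 <= quad D v.
  by have := B_ge0 v; rewrite quadZ pmulr_rge0// ltr0n.
have D_le v : quad D v <= 18 * L ^+ 2 * \sum_i v i ^+ 2.
  have := @quad_le_trace _ _ D [set: _]%SET v (@sub_avgmx_sym _ one_class) D_ge0.
  move=> /(_ _)/le_trans; apply; first by move=> i; rewrite inE.
  rewrite (eq_bigl xpredT) => [|i]; last by rewrite inE.
  rewrite [X in _ * X <= _](eq_bigl xpredT) => [|i]; last by rewrite inE.
  by rewrite ler_wpM2r// sumr_ge0// => i _; exact: sqr_ge0.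
have := permanent_expand B_sym B_sum0 B_ge0 t1; rewrite -one_classE => ex.
rewrite ler_pdivlMr ?exprn_gt0// -(ler_pM2r fact_gt0R).
have -> : (second_moment - 1) * t ^+ 2 * m.+1`!%:R =
    t ^+ 2 * (permanent (m.+1%:R *: ov one_class) - m.+1`!%:R).
  by rewrite /second_moment; field; rewrite gt_eqF// fact_gt0R.
apply: (le_trans ex); apply: (@le_trans _ _ (permanent (const_mx 1 + t *: B))).
  by rewrite gerBl ltW// fact_gt0R.
have tBE : m.+1%:R^-1 *: (t *: B) = t *: D.
  by rewrite /B !scalerA mulrAC mulVf ?pnatr_eq0// mul1r.
have t_half : t * (18 * L ^+ 2) <= 2^-1 by lra.
have sum_ge0 (v : 'I_m.+1 -> R) : 0 <= \sum_i v i ^+ 2.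
  by rewrite sumr_ge0// => i _; exact: sqr_ge0.
have tD_le v : quad (t *: D) v <= 2^-1 * \sum_i v i ^+ 2.
  rewrite quadZ; apply: (@le_trans _ _ (t * (18 * L ^+ 2 * \sum_i v i ^+ 2))).
    by rewrite ler_wpM2l// ltW.
  by rewrite mulrA ler_wpM2r.
have detE : expR (- 1) <= \det (1%:M - t *: D).
  apply: le_trans (det_ge_expR_trace _ _ tD_le).
  - rewrite ler_expR lerN2; under eq_bigr => i _ do rewrite mxE.
    rewrite -mulr_sumr; have := ler_wpM2l (ltW t0) trD; lra.
  - by move=> i j; rewrite [LHS]mxE [RHS]mxE sub_avgmx_sym.
  - by move=> v; rewrite quadZ mulr_ge0// ltW.
have := @permanent_le_det _ _ (t *: B) _ _ _ (2^-1 * m.+1%:R) _ _.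
move=> /(_ _ _ _ _ _)/le_trans; apply.
- by move=> i j; rewrite [LHS]mxE [RHS]mxE B_sym.
- by move=> i; under eq_bigr => j _ do rewrite mxE; rewrite -mulr_sumr B_sum0 mulr0.
- by move=> v; rewrite quadZ mulr_ge0 ?B_ge0// ltW.
- by rewrite gtr_pMl ?ltr0n//; lra.
- move=> v; have := tD_le v; rewrite -tBE quadZ -(ler_pM2l (x := m.+1%:R)) ?ltr0n//.
  by rewrite mulVKf ?pnatr_eq0// mulrA [m.+1%:R * _]mulrC.
rewrite tBE mulrC; apply: ler_wpM2r; first by rewrite ltW// fact_gt0R.
have e1 : 0 < expR (- 1) :> R := expR_gt0 _.
by rewrite -[expR 1]invrK -expRN lef_pV2 ?posrE// (lt_le_trans e1).
Qed.

End UpperBound.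

(** * Densities and product measures *)

Section Density.
Local Open Scope ereal_scope.

Definition has_density d (T : measurableType d) (R : realType)
    (P : set T -> \bar R) (mu : {measure set T -> \bar R}) (g : T -> R) :=
  [/\ forall x, (0 <= g x)%R, measurable_fun setT g &
      forall A, measurable A -> P A = \int[mu]_(x in A) (g x)%:E].

Lemma density_dominates d (T : measurableType d) (R : realType)
    (P : set T -> \bar R) (mu : {measure set T -> \bar R}) (g : T -> R) :
  has_density P mu g -> P `<< mu.
Proof.
move=> [g0 mg Pg]; apply/null_content_dominatesP => A mA muA.
rewrite Pg//; apply: null_set_integral => //.
by apply/measurable_EFinP; apply: measurable_funTS.
Qed.

Lemma density_integral d (T : measurableType d) (R : realType)
    (P : probability T R) (mu : {sigma_finite_measure set T -> \bar R})
    (g : T -> R) (phi : T -> \bar R) :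
  has_density P mu g -> (forall x, 0 <= phi x) -> measurable_fun setT phi ->
  \int[P]_x phi x = \int[mu]_x (phi x * (g x)%:E).
Proof.
move=> Pg phi0 mphi; have Pmu := density_dominates Pg; case: Pg => g0 mg Pg.
rewrite -(Radon_Nikodym_SigmaFinite.change_of_variables Pmu phi0 _ mphi)//.
pose f := Radon_Nikodym_SigmaFinite.f P mu.
have fi : mu.-integrable setT f by exact: Radon_Nikodym_SigmaFinite.f_integrable.
have mf := measurable_int _ fi.
have mg' : measurable_fun setT (EFin \o g) by exact/measurable_EFinP.
apply: ge0_ae_eq_integral => //.
- exact: emeasurable_funM.
- exact: emeasurable_funM.
- by move=> x _; rewrite mule_ge0// Radon_Nikodym_SigmaFinite.f_ge0.
- by move=> x _; rewrite mule_ge0// lee_fin.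
apply: ae_eqe_mul2l; apply: integral_ae_eq => // E _ mE.
exact: etrans (esym (Radon_Nikodym_SigmaFinite.f_integral Pmu mE)) (Pg _ mE).
Qed.

Section Tuple.
Context d (T : measurableType d) (R : realType).

Lemma measurable_prod_tnth n (g : 'I_n -> T -> R) :
  (forall i, measurable_fun setT (g i)) ->
  measurable_fun [set: n.-tuple T] (fun x => \prod_i g i (tnth x i))%R.
Proof.
move=> mg; apply: measurable_prod => i _.
by apply: (measurableT_comp (mg i)); exact: measurable_tnth.
Qed.

Lemma tuple_prob_integral n (P : 'I_n.+1 -> probability T R)
    (phi : n.+1.-tuple T -> \bar R) :
  (forall x, 0 <= phi x) -> measurable_fun setT phi ->
  \int[tuple_prob P]_x phi x =
  \int[P ord0]_x \int[tuple_prob (fun i => P (lift ord0 i))]_y phi (tcons (x, y)).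
Proof.
move=> phi0 mphi.
rewrite /= ge0_integral_pushforward//=.
rewrite fubini_tonelli1//.
exact: measurableT_comp.
Qed.

(** By Fubini, one coordinate at a time. *)
Lemma tuple_prob_density n (P Q : 'I_n -> probability T R)
    (g : 'I_n -> T -> R) (phi : n.-tuple T -> \bar R) :
  (forall i, has_density (P i) (Q i) (g i)) ->
  (forall x, 0 <= phi x) -> measurable_fun setT phi ->
  \int[tuple_prob P]_x phi x =
  \int[tuple_prob Q]_x (phi x * (\prod_i g i (tnth x i))%:E).
Proof.
elim: n P Q g phi => [|n IH] P Q g phi Pg phi0 mphi.
  by apply: eq_integral => x _; rewrite big_ord0 mule1.
pose g' (i : 'I_n) := g (lift ord0 i).
pose Q' (i : 'I_n) := Q (lift ord0 i).
have mg i : measurable_fun setT (g i) by have [] := Pg i.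
have mprod := measurable_prod_tnth mg.
have mprod' := measurable_prod_tnth (fun i : 'I_n => mg (lift ord0 i)).
have prod0 k (h : 'I_k -> T -> R) (y : k.-tuple T) :
    (forall i x, (0 <= h i x)%R) -> (0 <= \prod_i h i (tnth y i))%R.
  by move=> h0; apply: prodr_ge0.
have g0 i x : (0 <= g i x)%R by have [] := Pg i.
pose F x := \int[tuple_prob Q']_y
  (phi (tcons (x, y)) * (\prod_i g' i (tnth y i))%:E).
have mphi' : measurable_fun setT (fun z : T * n.-tuple T =>
    phi (tcons z) * (\prod_i g' i (tnth z.2 i))%:E).
  apply: emeasurable_funM; first exact: measurableT_comp.
  apply/measurable_EFinP.
  by apply: (measurableT_comp mprod'); exact: measurable_snd.
have phi'0 z : 0 <= phi (tcons z) * (\prod_i g' i (tnth z.2 i))%:E.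
  by rewrite mule_ge0// lee_fin prod0// => i x; exact: g0.
have mF : measurable_fun setT F.
  exact: (measurable_fun_fubini_tonelli_F (m2 := tuple_prob Q') _ mphi' phi'0).
have F0 x : 0 <= F x by apply: integral_ge0 => y _; exact: (phi'0 (x, y)).
rewrite tuple_prob_integral//.
transitivity (\int[P ord0]_x F x).
  apply: eq_integral => x _.
  apply: (IH (fun i => P (lift ord0 i)) Q' g') => //.
  apply: measurableT_comp => //.
  apply: measurableT_comp; first exact: measurable_tcons.
  exact: pair1_measurable.
rewrite (density_integral (Pg ord0))// tuple_prob_integral//; last 2 first.
  by move=> x; rewrite mule_ge0// lee_fin prod0.
  by apply: emeasurable_funM => //; exact/measurable_EFinP.
apply: eq_integral => x _; rewrite /F muleC -ge0_integralZl//.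
- apply: eq_integral => y _; rewrite muleCA -EFinM big_ord_recl; congr (_ * (_ * _)%:E).
  by apply: eq_bigr => i _; rewrite /g' tnthS.
- by apply: (measurableT_comp mphi'); exact: pair1_measurable.
- by rewrite lee_fin.
Qed.

Lemma tuple_prob_prod n (P : 'I_n -> probability T R) (g : 'I_n -> T -> R) :
  (forall i x, (0 <= g i x)%R) -> (forall i, measurable_fun setT (g i)) ->
  \int[tuple_prob P]_x (\prod_i g i (tnth x i))%:E =
  \prod_i \int[P i]_x (g i x)%:E.
Proof.
elim: n P g => [|n IH] P g g0 mg.
  rewrite big_ord0; under eq_integral do rewrite big_ord0.
  by rewrite integral_cst//= diracT mule1.
rewrite tuple_prob_integral; last 2 first.
  by move=> x; rewrite lee_fin prodr_ge0.
  by apply/measurable_EFinP; exact: measurable_prod_tnth.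
rewrite big_ord_recl -IH//.
set c := \int[tuple_prob _]_x _.
have c0 : 0 <= c by apply: integral_ge0 => y _; rewrite lee_fin prodr_ge0.
rewrite -ge0_integralZr//; last 2 first.
  by apply/measurable_EFinP.
  by move=> x _; rewrite lee_fin.
apply: eq_integral => x _; rewrite /c -ge0_integralZl//.
- apply: eq_integral => y _; rewrite big_ord_recl -EFinM; congr (_ * _)%:E.
  by apply: eq_bigr => i _; rewrite tnthS.
- apply/measurable_EFinP.
  exact: (measurable_prod_tnth (fun i : 'I_n => mg (lift ord0 i))).
- by move=> y _; rewrite lee_fin prodr_ge0.
- by rewrite lee_fin.
Qed.

End Tuple.
End Density.

(** * The divergence as a permanent *)

Section Chi2Permanent.
Context d (T : measurableType d) (R : realType).
Variable nu : {sigma_finite_measure set T -> \bar R}.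
Variables (m : nat) (P : 'I_m.+1 -> probability T R) (q : 'I_m.+1 -> T -> R).
Hypothesis Pq : forall i, has_density (P i) nu (q i).

Let q_ge0 i x : 0 <= q i x. Proof. by have [] := Pq i. Qed.
Let q_meas i : measurable_fun setT (q i). Proof. by have [] := Pq i. Qed.
Let q_int i : (\int[nu]_x (q i x)%:E = 1)%E.
Proof. by have [_ _ <-//] := Pq i; rewrite probability_setT. Qed.

Let S x := class_mass (q ^~ x) (one_class (m := m)) ord0.
(** The density of [P i] with respect to the average of the [P i]. *)
Let f i x := m.+1%:R * q i x / S x.

Let S_ge0 x : 0 <= S x. Proof. exact: class_mass_ge0. Qed.

Let S_meas : measurable_fun setT S.
Proof. exact: mass_meas. Qed.

Let f_ge0 i x : 0 <= f i x.
Proof. by rewrite divr_ge0// mulr_ge0. Qed.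

Let f_meas i : measurable_fun setT (f i).
Proof.
apply: measurable_funM; first exact: measurable_funM.
under eq_fun do rewrite -powR_inv1//.
exact: (measurableT_comp (measurable_powR _)).
Qed.

Let pbar := mixture ord0 P : probability T R.

Let pbar_density : has_density pbar nu (fun x => S x / m.+1%:R).
Proof.
split=> [x| |A mA]; first by rewrite divr_ge0.
  exact: measurable_funM.
rewrite /pbar /= /mixture card_ord.
under eq_bigr => i _ do (have [_ _ ->//] := Pq i).
rewrite -ge0_integral_sum//; last 2 first.
  by move=> i; apply/measurable_EFinP/measurable_funTS.
  by move=> i x _; rewrite lee_fin.
rewrite -ge0_integralZl//; last 2 first.
  apply: emeasurable_sum => i; apply/measurable_EFinP/measurable_funTS.
  exact: q_meas.
  by move=> x _; apply: sume_ge0 => i _; rewrite lee_fin.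
apply: eq_integral => x _; rewrite sumEFin -EFinM mulrC.
by rewrite /S /class_mass.
Qed.

Let f_pbar i x : f i x * (S x / m.+1%:R) = q i x.
Proof.
have W : q i x * (S x / S x) = q i x.
  exact: (weight_mulfV (q_ge0 ^~ x) (one_class (m := m)) i).
transitivity (q i x * (S x / S x) * (m.+1%:R / m.+1%:R)).
  by rewrite /f; ring.
by rewrite W mulfV ?mulr1// pnatr_eq0.
Qed.

Let P_density i : has_density (P i) pbar (f i).
Proof.
split=> // A mA; have [_ _ ->//] := Pq i.
rewrite integral_mkcond [RHS]integral_mkcond.
rewrite (density_integral pbar_density); last 2 first.
  by move=> x; rewrite erestrict_ge0// => y _; rewrite lee_fin.
  apply/(measurable_restrictT _ mA)/measurable_funTS.
  exact/measurable_EFinP.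
apply: eq_integral => x _; rewrite !patchE; case: ifP => _; last by rewrite mul0e.
by rewrite -EFinM f_pbar.
Qed.

(** The likelihood ratio of the permutation mixture to the mean field. *)
Let h (x : m.+1.-tuple T) : R :=
  (m.+1`!)%:R^-1 * \sum_(s : 'S_m.+1) \prod_i f (s i) (tnth x i).

Let h_ge0 x : 0 <= h x.
Proof. by rewrite mulr_ge0// sumr_ge0// => s _; exact: prodr_ge0. Qed.

Let h_meas : measurable_fun setT h.
Proof.
apply: measurable_funM => //; apply: measurable_sum => s.
exact: (measurable_prod_tnth (fun i => f_meas (s i))).
Qed.

Lemma perm_mixture_density : has_density (perm_mixture P) (mean_field P) h.
Proof.
split=> // A mA; rewrite /perm_mixture /= /mixture card_Sn.
have tpE (s : 'S_m.+1) : tuple_prob (fun i => P (s i)) A =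
    (\int[mean_field P]_(x in A) (\prod_i f (s i) (tnth x i))%:E)%E.
  transitivity (\int[tuple_prob (fun i => P (s i))]_x (\1_A x)%:E)%E.
    by rewrite integral_indic// setIT.
  rewrite (tuple_prob_density (Q := fun=> pbar) (g := fun i => f (s i)))//.
    rewrite [RHS]integral_mkcond; apply: eq_integral => x _.
    rewrite patchE indicE; case: ifP => _; first by rewrite mul1e.
    by rewrite mul0e.
  by apply/measurable_EFinP; exact: measurable_indic.
under eq_bigr => s _ do rewrite tpE.
have mp (s : 'S_m.+1) := measurable_prod_tnth (fun i => f_meas (s i)).
rewrite -ge0_integral_sum//; last 2 first.
  by move=> s; apply/measurable_EFinP/measurable_funTS; exact: mp.
  by move=> s x _; rewrite lee_fin prodr_ge0.
rewrite -ge0_integralZl//; last 2 first.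
  apply: emeasurable_sum => s; apply/measurable_EFinP/measurable_funTS.
  exact: mp.
  by move=> x _; apply: sume_ge0 => s _; rewrite lee_fin prodr_ge0.
by apply: eq_integral => x _; rewrite sumEFin -EFinM.
Qed.

Let ov_int i j : (\int[pbar]_x (f i x * f j x)%:E =
  (m.+1%:R * overlap nu q (one_class (m := m)) i j)%:E)%E.
Proof.
rewrite (density_integral pbar_density); last 2 first.
  by move=> x; rewrite lee_fin mulr_ge0.
  by apply/measurable_EFinP; exact: measurable_funM.
have Ik := kernel_intble q_ge0 q_meas q_int (one_class (m := m)) i j.
rewrite mxE EFinM /Rintegral fineK; last exact: integrable_fin_num.
rewrite -ge0_integralZl//; last 2 first.
  by apply: measurable_int Ik.
  by move=> x _; rewrite lee_fin class_kernel_ge0.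
apply: eq_integral => x _; rewrite -!EFinM; congr (_%:E).
rewrite -mulrA mulrCA f_pbar /f /class_kernel eqxx -/(S x); ring.
Qed.

Let h_int : (\int[mean_field P]_x (h x)%:E = 1)%E.
Proof.
have [_ _ <-//] := perm_mixture_density; exact: probability_setT.
Qed.

Let h2_int : (\int[mean_field P]_x (h x ^+ 2)%:E = (second_moment nu q)%:E)%E.
Proof.
pose M := m.+1%:R *: overlap nu q (one_class (m := m)).
pose F (s t : 'S_m.+1) (x : m.+1.-tuple T) :=
  \prod_i (f (s i) (tnth x i) * f (t i) (tnth x i)).
have F_ge0 s t x : 0 <= F s t x by apply: prodr_ge0 => i _; rewrite mulr_ge0.
have F_meas s t : measurable_fun setT (F s t).
  apply: (measurable_prod_tnth (g := fun i x => f (s i) x * f (t i) x)) => i.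
  exact: measurable_funM.
have FE s t : (\int[mean_field P]_x (F s t x)%:E =
    (\prod_i M (s i) (t i))%:E)%E.
  rewrite (tuple_prob_prod _ (g := fun i x => f (s i) x * f (t i) x)).
  - rewrite -prodEFin; apply: eq_bigr => i _.
    by rewrite ov_int /M [X in _ = X%:E]mxE.
  - by move=> i x; rewrite mulr_ge0.
  - by move=> i; exact: measurable_funM.
have h2E x : h x ^+ 2 = (m.+1`!%:R^-1) ^+ 2 * \sum_s \sum_t F s t x.
  rewrite /h exprMn; congr (_ * _); rewrite expr2 big_distrlr/=.
  apply: eq_bigr => s _; apply: eq_bigr => t _.
  by rewrite /F [RHS]big_split.
under eq_integral do rewrite h2E EFinM -sumEFin.
rewrite ge0_integralZl//; last 2 first.
  apply: emeasurable_sum => s; apply/measurable_EFinP.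
  by apply: measurable_sum => t; exact: F_meas.
  by move=> x _; apply: sume_ge0 => s _; rewrite lee_fin sumr_ge0.
rewrite ge0_integral_sum//; last 2 first.
  move=> s; apply/measurable_EFinP.
  by apply: measurable_sum => t; exact: F_meas.
  by move=> s x _; rewrite lee_fin sumr_ge0.
transitivity ((m.+1`!%:R^-1 ^+ 2)%:E * \sum_(s : 'S_m.+1) (permanent M)%:E)%E.
  congr (_ * _)%E; apply: eq_bigr => s _.
  under eq_integral do rewrite -sumEFin.
  rewrite ge0_integral_sum//; last 2 first.
    by move=> t; apply/measurable_EFinP.
    by move=> t x _; rewrite lee_fin.
  rewrite (eq_bigr _ (fun t _ => FE s t)) sumEFin; congr (_%:E).
  (* the (s, t) term depends on s^-1 t only *)
  rewrite /permanent (reindex_inj (mulgI s)); apply: eq_bigr => t _.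
  rewrite [RHS](reindex_inj (@perm_inj _ s)); apply: eq_bigr => i _.
  by rewrite permM.
rewrite sumEFin sumr_const card_Sn -EFinM /second_moment -/M; congr (_%:E).
rewrite -mulr_natl; field.
by rewrite pnatr_eq0 -lt0n fact_gt0.
Qed.

(** Expanding the square of the likelihood ratio gives a double sum over
    permutations of products of overlaps, in which every permutation contributes
    the same permanent. *)
Theorem chi2_div_permanent :
  chi2_div (perm_mixture P) (mean_field P) = (second_moment nu q - 1)%:E.
Proof.
have dens := perm_mixture_density; have dom := density_dominates dens.
rewrite /chi2_div; case: pselect => // dom'.
set RN := Radon_Nikodym _ _.
have RN_int : (mean_field P).-integrable setT RN.
  exact: Radon_Nikodym_integrable.
have RNh : ae_eq (mean_field P) setT RN (EFin \o h).
  apply: integral_ae_eq => // [|E _ mE]; first exact/measurable_EFinP.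
  have RNE := @Radon_Nikodym_integral _ _ _
    (charge_of_finite_measure (perm_mixture P)) (mean_field P) E dom' mE.
  by apply: etrans (esym RNE) _; have [_ _ /(_ E mE)] := dens.
have -> : (\int[mean_field P]_x (RN x - 1) ^+ 2 =
    \int[mean_field P]_x ((h x - 1) ^+ 2)%:E)%E.
  apply: ae_eq_integral => //.
  - have mRN := measurable_int _ RN_int.
    rewrite (_ : (fun x => _) = (fun x => (RN x - 1) * (RN x - 1))%E); last first.
      by apply/funext => x; rewrite expe2.
    by apply: emeasurable_funM; exact: emeasurable_funB.
  - apply/measurable_EFinP; apply: measurable_funX; exact: measurable_funB.
  - apply: filterS RNh => x /= RNx xT; rewrite RNx//=.
have h1_ge0 x : 0 <= (h x - 1) ^+ 2 by exact: sqr_ge0.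
have mh1 : measurable_fun setT (fun x => (h x - 1) ^+ 2).
  by apply: measurable_funX; exact: measurable_funB.
have E : (\int[mean_field P]_x ((h x - 1) ^+ 2)%:E + 2%:E =
    (second_moment nu q)%:E + 1%:E)%E.
  transitivity (\int[mean_field P]_x ((h x - 1) ^+ 2 + 2 * h x)%:E)%E.
    under [RHS]eq_integral do rewrite EFinD.
    rewrite ge0_integralD//=; last 4 first.
    - by move=> x _; rewrite lee_fin.
    - exact/measurable_EFinP.
    - by move=> x _; rewrite lee_fin mulr_ge0.
    - by apply/measurable_EFinP; exact: measurable_funM.
    congr (_ + _)%E; under eq_integral do rewrite EFinM.
    rewrite ge0_integralZl//=; last 2 first.
    - exact/measurable_EFinP.
    - by move=> x _; rewrite lee_fin.
    by rewrite h_int mule1.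
  transitivity (\int[mean_field P]_x (h x ^+ 2 + 1)%:E)%E.
    by apply: eq_integral => x _; congr (_%:E); ring.
  under eq_integral do rewrite EFinD.
  rewrite ge0_integralD//=; last 2 first.
  - by move=> x _; rewrite lee_fin sqr_ge0.
  - by apply/measurable_EFinP; exact: measurable_funX.
  rewrite h2_int; congr (_ + _)%E; rewrite integral_cst// mul1e.
  exact: probability_setT.
have : (\int[mean_field P]_x ((h x - 1) ^+ 2)%:E)%E \is a fin_num.
  have : (\int[mean_field P]_x ((h x - 1) ^+ 2)%:E + 2%:E)%E \is a fin_num.
    by rewrite E.
  by rewrite fin_numD => /andP[].
move: E; case: (\int[_]_x _)%E => // r; rewrite -!EFinD => -[E] _.
congr (_%:E); lra.
Qed.
End Chi2Permanent.

(** * Lower bounds from balanced groups *)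

(** The bound (2 a + 1) 'C(2 a, a)^2 <= 16^a, without division. *)
Lemma central_factorial_le a :
  ((2 * a).+1 * (2 * a)`! ^ 2 <= 16 ^ a * a`! ^ 4)%N.
Proof.
elim: a => [//|a IH].
have -> : (2 * a.+1 = (2 * a).+2)%N by lia.
rewrite !factS [(16 ^ a.+1)%N]expnS.
move: IH; move: ((2 * a)`!) (a`!) (16 ^ a)%N => x y z IH.
have e1 : ((2 * a).+3 * (2 * a).+1 <= 4 * (a.+1 * a.+1))%N by nia.
have e2 : ((2 * a).+2 * (2 * a).+2 = 4 * (a.+1 * a.+1))%N by nia.
have E := leq_mul e1 (leqnn ((2 * a).+2 * (2 * a).+2)); rewrite {2}e2 in E.
have := leq_mul E IH.
by congr (_ <= _)%N; rewrite !(expnS, expn0); ring.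
Qed.

Lemma bernoulli_le (R : realFieldType) n (e : R) : 0 <= e <= 1 ->
  1 - n%:R * e <= (1 - e) ^+ n.
Proof.
move=> /andP[e0 e1]; elim: n => [|n IH]; first by rewrite mul0r subr0 expr0.
rewrite exprS; apply: (@le_trans _ _ ((1 - e) * (1 - n%:R * e))).
  have : 0 <= n%:R * e * e :> R by rewrite !mulr_ge0.
  by rewrite -natr1; lra.
by rewrite ler_wpM2l// subr_ge0.
Qed.

Lemma mult_modn k s (kgt0 : (0 < k)%N) (b : 'I_k) :
  mult (fun i : 'I_(k * s) => Ordinal (ltn_pmod i kgt0)) b = s.
Proof.
rewrite /mult -(big_mkord xpredT (fun i => (Ordinal (ltn_pmod i kgt0) == b) : nat)).
elim: s => [|s IH]; first by rewrite muln0 big_geq.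
rewrite mulnS addnC (big_cat_nat _ (n := (k * s)%N))//=; last exact: leq_addr.
rewrite IH -{1}[(k * s)%N]add0n big_addn addKn big_mkord.
rewrite (bigD1 b)//= big1 ?addn0.
  have -> : Ordinal (ltn_pmod (b + k * s) kgt0) = b.
    by apply/val_inj; rewrite /= addnC mulnC modnMDl modn_small.
  by rewrite eqxx addn1.
move=> j jb; rewrite (_ : _ == b = false)//; apply/negbTE; apply: contra jb.
by move=> /eqP/(congr1 val)/=; rewrite addnC mulnC modnMDl modn_small// => jb; apply/eqP/val_inj.
Qed.

Section Blocks.
Variable R : realType.

(** The inverse of the probability that k s independent uniform labels, in a set
    of size k, are perfectly balanced. *)
Definition block_ratio (k s : nat) : R :=
  (s`! ^ k)%:R * k%:R ^+ (k * s) / ((k * s)`!)%:R.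

Lemma block_ratio_ge0 k s : 0 <= block_ratio k s.
Proof. by rewrite divr_ge0// mulr_ge0// exprn_ge0. Qed.

(** Two halves of a = k s labels each: the ratio is squared and multiplied by
    4^a (a!)^2 / (2 a)!, the inverse of the probability that the halves are
    balanced. *)
Lemma block_ratio_double k s : (0 < k)%N -> (0 < s)%N ->
  (2 * s)%:R * block_ratio k s ^+ 4 <= block_ratio (2 * k) s ^+ 2.
Proof.
move=> k0 s0; pose a := (k * s)%N.
have fa0 : 0 < a`!%:R :> R by rewrite ltr0n fact_gt0.
have f2a0 : 0 < (2 * a)`!%:R :> R by rewrite ltr0n fact_gt0.
pose c : R := a`!%:R ^+ 2 * 4 ^+ a / (2 * a)`!%:R.
have -> : block_ratio (2 * k) s = block_ratio k s ^+ 2 * c.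
  rewrite /block_ratio /c -mulnA -/a [(2 * k)%N]mulnC expnM natrX.
  rewrite [(k * 2)%:R]natrM exprMn [(2 * a)%N]mulnC ![_ ^+ (a * 2)]exprM.
  rewrite [2 ^+ a ^+ 2]exprAC (_ : 2 ^+ 2 = 4) ?[((_ ^ k) ^ 2)%:R]natrX; last by ring.
  by field; rewrite !gt_eqF// mulnC.
have -> : (block_ratio k s ^+ 2 * c) ^+ 2 = block_ratio k s ^+ 4 * c ^+ 2.
  by ring.
rewrite mulrC ler_wpM2l ?exprn_ge0 ?block_ratio_ge0//.
have := central_factorial_le a; rewrite -(ler_nat R) !natrM !natrX => H.
rewrite /c expr_div_n ler_pdivlMr ?exprn_gt0// exprMn -exprM -exprM.
rewrite [X in _ <= _ * X](_ : _ = 16 ^+ a); last first.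
  by rewrite mulnC exprM; congr (_ ^+ _); ring.
rewrite mulrC [leRHS]mulrC mulrC (le_trans _ H)// ler_wpM2r ?exprn_ge0//.
rewrite -natrM ler_nat ltnW// ltnS leq_mul2l/= /a.
by rewrite leq_pmull.
Qed.

Lemma block_ratio_pow2 r s : (0 < s)%N ->
  (2 * s)%:R ^+ (2 ^ r).-1 <= block_ratio (2 ^ r) s ^+ 2.
Proof.
move=> s0; elim: r => [|r IH].
  rewrite expn0 /block_ratio expr0 !mul1n expn1 expr1n mulr1.
  by rewrite divff ?expr1n// pnatr_eq0 -lt0n fact_gt0.
rewrite expnS; apply: le_trans (block_ratio_double _ s0); last by rewrite expn_gt0.
have -> : (2 * 2 ^ r).-1 = ((2 ^ r).-1 * 2).+1.
  by have := expn_gt0 2 r; lia.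
rewrite exprS ler_wpM2l// exprM (exprM _ 2 2).
by rewrite lerXn2r ?nnegrE ?exprn_ge0 ?block_ratio_ge0.
Qed.

End Blocks.

Lemma permanent_recl (F : comNzRingType) n (A : 'M[F]_n.+1) :
  permanent A = \sum_j A ord0 j * permanent (row' ord0 (col' j A)).
Proof.
rewrite /permanent sum_perm_recl; apply: eq_bigr => j _.
rewrite big_distrr; apply: eq_bigr => s _.
rewrite big_ord_recl lift_perm_id; congr (_ * _).
by apply: eq_bigr => i _; rewrite lift_perm_lift !mxE.
Qed.

Lemma permanent_mx2 (F : comNzRingType) (A : 'M[F]_2) :
  permanent A = A ord0 ord0 * A ord_max ord_max + A ord0 ord_max * A ord_max ord0.
Proof.
have p0 (B : 'M[F]_0) : permanent B = 1.
  rewrite /permanent (big_pred1 (1%g : 'S_0)) ?big_ord0// => s; symmetry.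
  by apply/eqP/permP => -[].
rewrite permanent_recl !big_ord_recl big_ord0 !permanent_recl !big_ord_recl !big_ord0.
by rewrite !p0 !mxE !mulr1 !addr0; congr (_ * A _ _ + A _ _ * A _ _); exact/val_inj.
Qed.

Section LowerBound.
Context d (T : measurableType d) (R : realType).
Variable nu : {measure set T -> \bar R}.

Lemma sqrt_le_half_sum (a b : R) : 0 <= a -> 0 <= b ->
  2 * Num.sqrt (a * b) <= a + b.
Proof.
move=> a0 b0; have ab0 : 0 <= a * b by exact: mulr_ge0.
rewrite -[leRHS]ger0_norm ?addr_ge0// -sqrtr_sqr.
rewrite -[2]ger0_norm// -sqrtr_sqr -sqrtrM ?sqr_ge0// ler_wsqrtr//.
rewrite -subr_ge0; have -> : (a + b) ^+ 2 - 2 ^+ 2 * (a * b) = (a - b) ^+ 2 by ring.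
exact: sqr_ge0.
Qed.

Section Pair.
Variables (m : nat) (q : 'I_m -> T -> R).
Hypothesis q_ge0 : forall i x, 0 <= q i x.
Hypothesis q_meas : forall i, measurable_fun setT (q i).
Hypothesis q_int : forall i, (\int[nu]_x (q i x)%:E = 1)%E.
Variables (K : finType) (c : 'I_m -> K).

Lemma sqrt_intble i j : intble nu (fun x => Num.sqrt (q i x * q j x)).
Proof.
apply: (intble_le _ (intbleD (q_intble q_ge0 q_meas q_int i)
  (q_intble q_ge0 q_meas q_int j))) => [|x].
  apply: measurableT_comp.
    by apply: continuous_measurable_fun; exact: sqrt_continuous.
  exact: measurable_funM.
rewrite ger0_norm ?sqrtr_ge0//.
have := sqrt_le_half_sum (q_ge0 i x) (q_ge0 j x).
have := sqrtr_ge0 (q i x * q j x); lra.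
Qed.

(** From q_i q_j / S <= q_i q_j / (q_i + q_j) and AM-GM in the denominator. *)
Lemma overlap_le_affinity i j : i != j ->
  overlap nu q c i j <= 2^-1 * \int[nu]_x Num.sqrt (q i x * q j x).
Proof.
move=> ij; rewrite mxE -RintegralZl//; last exact: sqrt_intble.
apply: le_Rint => [||x]; first exact: kernel_intble.
  exact/intbleZ/sqrt_intble.
rewrite /class_kernel; case: eqP => [cij|_]; last first.
  by rewrite mulr_ge0 ?sqrtr_ge0.
set S := class_mass _ _ _; set r := Num.sqrt _.
have p0 : 0 <= q i x * q j x by exact: mulr_ge0.
have rr : q i x * q j x = r ^+ 2 by rewrite sqr_sqrtr.
have r0 : 0 <= r by exact: sqrtr_ge0.
have rS : 2 * r <= S.
  apply: (le_trans (sqrt_le_half_sum (q_ge0 i x) (q_ge0 j x))).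
  rewrite /S /class_mass (bigD1 i)//= lerD2l (bigD1 j)//=; last first.
    by rewrite cij eqxx eq_sym.
  by rewrite lerDl sumr_ge0.
have [S0|S0] := eqVneq S 0; first by rewrite S0 invr0 mulr0 mulr_ge0.
have S_gt0 : 0 < S by rewrite lt_neqAle eq_sym S0 (le_trans _ rS)// mulr_ge0.
by rewrite rr ler_pdivrMr// expr2 mulrAC ler_wpM2r//; lra.
Qed.

End Pair.

(** If b is the overlap of the two densities, the permanent is
    (2 (1 - b))^2 + (2 b)^2, and the divergence is (1 - 2 b)^2. *)
Lemma second_moment_pair (q : 'I_2 -> T -> R) :
  (forall i x, 0 <= q i x) -> (forall i, measurable_fun setT (q i)) ->
  (forall i, (\int[nu]_x (q i x)%:E = 1)%E) ->
  \int[nu]_x Num.sqrt (q ord0 x * q ord_max x) <= 1 ->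
  (1 - \int[nu]_x Num.sqrt (q ord0 x * q ord_max x)) ^+ 2 <= second_moment nu q - 1.
Proof.
move=> q0 qm qi; set rho := \int[nu]_x _ => rho1.
pose A := overlap nu q (one_class (m := 1)).
have [A_sym A1] := overlap_stochastic q0 qm qi (one_class (m := 1)).
pose b := A ord0 ord_max.
have br : b <= 2^-1 * rho by exact: overlap_le_affinity.
have A01 : A ord0 ord0 = 1 - b.
  by have := A1 ord0; rewrite !big_ord_recl big_ord0 addr0 -/A;
    rewrite (_ : lift _ _ = ord_max) -/b; [lra|exact/val_inj].
have A11 : A ord_max ord_max = 1 - b.
  have := A1 ord_max; rewrite !big_ord_recl big_ord0 addr0 -/A.
  rewrite (_ : lift _ _ = ord_max); last exact/val_inj.
  by rewrite A_sym -/A -/b; lra.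
have -> : second_moment nu q = 2 * ((1 - b) ^+ 2 + b ^+ 2).
  rewrite /second_moment -/A permanent_mx2 ![(_ *: A) _ _]mxE A01 A11 [A ord_max _]A_sym -/b.
  by rewrite !factS fact0; field.
have -> : 2 * ((1 - b) ^+ 2 + b ^+ 2) - 1 = (1 - 2 * b) ^+ 2 by ring.
by rewrite lerXn2r ?nnegrE//; lra.
Qed.

Section Groups.
Variables (k s m : nat) (p : 'I_k -> T -> R) (g : 'I_m.+1 -> 'I_k).
Hypothesis p_ge0 : forall a x, 0 <= p a x.
Hypothesis p_meas : forall a, measurable_fun setT (p a).
Hypothesis p_int : forall a, (\int[nu]_x (p a x)%:E = 1)%E.
Hypothesis s_gt0 : (0 < s)%N.
Hypothesis g_mult : forall a, mult g a = s.
Variable e : R.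
Hypothesis e_ge0 : 0 <= e.
Hypothesis p_aff : forall a b, a != b ->
  \int[nu]_x Num.sqrt (p a x * p b x) <= e.
Hypothesis kse : (k * s)%:R * (k%:R * e) <= 1.

Let q i := p (g i).
Let P := overlap nu p (fun _ => ord0 : 'I_1).

Lemma overlap_diag_ge a : 1 - 2^-1 * (k%:R * e) <= P a a.
Proof.
have := (overlap_stochastic p_ge0 p_meas p_int (fun _ => ord0 : 'I_1)).2 a.
rewrite -/P (bigD1 a)//= => /eqP; rewrite eq_sym -subr_eq => /eqP <-.
rewrite lerD2l lerN2 mulrCA -[X in X%:R * _](card_ord k) mulr_natl -sumr_const.
rewrite big_mkcond ler_sum// => b _; case: eqVneq => [_|ba] /=.
  by rewrite mulr_ge0.
have ab : a != b by rewrite eq_sym.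
have H := overlap_le_affinity p_ge0 p_meas p_int (fun _ => ord0 : 'I_1) ab.
by apply: (le_trans H); rewrite ler_wpM2l// p_aff.
Qed.

Lemma sum_groups (F : 'I_k -> R) : \sum_i F (g i) = s%:R * \sum_a F a.
Proof.
rewrite (partition_big g xpredT)//= mulr_sumr; apply: eq_bigr => a _.
rewrite (eq_bigr (fun=> F a)) => [|i /eqP->//].
rewrite sumr_const mulr_natl -(g_mult a) /mult; congr (_ *+ _).
rewrite -sum1_card big_mkcond; apply: eq_bigr => i _.
by rewrite unfold_in -[eqn _ _]/(g i == a); case: eqP.
Qed.

Lemma groups_card : m.+1 = (k * s)%N.
Proof.
apply/eqP; rewrite -(eqr_nat R) natrM mulrC; have := sum_groups (fun=> 1).
by rewrite !sumr_const !card_ord => ->.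
Qed.

Lemma overlap_groups i j : g i = g j ->
  m.+1%:R * overlap nu q (one_class (m := m)) i j = k%:R * P (g i) (g i).
Proof.
move=> gij; have s0 : s%:R != 0 :> R by rewrite pnatr_eq0 -lt0n.
have -> : m.+1%:R = k%:R * s%:R :> R by rewrite groups_card natrM.
rewrite -mulrA; congr (_ * _).
rewrite [X in _ * X]mxE [RHS]mxE -RintegralZl//; last first.
  by apply: kernel_intble => ?; [exact: p_ge0|exact: p_meas|exact: p_int].
apply: eq_Rintegral => x _; rewrite /class_kernel/= /q -gij.
have -> : class_mass (fun i => p (g i) x) (one_class (m := m)) i =
    s%:R * class_mass (p ^~ x) (fun=> ord0 : 'I_1) (g i).
  by rewrite /class_mass/= (sum_groups (p ^~ x)).
by rewrite invfM [LHS]mulrCA mulVKf.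
Qed.

(** Only the permutations that preserve the groups are kept. By the separation
    hypothesis the entries they use lose at most a factor 2 altogether, compared
    with groups of disjoint support. *)
Lemma second_moment_groups : 2^-1 * block_ratio R k s <= second_moment nu q.
Proof.
have k0 : (0 < k)%N by case: (k) (g ord0) => [[]|].
have ke : 0 <= 2^-1 * (k%:R * e) <= 1.
  have ke0 : 0 <= k%:R * e by rewrite mulr_ge0.
  rewrite mulr_ge0//=; have : k%:R * e <= 1; last by lra.
  by apply: (le_trans _ kse); rewrite ler_peMl// ler1n muln_gt0 k0.
pose b : R := k%:R * (1 - 2^-1 * (k%:R * e)).
have b0 : 0 <= b by rewrite mulr_ge0// subr_ge0; case/andP: ke.
pose W : R := (s`! ^ k)%:R * b ^+ m.+1.
have perm_ge : W <= permanent (m.+1%:R *: overlap nu q (one_class (m := m))).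
  have -> : W = \sum_(t : 'S_m.+1) (\prod_i (g (t i) == g i))%:R * b ^+ m.+1.
    rewrite -big_distrl -natr_sum card_matching.
    have -> : same_type g g by apply/forallP => ?.
    by under eq_bigr => a _ do rewrite g_mult; rewrite prod_nat_const card_ord.
  apply: ler_sum => t _; rewrite natr_prod.
  have -> : b ^+ m.+1 = \prod_(i < m.+1) b by rewrite prodr_const card_ord.
  rewrite -big_split; apply: ler_prod => i _ /=.
  rewrite mulr_ge0//= [X in _ <= X]mxE; case: eqP => [gi|_]; last first.
    by rewrite mul0r mulr_ge0// overlap_ge0// => ? ?; exact: p_ge0.
  by rewrite mul1r overlap_groups// ler_wpM2l// overlap_diag_ge.
rewrite /second_moment ler_pdivlMr ?ltr0n ?fact_gt0//; apply: le_trans perm_ge.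
have f0 : (k * s)`!%:R != 0 :> R by rewrite pnatr_eq0 -lt0n fact_gt0.
rewrite /W /b /block_ratio groups_card exprMn -[leLHS]mulrA divfK// [leLHS]mulrC [leRHS]mulrA.
rewrite ler_wpM2l ?mulr_ge0 ?exprn_ge0//.
apply: le_trans (bernoulli_le _ ke).
by move: kse; lra.
Qed.

End Groups.

End LowerBound.

(** * One-parameter families with Gaussian affinity *)

Section Family.
Context d (T : measurableType d) (R : realType).
Variable nu : {sigma_finite_measure set T -> \bar R}.
Variables (Pr : R -> probability T R) (p : R -> T -> R).
Hypothesis p_density : forall u, has_density (Pr u) nu (p u).
Hypothesis p_aff : forall u v, 0 <= u -> 0 <= v ->
  \int[nu]_x Num.sqrt (p u x * p v x) = expR (- ((u - v) ^+ 2 / 2)).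
Hypothesis p_trace : forall m (u : 'I_m.+1 -> R) (K : finType)
    (c : 'I_m.+1 -> K) (k : K) (L : R), (forall i, 0 <= u i) ->
  0 <= L <= 6^-1 -> (forall i j, c i = k -> c j = k -> `|u i - u j| <= L) ->
  \sum_(i | c i == k) overlap nu (fun i => p (u i)) c i i <= 1 + 18 * L ^+ 2.

Definition segment_family (B : R) : set (probability T R) :=
  [set Pr u | u in [set u | 0 <= u <= B]].

Local Notation chi2 B n := (chi2_family (segment_family B) n).

Let p_ge0 u x : 0 <= p u x. Proof. by case: (p_density u). Qed.
Let p_meas u : measurable_fun setT (p u). Proof. by case: (p_density u). Qed.
Let p_int u : (\int[nu]_x (p u x)%:E = 1)%E.
Proof.
by case: (p_density u) => _ _ <-; rewrite ?probability_setT.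
Qed.

Lemma chi2_family_le B n (C : R) :
  (forall m (u : 'I_m.+1 -> R), (m < n)%N -> (forall i, 0 <= u i <= B) ->
    second_moment nu (fun i => p (u i)) - 1 <= C) ->
  (chi2 B n <= C%:E)%E.
Proof.
move=> H; apply: bigmax_le => [|m _]; first exact: leNye.
apply: ge_ereal_sup => _ [P /= FP <-].
have /choice[u uP] : forall i, exists u, 0 <= u <= B /\ Pr u = P i.
  by move=> i; case: (FP i) => u; exists u.
have Pq i : has_density (P i) nu (p (u i)) by rewrite -(uP i).2.
by rewrite (chi2_div_permanent Pq) lee_fin H// => i; case: (uP i).
Qed.

Lemma le_chi2_family B n m (u : 'I_m.+1 -> R) (C : R) : (m < n)%N ->
  (forall i, 0 <= u i <= B) -> C <= second_moment nu (fun i => p (u i)) - 1 ->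
  (C%:E <= chi2 B n)%E.
Proof.
move=> mn uB H.
have Pq i : has_density (Pr (u i)) nu (p (u i)) by [].
apply: (le_trans _ (le_bigmax_cond _ _ (j := Ordinal mn) _)) => //=.
apply: ereal_sup_ge; exists (second_moment nu (fun i => p (u i)) - 1)%:E; last by rewrite lee_fin.
exists (fun i => Pr (u i)); last by rewrite (chi2_div_permanent Pq).
by move=> i /=; exists (u i) => //; exact: uB.
Qed.

Section Upper.
Variables (m : nat) (u : 'I_m.+1 -> R).
Hypothesis u_ge0 : forall i, 0 <= u i.

Let q_ge0 i x : 0 <= p (u i) x. Proof. exact: p_ge0. Qed.
Let q_meas i : measurable_fun setT (p (u i)). Proof. exact: p_meas. Qed.
Let q_int i : (\int[nu]_x (p (u i) x)%:E = 1)%E. Proof. exact: p_int. Qed.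
Let q_aff i j : \int[nu]_x Num.sqrt (p (u i) x * p (u j) x) =
  expR (- ((u i - u j) ^+ 2 / 2)).
Proof. exact: p_aff. Qed.
Let q_trace (K : finType) (c : 'I_m.+1 -> K) (k : K) (L : R) :
  0 <= L <= 6^-1 -> (forall i j, c i = k -> c j = k -> `|u i - u j| <= L) ->
  \sum_(i | c i == k) overlap nu (fun i => p (u i)) c i i <= 1 + 18 * L ^+ 2.
Proof. exact: p_trace. Qed.

Definition cell (v : R) := truncn (6 * v).

Lemma cell_le v w n : 0 <= v -> 0 <= w -> (cell v < cell w + n)%N ->
  v - w <= 6^-1 * n%:R.
Proof.
move=> v0 w0 vw.
have := truncnS_gt (6 * v); have := truncn_le (6 * w).
rewrite mulr_ge0//; rewrite -/(cell v) -/(cell w) => H1 H2.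
have : (cell v).+1%:R <= (cell w + n)%:R :> R by rewrite ler_nat.
rewrite natrD; lra.
Qed.

Lemma cell_close i j n : (cell (u i) < cell (u j) + n)%N ->
  (cell (u j) < cell (u i) + n)%N -> `|u i - u j| <= 6^-1 * n%:R.
Proof.
move=> ij ji; rewrite ler_norml; have := cell_le (u_ge0 i) (u_ge0 j) ij.
have := cell_le (u_ge0 j) (u_ge0 i) ji; lra.
Qed.

Lemma cell_lt v n : 0 <= v -> 6 * v < n%:R -> (cell v < n)%N.
Proof.
move=> v0 vn; rewrite -(ltr_nat R); apply: le_lt_trans vn.
by rewrite truncn_le mulr_ge0.
Qed.

Lemma second_moment_family_short J : (forall i, 6 * u i < 2 ^+ J) ->
  second_moment nu (fun i => p (u i)) <= expR (dyadic_cost R J).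
Proof.
move=> uJ; apply: (second_moment_le_short q_ge0 q_meas q_int q_aff q_trace cell_close) => i.
by apply: cell_lt => //; rewrite natrX.
Qed.

Lemma second_moment_family_long J K n : (m < n)%N -> (1 < n)%N ->
  (forall i, 6 * u i < (K * 2 ^ J)%:R) ->
  second_moment nu (fun i => p (u i)) <=
  expR 2 * (1 + n%:R) ^+ K * expR (K%:R * dyadic_cost R J).
Proof.
move=> mn n1 uJ.
apply: (second_moment_le_long q_ge0 q_meas q_int q_aff q_trace cell_close) => // i.
by apply: cell_lt => //; rewrite natrX.
Qed.

Lemma second_moment_family_small L t : 0 <= L <= 6^-1 -> 1 <= t ->
  36 * L ^+ 2 * t <= 1 -> (forall i j, `|u i - u j| <= L) ->
  second_moment nu (fun i => p (u i)) - 1 <= expR 1 / t ^+ 2.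
Proof. exact: (second_moment_le_small q_ge0 q_meas q_int q_trace). Qed.

End Upper.

(** Dyadic scales are dense enough to round up within a factor 2. *)
Lemma dyadic_scale (B : R) : 6^-1 <= B ->
  exists J, B < 6^-1 * 2 ^+ J <= 2 * B.
Proof.
move=> B6.
have ex : exists J, 6 * B < (2 ^ J)%:R.
  exists (truncn (6 * B)).+1; apply: (lt_trans (truncnS_gt _)).
  by rewrite ltr_nat ltn_expl.
case: (ex_minnP ex) => -[|J] JB minJ.
  by exfalso; move: JB; rewrite expn0; lra.
exists J.+1; apply/andP; split; first by move: JB; rewrite natrX; lra.
have : ~~ (6 * B < (2 ^ J)%:R) by apply/negP => /minJ; rewrite ltnn.
rewrite -leNgt; rewrite natrX exprS; lra.
Qed.

Lemma chi2_le_expR_sqr B n : 6^-1 <= B ->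
  (chi2 B n <= (expR (232 * B ^+ 2))%:E)%E.
Proof.
move=> B6; have [J /andP[J1 J2]] := dyadic_scale B6.
apply: chi2_family_le => m u _ uB.
have u0 i : 0 <= u i by case/andP: (uB i).
have uJ i : 6 * u i < 2 ^+ J by case/andP: (uB i) => _ ?; lra.
rewrite lerBlDr (le_trans (second_moment_family_short u0 uJ))// ler_wpDr// ler_expR /dyadic_cost.
have : (6^-1 * 2 ^+ J) ^+ 2 <= (2 * B) ^+ 2.
  by rewrite lerXn2r ?nnegrE ?mulr_ge0//; lra.
have : 6 * B <= 36 * B ^+ 2 by rewrite expr2; nra.
rewrite exprMn; lra.
Qed.

Lemma chi2_le_pow4_small B n : 0 <= B <= 6^-1 ->
  (chi2 B n <= (6 ^+ 4 * expR 1 * B ^+ 4)%:E)%E.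
Proof.
move=> B01; apply: chi2_family_le => m u _ uB.
have u0 i : 0 <= u i by case/andP: (uB i).
have uL i j : `|u i - u j| <= B.
  by move: (uB i) (uB j) => /andP[? ?] /andP[? ?]; rewrite ler_norml; lra.
have small t (t1 : 1 <= t) (Bt : 36 * B ^+ 2 * t <= 1) :=
  second_moment_family_small u0 B01 t1 Bt uL.
have [B0|B0] := eqVneq B 0.
  (* for B = 0 the bound holds for every t; let t grow *)
  rewrite B0 expr0n mulr0 leNgt; apply/negP; set D := second_moment _ _ - 1 => D0.
  have e1 : 0 < expR 1 :> R by exact: expR_gt0.
  have eD : 0 < expR 1 / D by exact: divr_gt0.
  have t1 : 1 <= 1 + expR 1 / D by rewrite lerDl ltW.
  have := small _ t1; rewrite B0 expr0n !(mulr0, mul0r) -/D => /(_ ler01).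
  rewrite ler_pdivlMr; last by rewrite exprn_gt0// (lt_le_trans ltr01).
  apply/negP; rewrite -ltNge -ltr_pdivrMl// mulrC expr2; nra.
have B_gt0 : 0 < B by rewrite lt_neqAle eq_sym B0; case/andP: B01.
have B2 : 0 < B ^+ 2 by exact: exprn_gt0.
have := small (36 * B ^+ 2)^-1.
have -> : expR 1 / (36 * B ^+ 2)^-1 ^+ 2 = 6 ^+ 4 * expR 1 * B ^+ 4.
  by field; rewrite B0.
apply; last by rewrite divff// gt_eqF// mulr_gt0.
rewrite invf_ge1 ?mulr_gt0//; case/andP: B01 => B00 B6.
have : B ^+ 2 <= 6^-1 ^+ 2 by rewrite lerXn2r ?nnegrE ?invr_ge0.
by rewrite [X in _ <= X](_ : _ = 36^-1); [lra|by field].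
Qed.

Lemma chi2_le_pow4 B n : 0 <= B <= 1 ->
  (chi2 B n <= (6 ^+ 4 * expR 232 * B ^+ 4)%:E)%E.
Proof.
move=> /andP[B0 B1]; have [B6|B6] := leP B 6^-1.
  apply: (le_trans (chi2_le_pow4_small n _)); first by rewrite B0.
  rewrite lee_fin ler_wpM2r ?exprn_ge0// ler_wpM2l ?exprn_ge0// ler_expR.
  by rewrite ler1n.
apply: (le_trans (chi2_le_expR_sqr n (ltW B6))).
rewrite lee_fin; apply: (@le_trans _ _ (expR 232)).
  by rewrite ler_expR ler_piMr// exprn_ile1.
rewrite mulrAC -exprMn ler_peMl ?expR_ge0// exprn_ege1//; lra.
Qed.

(** [l] stands for sqrt(ln n), which is at least 5/8 for n >= 2. At cell length
    l, up to a factor 2, the cells cost exp(O(K l^2)), and so do the rank-one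
    updates, since n = exp(l^2). *)
Lemma chi2_le_expR_lin B l n : (1 < n)%N -> n%:R = expR (l ^+ 2) :> R ->
  5 / 8 <= l -> l <= B -> (chi2 B n <= (expR (160 * (B * l)))%:E)%E.
Proof.
move=> n1 nl l58 lB; have [|J] := @dyadic_scale l; first by lra.
set ell := 6^-1 * 2 ^+ J => /andP[ell1 ell2].
have ell0 : 0 < ell by lra.
have B0 : 0 <= B by lra.
pose K := (truncn (B / ell)).+1.
have KB : B < K%:R * ell by rewrite -ltr_pdivrMr// truncnS_gt.
have K2 : K%:R * l <= 2 * B.
  have : (truncn (B / ell))%:R <= B / ell by rewrite truncn_le divr_ge0// ltW.
  rewrite ler_pdivlMr// /K -natr1 mulrDl mul1r => H.
  have : (truncn (B / ell))%:R * l <= (truncn (B / ell))%:R * ell.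
    by rewrite ler_wpM2l// ltW.
  lra.
apply: chi2_family_le => m u mn uB.
have u0 i : 0 <= u i by case/andP: (uB i).
have uJ i : 6 * u i < (K * 2 ^ J)%:R.
  case/andP: (uB i) => _ uB'; rewrite natrM natrX.
  have -> : K%:R * 2 ^+ J = 6 * (K%:R * ell) by rewrite /ell; field.
  by lra.
rewrite lerBlDr; apply: (le_trans (second_moment_family_long u0 mn n1 uJ)).
rewrite ler_wpDr//.
have n2 : 1 + n%:R <= expR (2 * l ^+ 2).
  have -> : expR (2 * l ^+ 2) = n%:R * n%:R by rewrite nl -expRD; congr expR; ring.
  have : 2 <= n%:R :> R by rewrite ler_nat.
  nra.
apply: (@le_trans _ _ (expR 2 * expR (2 * l ^+ 2) ^+ K * expR (K%:R * dyadic_cost R J))).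
  by rewrite ler_wpM2r ?expR_ge0// ler_wpM2l ?expR_ge0// lerXn2r ?nnegrE ?expR_ge0//.
rewrite -expRM_natl -!expRD ler_expR.
have cJ : dyadic_cost R J <= 74 * l ^+ 2.
  rewrite /dyadic_cost -/ell (_ : 3 * 2 ^+ J = 18 * ell); last by rewrite /ell; field.
  have : ell ^+ 2 <= (2 * l) ^+ 2 by rewrite lerXn2r ?nnegrE; lra.
  rewrite exprMn; have : l <= 8 / 5 * l ^+ 2 by rewrite expr2; nra.
  lra.
have K0 : 0 <= K%:R :> R by [].
have l2 : 25 / 64 <= B * l by nra.
have : K%:R * l ^+ 2 <= 2 * (B * l).
  by rewrite expr2 !mulrA ler_wpM2r//; lra.
have := ler_wpM2l K0 cJ.
lra.
Qed.

Lemma one_sub_expRN_ge (y : R) : 0 <= y -> y / (1 + y) <= 1 - expR (- y).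
Proof.
move=> y0; have y1 : 0 < 1 + y by rewrite ltr_wpDr.
have -> : y / (1 + y) = 1 - (1 + y)^-1 by field; rewrite gt_eqF.
rewrite lerD2l lerN2 expRN lef_pV2 ?posrE ?expR_gt0//; exact: expR_ge1Dx.
Qed.

Lemma chi2_ge_pair B n : 0 <= B -> (1 < n)%N ->
  (((1 - expR (- (B ^+ 2 / 2))) ^+ 2)%:E <= chi2 B n)%E.
Proof.
move=> B0 n1; pose u (i : 'I_2) := if i == ord0 then 0 else B.
apply: (le_chi2_family n1 (u := u)) => [i|].
  by rewrite /u; case: ifP => _; rewrite ?lexx ?B0.
have aff : \int[nu]_x Num.sqrt (p (u ord0) x * p (u ord_max) x) =
    expR (- (B ^+ 2 / 2)) by rewrite /u/= p_aff// sub0r sqrrN.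
rewrite -aff; apply: (second_moment_pair (fun i => p_ge0 (u i)) (fun i => p_meas (u i))
  (fun i => p_int (u i))).
by rewrite aff -expR0 ler_expR oppr_le0 divr_ge0// sqr_ge0.
Qed.

Lemma chi2_ge_pow4 B n : 0 <= B <= 1 -> (1 < n)%N ->
  ((16^-1 * B ^+ 4)%:E <= chi2 B n)%E.
Proof.
move=> /andP[B0 B1] n1; apply: (le_trans _ (chi2_ge_pair B0 n1)).
have y0 : 0 <= B ^+ 2 / 2 by rewrite divr_ge0// sqr_ge0.
have y1 : B ^+ 2 / 2 <= 1 by have := exprn_ile1 2 B0 B1; lra.
have E : 16^-1 * B ^+ 4 = (B ^+ 2 / 2 / 2) ^+ 2 by field.
rewrite lee_fin E.
have H : B ^+ 2 / 2 / 2 <= 1 - expR (- (B ^+ 2 / 2)).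
  apply: (le_trans _ (one_sub_expRN_ge y0)).
  by rewrite ler_wpM2l// lef_pV2 ?posrE; lra.
have h0 : 0 <= B ^+ 2 / 2 / 2 by lra.
by rewrite lerXn2r ?nnegrE// (le_trans h0 H).
Qed.

Lemma chi2_ge_const B n : 2^-1 <= B -> (1 < n)%N ->
  ((9^-1 ^+ 2)%:E <= chi2 B n)%E.
Proof.
move=> B2 n1; have B0 : 0 <= B by lra.
apply: (le_trans _ (chi2_ge_pair B0 n1)).
have y8 : 8^-1 <= B ^+ 2 / 2 by rewrite expr2; nra.
have y0 : 0 <= B ^+ 2 / 2 by lra.
have H : 9^-1 <= 1 - expR (- (B ^+ 2 / 2)).
  apply: (le_trans _ (one_sub_expRN_ge y0)).
  by rewrite ler_pdivlMr; lra.
by rewrite lee_fin lerXn2r ?nnegrE ?(le_trans _ H).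
Qed.

Lemma chi2_ge_groups B n k s (v : 'I_k -> R) (D : R) :
  (0 < k)%N -> (0 < s)%N -> (k * s <= n)%N -> 0 <= D ->
  (forall a, 0 <= v a <= B) -> (forall a b, a != b -> D <= `|v a - v b|) ->
  (k * s)%:R * (k%:R * expR (- (D ^+ 2 / 2))) <= 1 ->
  ((2^-1 * block_ratio R k s - 1)%:E <= chi2 B n)%E.
Proof.
move=> k0 s0 ksn D0 vB vD ks1.
have [m mE] : exists m, (k * s = m.+1)%N.
  by exists (k * s).-1; rewrite prednK// muln_gt0 k0.
pose g (i : 'I_m.+1) := Ordinal (ltn_pmod i k0).
have gs b : mult g b = s by have := mult_modn s k0 b; rewrite mE.
have mn : (m < n)%N by rewrite -mE.
apply: (le_chi2_family mn (u := fun i => v (g i))) => [i|]; first exact: vB.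
rewrite lerD2r; apply: (second_moment_groups (fun a => p_ge0 (v a)) (fun a => p_meas (v a))
  (fun a => p_int (v a)) s0 gs _ _ ks1) => //.
move=> a b ab; have [/andP[va _] /andP[vb _]] := (vB a, vB b).
rewrite p_aff// ler_expR lerN2 ler_wpM2r//.
by rewrite -[leRHS]real_normK ?num_real// lerXn2r ?nnegrE// vD.
Qed.

(** A lower bound of the form Y / 2 - 1 is void while Y < 2; the constant lower
    bound takes over there. *)
Lemma chi2_ge_boost B n (Y : R) : 2^-1 <= B -> (1 < n)%N ->
  (4 < Y -> ((2^-1 * Y - 1)%:E <= chi2 B n)%E) ->
  ((Y / 18 ^+ 2)%:E <= chi2 B n)%E.
Proof.
move=> B2 n1 YB; have [Y4|Y4] := leP Y 4.
  apply: (le_trans _ (chi2_ge_const B2 n1)); rewrite lee_fin expr2; lra.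
apply: le_trans (YB Y4); rewrite lee_fin ler_pdivrMr ?exprn_gt0//.
rewrite (_ : 18 ^+ 2 = 324) ?expr2 -?natrM//; lra.
Qed.

(** Two groups at the ends of the segment, with s as large as their affinity
    exp(-B^2 / 2) allows. *)
Lemma chi2_ge_expR_sqr B n : 2^-1 <= B -> (1 < n)%N ->
  expR (B ^+ 2 / 2) <= n%:R ->
  ((expR (B ^+ 2 / 4) / 6 ^+ 4)%:E <= chi2 B n)%E.
Proof.
move=> B2 n1 Bn; set E := expR (B ^+ 2 / 4).
have E0 : 0 < E by exact: expR_gt0.
have EE : expR (B ^+ 2 / 2) = E ^+ 2 by rewrite -expRM_natl; congr expR; field.
have E' : E / 6 ^+ 4 <= E / 2 / 18 ^+ 2.
  rewrite -mulrA ler_wpM2l ?(ltW E0)// -invfM lef_pV2 ?posrE ?mulr_gt0 ?exprn_gt0//.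
  rewrite !exprS expr0 !mulr1; lra.
apply: (@le_trans _ _ (E / 2 / 18 ^+ 2)%:E); first by rewrite lee_fin.
apply: chi2_ge_boost => // E4; pose s := truncn (E ^+ 2 / 4).
have s_ge : s%:R <= E ^+ 2 / 4 by rewrite truncn_le divr_ge0// sqr_ge0.
have s_lt : E ^+ 2 / 4 < s%:R + 1 by rewrite natr1 truncnS_gt.
have s1 : 1 <= s%:R :> R by rewrite ler1n truncn_gt0; nra.
have s0 : (0 < s)%N by rewrite -(ler1n R).
pose v (a : 'I_2) := if a == ord0 then 0 else B.
have B0 : 0 <= B by lra.
apply: (le_trans _ (@chi2_ge_groups B n 2 s v B isT s0 _ B0 _ _ _)).
- rewrite lee_fin lerD2r ler_wpM2l// -(@ler_pXn2r _ 2) ?nnegrE ?block_ratio_ge0//.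
    by apply: le_trans (block_ratio_pow2 R 1 s0); rewrite expr1 natrM expr_div_n; lra.
  by rewrite divr_ge0 ?ltW.
- by rewrite -(ler_nat R) natrM (le_trans _ Bn)// EE; lra.
- by move=> a; rewrite /v; case: ifP; rewrite ?lexx ?B0.
- move=> [[|[|//]] ?] [[|[|//]] ?] //= _.
    by rewrite /v /= sub0r normrN ger0_norm.
  by rewrite /v /= subr0 ger0_norm.
rewrite natrM expRN EE mulrA ler_pdivrMr ?exprn_gt0// mul1r; lra.
Qed.

(** At distance 2 l = 2 sqrt(ln n) the affinities are n^-2, which suits groups of
    any size up to n / k. The upper bound on B, here n^(199/200), is what leaves
    groups of size at least of the order of n^(1/200). *)
Lemma chi2_ge_expR_grid B l n : (1 < n)%N -> n%:R = expR (l ^+ 2) :> R ->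
  5 / 8 <= l -> 8 * l <= B -> B <= expR (199 / 200 * l ^+ 2) ->
  ((expR (B * l / 64 ^+ 2) / 18 ^+ 2)%:E <= chi2 B n)%E.
Proof.
move=> n1 nl l58 lB Bn.
have l0 : 0 < l by lra. have lN0 : l != 0 by rewrite gt_eqF.
have B0 : 0 <= B by lra.
pose x := B / l; have xl : x * l = B by rewrite divfK.
have x8 : 8 <= x by rewrite ler_pdivlMr.
have [|r /andP[r1 r2]] := @dyadic_scale ((1 + x / 2) / 12); first by lra.
pose k := (2 ^ r)%N; have kE : 2 ^+ r = k%:R :> R by rewrite natrX.
rewrite kE in r1 r2.
have k0 : (0 < k)%N by rewrite expn_gt0.
have kB : k%:R <= B by nra.
pose N := expR (l ^+ 2 / 200).
have nN : n%:R = expR (199 / 200 * l ^+ 2) * N.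
  by rewrite nl -expRD; congr expR; field.
have N0 : 0 < N by exact: expR_gt0.
have N1 : 1 <= N by rewrite -expR0 ler_expR divr_ge0// sqr_ge0.
have kN : k%:R * N <= n%:R by rewrite nN ler_wpM2r ?(ltW N0)// (le_trans kB).
have kn : k%:R <= n%:R :> R by apply: (le_trans _ kN); rewrite ler_peMr.
pose s := (n %/ k)%N.
have s0 : (0 < s)%N by rewrite divn_gt0// -(ler_nat R).
have sN : N <= (2 * s)%:R.
  have : k%:R * N < k%:R * (s.+1)%:R.
    by apply: (le_lt_trans kN); rewrite -natrM ltr_nat mulnC ltn_ceil.
  rewrite ltr_pM2l ?ltr0n// => /ltW/le_trans; apply.
  by rewrite ler_nat mul2n -addnn -addn1 leq_add2l.
pose Y := expR ((k%:R - 1) * (l ^+ 2 / 20 ^+ 2)).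
have Yratio : Y <= block_ratio R k s.
  rewrite -(@ler_pXn2r _ 2) ?nnegrE ?block_ratio_ge0 ?expR_ge0//.
  apply: le_trans (block_ratio_pow2 R r s0).
  rewrite (_ : Y ^+ 2 = N ^+ (2 ^ r).-1).
    by rewrite lerXn2r ?nnegrE ?(ltW N0)//.
  rewrite -!expRM_natl -/k -subn1 natrB//; congr expR; by field.
have YB : expR (B * l / 64 ^+ 2) <= Y.
  rewrite ler_expR -xl.
  have -> : x * l * l / 64 ^+ 2 = x * (5 / 16) ^+ 2 * (l ^+ 2 / 20 ^+ 2) by field.
  by rewrite ler_wpM2r ?divr_ge0 ?sqr_ge0// expr2; lra.
apply: chi2_ge_boost => //; first by lra.
move=> _; pose v (a : 'I_k) := a%:R * (2 * l).
have l20 : 0 <= 2 * l by lra.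
apply: (le_trans _ (@chi2_ge_groups B n k s v (2 * l) k0 s0 _ l20 _ _ _)).
- by rewrite lee_fin lerD2r ler_wpM2l// (le_trans YB).
- by rewrite mulnC leq_trunc_div.
- move=> a; rewrite /v mulr_ge0//= -xl.
  have : a%:R <= k%:R - 1 :> R.
    by rewrite lerBrDr natr1 ler_nat.
  move=> ak; have : a%:R <= x / 2 by lra.
  by move=> /(ler_wpM2r l20)/le_trans; apply; lra.
- move=> a b ab; rewrite /v -mulrBl normrM (ger0_norm l20) ler_peMl//.
  wlog: a b ab / (b < a)%N.
    move=> H; have := ab; rewrite neq_ltn => /orP[ba|]; last exact: H.
    by rewrite distrC H// eq_sym.
  move=> ba; rewrite ger0_norm ?subr_ge0 ?ler_nat 1?ltnW//.
  by rewrite lerBrDr addrC natr1 ler_nat.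
have ksn : (k * s)%:R <= n%:R :> R by rewrite ler_nat mulnC leq_trunc_div.
have -> : expR (- ((2 * l) ^+ 2 / 2)) = n%:R^-1 * n%:R^-1.
  by rewrite nl -expRN -expRD; congr expR; field.
have nR0 : 0 < n%:R :> R by rewrite ltr0n ltnW.
rewrite mulrA mulrACA mulr_ile1// ?mulr_ge0 ?invr_ge0//.
all: by rewrite ler_pdivrMr// mul1r.
Qed.

Lemma chi2_ge_expR_lin B l n : (1 < n)%N -> n%:R = expR (l ^+ 2) :> R ->
  5 / 8 <= l -> l <= B -> B <= expR (199 / 200 * l ^+ 2) ->
  ((expR (B * l / 64 ^+ 2) / 6 ^+ 4)%:E <= chi2 B n)%E.
Proof.
move=> n1 nl l58 lB Bn; have [B8|B8] := leP (8 * l) B.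
  apply: (le_trans _ (chi2_ge_expR_grid n1 nl l58 B8 Bn)).
  rewrite lee_fin ler_wpM2l ?expR_ge0// lef_pV2 ?posrE ?exprn_gt0//.
  by rewrite !exprS expr0 !mulr1; lra.
have l0 : 0 <= l ^+ 2 by exact: sqr_ge0.
have l2 : 2^-1 <= l by lra.
have ln' : expR (l ^+ 2 / 2) <= n%:R by rewrite nl ler_expR; lra.
have sub : (chi2 l n <= chi2 B n)%E.
  apply: le_bigmax2 => m _; apply: ereal_sup_le => _ [P /= lP <-].
  exists P => //= i; have [u /= /andP[u0 ul] <-] := lP i.
  by exists u => //=; rewrite u0 (le_trans ul).
apply: (le_trans _ sub); apply: (le_trans _ (chi2_ge_expR_sqr l2 n1 ln')).
rewrite lee_fin ler_wpM2r// ler_expR.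
have Bl : B * l <= 8 * l ^+ 2 by rewrite expr2 mulrA ler_wpM2r ?(ltW B8)//; lra.
rewrite ler_pdivrMr ?exprn_gt0// (_ : 64 ^+ 2 = 4 * (32 * 32)); last by ring.
lra.
Qed.

End Family.

(** * Bounds on the trace of an overlap matrix *)

Section Trace.
Context d (T : measurableType d) (R : realType).
Variable nu : {measure set T -> \bar R}.
Variables (m : nat) (q : 'I_m -> T -> R).
Hypothesis q_ge0 : forall i x, 0 <= q i x.
Hypothesis q_meas : forall i, measurable_fun setT (q i).
Hypothesis q_int : forall i, (\int[nu]_x (q i x)%:E = 1)%E.
Variables (K : finType) (c : 'I_m -> K) (k : K).

Lemma trace_class_Rint : \sum_(i | c i == k) overlap nu q c i i =
  \int[nu]_x \sum_(i | c i == k) class_kernel (q ^~ x) c i i.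
Proof.
rewrite Rintegral_sum => [|i]; last exact: kernel_intble.
by apply: eq_bigr => i _; rewrite mxE.
Qed.

Lemma trace_intble :
  intble nu (fun x => \sum_(i | c i == k) class_kernel (q ^~ x) c i i).
Proof. by apply: intble_sum => i; exact: kernel_intble. Qed.

(** The trace is the integral of a weighted mean of the densities of the
    class. *)
Lemma trace_class_le_envelope (g : T -> R) : intble nu g ->
  (forall x, 0 <= g x) -> (forall i x, c i = k -> q i x <= g x) ->
  \sum_(i | c i == k) overlap nu q c i i <= \int[nu]_x g x.
Proof.
move=> Ig g0 qg; rewrite trace_class_Rint.
apply: le_Rint => [||x]; [exact: trace_intble|exact: Ig|].
have [i0 /eqP i0k|no] := pickP (fun i => c i == k); last by rewrite big_pred0.
set S := class_mass (q ^~ x) c i0.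
apply: (@le_trans _ _ (\sum_(i | c i == k) q i x * (g x / S))).
  apply: ler_sum => i /eqP ik; rewrite /class_kernel eqxx.
  rewrite (class_mass_eq (q ^~ x) (etrans ik (esym i0k))) -mulrA.
  by rewrite ler_wpM2l// ler_wpM2r ?invr_ge0 ?class_mass_ge0// qg.
rewrite -mulr_suml -[X in X * _](_ : S = _); last by rewrite /S /class_mass i0k.
have [->|S0] := eqVneq S 0; first by rewrite mul0r.
by rewrite mulrCA divff// mulr1.
Qed.

(** The average of the densities of the class is at least their harmonic mean, so
    the trace is at most the average of the integrals of p_i^2 / p_j. *)
Lemma trace_class_le_divergence (X : R) : 0 <= X ->
  (forall i x, c i = k -> 0 < q i x) ->
  (forall i j, c i = k -> c j = k -> intble nu (fun x => q i x ^+ 2 / q j x)) ->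
  (forall i j, c i = k -> c j = k -> \int[nu]_x (q i x ^+ 2 / q j x) <= X) ->
  \sum_(i | c i == k) overlap nu q c i i <= X.
Proof.
move=> X0 q_gt0 qI qX; rewrite trace_class_Rint.
have [i0 /eqP i0k|no] := pickP (fun i => c i == k); last first.
  by under eq_Rintegral do rewrite big_pred0//; rewrite Rintegral_cst// mul0r.
pose n : R := #|[pred i | c i == k]|%:R.
have n0 : 0 < n by rewrite ltr0n; apply/card_gt0P; exists i0; rewrite inE i0k.
pose h i j := if (c i == k) && (c j == k) then
  fun x => q i x ^+ 2 / q j x else fun=> 0.
have hI i j : intble nu (h i j).
  rewrite /h; case: ifP => [/andP[/eqP ci /eqP cj]|_]; first exact: qI.
  exact: intble0.
have hX i j : c i == k -> c j == k -> \int[nu]_x h i j x <= X.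
  by move=> ci cj; rewrite /h ci cj; apply: qX; exact/eqP.
have HI i : intble nu (fun x => \sum_(j | c j == k) h i j x) by exact: intble_sum.
have HI2 : intble nu (fun x => \sum_(i | c i == k) \sum_(j | c j == k) h i j x).
  exact: intble_sum.
apply: (@le_trans _ _ (\int[nu]_x
    (n ^- 2 * \sum_(i | c i == k) \sum_(j | c j == k) h i j x))); last first.
  rewrite RintegralZl// mulrC ler_pdivrMr ?exprn_gt0//.
  rewrite Rintegral_sum//; under eq_bigr => i _ do rewrite Rintegral_sum//.
  apply: (@le_trans _ _ (\sum_(i | c i == k) \sum_(j | c j == k) X)).
    by apply: ler_sum => i ci; apply: ler_sum => j cj; exact: hX.
  by rewrite !sumr_const -mulrnA -mulr_natr natrM.
apply: le_Rint => [||x]; [exact: trace_intble|exact: intbleZ|].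
rewrite mulr_sumr; apply: ler_sum => i /eqP ik; rewrite /class_kernel eqxx.
rewrite -expr2 (eq_bigr (fun j => q i x ^+ 2 * (q j x)^-1)); last first.
  by move=> j cj; rewrite /h ik eqxx cj.
rewrite -mulr_sumr mulrCA ler_wpM2l ?sqr_ge0//.
set S := class_mass _ _ _.
have SE : S = \sum_(j | c j == k) q j x by rewrite /S /class_mass ik.
have S0 : 0 < S by rewrite SE (bigD1 i) ?ik//= ltr_wpDr ?sumr_ge0// q_gt0.
rewrite -[leRHS]mulrC ler_pdivlMr ?exprn_gt0//.
(* tangent of 1 / q at the mean S / n *)
apply: (@le_trans _ _ (\sum_(j | c j == k) (2 * n / S - q j x * (n / S) ^+ 2))).
  rewrite sumrB (_ : \sum_(j | c j == k) q j x * (n / S) ^+ 2 = S * (n / S) ^+ 2).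
    rewrite sumr_const -[_ *+ _]mulr_natr -/n.
    by rewrite le_eqVlt; apply/orP; left; apply/eqP; field; rewrite gt_eqF.
  by rewrite [X in _ = X * _]SE mulr_suml.
apply: ler_sum => j /eqP cj; have qj := q_gt0 j x cj.
rewrite -(ler_pM2r qj) mulVf ?gt_eqF// -subr_ge0.
rewrite (_ : _ - _ = (1 - q j x * (n / S)) ^+ 2) ?sqr_ge0//.
by ring.
Qed.

End Trace.

Lemma expR_le_linear (R : realType) (y : R) : 0 <= y <= 4^-1 ->
  expR y <= 1 + 4 / 3 * y.
Proof.
move=> /andP[y0 y4]; have := expR_ge1Dx (- y); rewrite expRN => H.
have e0 := expR_gt0 y.
have : (1 - y) * expR y <= 1 by rewrite -ler_pdivlMr// mul1r.
have : 1 <= (1 - y) * (1 + 4 / 3 * y) by nra.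
have y1 : 0 < 1 - y by lra.
by move=> H1 H2; rewrite -(ler_pM2l y1) (le_trans H2).
Qed.

(** * The normal family *)

Section Normal.
Variable R : realType.
Local Notation mu := (@lebesgue_measure R).
Local Notation pdf t := (normal_pdf t (1 : R)).

Let pdfE t x : pdf t x = normal_peak 1 * expR (- (x - t) ^+ 2 / 2).
Proof. by rewrite normal_pdfE ?oner_neq0// /normal_fun expr1n. Qed.

Lemma normal_pdf_gt0 t x : 0 < pdf t x.
Proof. by rewrite pdfE mulr_gt0 ?expR_gt0// normal_peak_gt0// oner_neq0. Qed.

Lemma normal_pdf_intble t : intble mu (pdf t).
Proof. exact: integrable_normal_pdf. Qed.

Lemma normal_pdf_Rint t : \int[mu]_x pdf t x = 1.
Proof. by rewrite /Rintegral integral_normal_pdf. Qed.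

Lemma normal_density t : has_density (normal_prob t 1) mu (pdf t).
Proof.
by split=> [x||A mA] //; [exact: normal_pdf_ge0|exact: measurable_normal_pdf].
Qed.

Lemma normal_sqrtE a b x : Num.sqrt (pdf a x * pdf b x) =
  expR (- ((a - b) ^+ 2 / 8)) * pdf ((a + b) / 2) x.
Proof.
rewrite !pdfE; set c := normal_peak 1; have c0 : 0 <= c by exact: normal_peak_ge0.
rewrite mulrACA -expr2 -expRD sqrtrM ?sqr_ge0// sqrtr_sqr ger0_norm//.
rewrite mulrCA; congr (_ * _); rewrite -expRD.
set z := (X in Num.sqrt (expR X)); set w := (X in _ = expR X).
have -> : expR z = expR w ^+ 2.
  by rewrite -expRM_natl /z /w; congr expR; field.
by rewrite sqrtr_sqr ger0_norm ?expR_ge0.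
Qed.

Lemma normal_divE a b x : pdf a x ^+ 2 / pdf b x =
  expR ((a - b) ^+ 2) * pdf (2 * a - b) x.
Proof.
rewrite !pdfE; set c := normal_peak 1.
have c0 : c != 0 by rewrite gt_eqF// normal_peak_gt0// oner_neq0.
rewrite exprMn invfM mulrACA expr2 mulfK// [RHS]mulrCA; congr (_ * _).
by rewrite -expRN -expRM_natl -!expRD; congr expR; field.
Qed.

Lemma normal_affinity a b : \int[mu]_x Num.sqrt (pdf a x * pdf b x) =
  expR (- ((a - b) ^+ 2 / 8)).
Proof.
under eq_Rintegral do rewrite normal_sqrtE.
rewrite RintegralZl//; last exact: normal_pdf_intble.
by rewrite normal_pdf_Rint mulr1.
Qed.

Lemma normal_trace (m : nat) (t : 'I_m -> R) (K : finType) (c : 'I_m -> K)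
    (k : K) (L : R) : 0 <= L <= 6^-1 ->
  (forall i j, c i = k -> c j = k -> `|t i - t j| <= 2 * L) ->
  \sum_(i | c i == k) overlap mu (fun i => pdf (t i)) c i i <= 1 + 18 * L ^+ 2.
Proof.
move=> /andP[L0 L6] tL; have L2 : L ^+ 2 <= 6^-1 ^+ 2 by rewrite lerXn2r ?nnegrE.
rewrite (_ : 6^-1 ^+ 2 = 36^-1) in L2; last by field.
have L20 : 0 <= L ^+ 2 by exact: sqr_ge0.
have div_intble i j : intble mu (fun x => pdf (t i) x ^+ 2 / pdf (t j) x).
  have := intbleZ (expR ((t i - t j) ^+ 2)) (normal_pdf_intble (2 * t i - t j)).
  by apply: eq_integrable => // x _; rewrite /= normal_divE.
apply: (@le_trans _ _ (expR (4 * L ^+ 2))); last first.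
  by apply: le_trans (expR_le_linear _) _; lra.
apply: trace_class_le_divergence => //.
- by move=> i x; exact: normal_pdf_ge0.
- by move=> i; exact: measurable_normal_pdf.
- by move=> i; exact: integral_normal_pdf.
- by move=> i x _; exact: normal_pdf_gt0.
move=> i j ci cj; under eq_Rintegral do rewrite normal_divE.
rewrite RintegralZl//; last exact: normal_pdf_intble.
rewrite normal_pdf_Rint mulr1 ler_expR.
rewrite -real_normK ?num_real// (_ : 4 * L ^+ 2 = (2 * L) ^+ 2); last by ring.
by rewrite lerXn2r ?nnegrE ?mulr_ge0// tL.
Qed.

End Normal.

(** * The Poisson family *)

HB.instance Definition _ (R : realType) := Measure_isSigmaFinite.Build _ _ _
  (@counting nat R) (sigma_finite_counting R).

Section Poisson.
Variable R : realType.
Local Notation count := (@counting nat R).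
Implicit Types (a u v : R) (k : nat).

(** At u = 0 this is the indicator of 0, the density of Poi(0). *)
Definition pois u k : R := (u ^+ 2) ^+ k / k`!%:R * expR (- u ^+ 2).

Lemma pois_ge0 u k : 0 <= pois u k.
Proof. by rewrite mulr_ge0 ?expR_ge0// divr_ge0// exprn_ge0 ?sqr_ge0. Qed.

Lemma pois_gt0 u k : 0 < u -> 0 < pois u k.
Proof.
by move=> u0; rewrite mulr_gt0 ?expR_gt0// divr_gt0 ?exprn_gt0// ltr0n fact_gt0.
Qed.

Lemma pois_density u : has_density (poisson_prob (u ^+ 2) 0%N) count (pois u).
Proof.
split=> [k||A _] //; first exact: pois_ge0.
transitivity (\sum_(k <oo) (if k \in A then (pois u k)%:E else 0%E))%E; last first.
  rewrite integral_mkcond ge0_integral_count.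
    by apply: eq_eseriesr => k _; rewrite patchE.
  by move=> k; rewrite patchE; case: ifP => // _; rewrite lee_fin pois_ge0.
have f0 k : (0 <= if k \in A then (pois u k)%:E else 0)%E.
  by case: ifP => // _; rewrite lee_fin pois_ge0.
have [u0|u0] := eqVneq u 0.
  rewrite u0 in f0 *; rewrite /poisson_prob expr0n/= ltxx.
  rewrite (nneseries_recl (fun k _ => f0 k))// eseries0 ?adde0; last first.
    move=> k k0 _; case: ifP => // _.
    by rewrite /pois expr0n/= expr0n -leqn0 leqNgt k0 !mul0r.
  rewrite diracE; case: ifP => // _.
  by rewrite /pois expr0n/= expr0 oppr0 expR0 fact0 divff// mulr1.
have u2 : 0 < u ^+ 2 by rewrite exprn_even_gt0.
rewrite /poisson_prob u2 esum_mkcond nneseries_esumT//.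
by apply: eq_esum => k _; case: ifP => // _; rewrite /poisson_pmf u2.
Qed.

Lemma pois_meas u : measurable_fun setT (pois u). Proof. by []. Qed.

Lemma integral_pois u : (\int[count]_k (pois u k)%:E = 1)%E.
Proof.
by case: (pois_density u) => _ _ <-; rewrite ?probability_setT.
Qed.

Lemma integral_exp_coeff a : 0 <= a ->
  (\int[count]_k (a ^+ k / k`!%:R)%:E = (expR a)%:E)%E.
Proof.
move=> a0; rewrite -[RHS]mule1 -(integral_pois (Num.sqrt a)).
rewrite -ge0_integralZl//; last first.
  by move=> k _; rewrite lee_fin pois_ge0.
apply: eq_integral => k _; rewrite -EFinM /pois sqr_sqrtr// mulrCA -expRD.
by rewrite addrN expR0 mulr1.
Qed.

Lemma exp_coeff_intble a : 0 <= a -> intble count (fun k => a ^+ k / k`!%:R).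
Proof.
move=> a0; apply/integrableP; split; first exact/measurable_EFinP.
under eq_integral => k _ do rewrite /= ger0_norm ?divr_ge0 ?exprn_ge0//.
by rewrite integral_exp_coeff// ltry.
Qed.

Lemma Rint_exp_coeff a : 0 <= a -> \int[count]_k (a ^+ k / k`!%:R) = expR a.
Proof. by move=> a0; rewrite /Rintegral integral_exp_coeff. Qed.

Lemma pois_sqrtE u v k : 0 <= u -> 0 <= v -> Num.sqrt (pois u k * pois v k) =
  expR (- ((u ^+ 2 + v ^+ 2) / 2)) * ((u * v) ^+ k / k`!%:R).
Proof.
move=> u0 v0; have f0 : k`!%:R != 0 :> R by rewrite pnatr_eq0 -lt0n fact_gt0.
set w := RHS; have w0 : 0 <= w.
  by rewrite mulr_ge0 ?expR_ge0// divr_ge0// exprn_ge0// mulr_ge0.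
rewrite (_ : _ * _ = w ^+ 2); first by rewrite sqrtr_sqr ger0_norm.
rewrite /w exprMn -expRM_natl /pois.
rewrite (_ : 2 * - _ = - u ^+ 2 + - v ^+ 2); last by field.
by rewrite expRD expr_div_n (exprMn k u v) (exprAC u) (exprAC v); field.
Qed.

Lemma pois_affinity u v : 0 <= u -> 0 <= v ->
  \int[count]_k Num.sqrt (pois u k * pois v k) = expR (- ((u - v) ^+ 2 / 2)).
Proof.
move=> u0 v0; under eq_Rintegral do rewrite pois_sqrtE//.
rewrite RintegralZl//; last by apply: exp_coeff_intble; rewrite mulr_ge0.
rewrite Rint_exp_coeff ?mulr_ge0// -expRD; congr expR; by field.
Qed.

Lemma pois_divE u v k : 0 < u -> 0 < v -> pois u k ^+ 2 / pois v k =
  expR (v ^+ 2 - 2 * u ^+ 2) * ((u ^+ 4 / v ^+ 2) ^+ k / k`!%:R).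
Proof.
move=> u0 v0; have f0 : k`!%:R != 0 :> R by rewrite pnatr_eq0 -lt0n fact_gt0.
have vN0 : v != 0 by rewrite gt_eqF.
have -> : expR (v ^+ 2 - 2 * u ^+ 2) = expR (v ^+ 2) * expR (- u ^+ 2) ^+ 2.
  by rewrite -expRM_natl -expRD; congr expR; ring.
rewrite /pois [expR (- v ^+ 2)]expRN expr_div_n.
rewrite (_ : u ^+ 4 = (u ^+ 2) ^+ 2); last by ring.
rewrite [((u ^+ 2) ^+ 2) ^+ k]exprAC.
have vk : (v ^+ 2) ^+ k != 0 by rewrite !expf_neq0.
by field; rewrite f0 vk gt_eqF ?expR_gt0.
Qed.

(** If some [u i <= L], all rates of the class are at most 4 L^2 and
    (4 L^2)^x / x! is an envelope. Otherwise all [u i > L], and the integral of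
    p_i^2 / p_j is exp of (u i - u j)^2 ((u i + u j) / u j)^2 <= 9 L^2. *)
Lemma pois_trace (m : nat) (u : 'I_m -> R) (K : finType) (c : 'I_m -> K)
    (k : K) (L : R) : (forall i, 0 <= u i) -> 0 <= L <= 6^-1 ->
  (forall i j, c i = k -> c j = k -> `|u i - u j| <= L) ->
  \sum_(i | c i == k) overlap count (fun i => pois (u i)) c i i <= 1 + 18 * L ^+ 2.
Proof.
move=> u0 /andP[L0 L6] uL; have L2 : L ^+ 2 <= 6^-1 ^+ 2 by rewrite lerXn2r ?nnegrE.
rewrite (_ : 6^-1 ^+ 2 = 36^-1) in L2; last by field.
have L20 : 0 <= L ^+ 2 by exact: sqr_ge0.
have q0 i x : 0 <= pois (u i) x by exact: pois_ge0.
have qm i : measurable_fun setT (pois (u i)) by exact: pois_meas.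
have qi i : (\int[count]_x (pois (u i) x)%:E = 1)%E by exact: integral_pois.
have [/existsP[i0 /andP[/eqP ik0 ui0]]|] :=
    boolP [exists i, (c i == k) && (u i <= L)].
  have M0 : 0 <= (2 * L) ^+ 2 by exact: sqr_ge0.
  apply: (@le_trans _ _ (\int[count]_x (((2 * L) ^+ 2) ^+ x / x`!%:R))).
    apply: (trace_class_le_envelope q0 qm qi); first exact: exp_coeff_intble.
      by move=> x; rewrite divr_ge0// exprn_ge0.
    move=> i x ik; rewrite /pois -[leRHS]mulr1 ler_pM ?expR_ge0//.
    - by rewrite divr_ge0// exprn_ge0// sqr_ge0.
    - rewrite ler_wpM2r ?invr_ge0// lerXn2r ?nnegrE ?sqr_ge0//.
      rewrite lerXn2r ?nnegrE ?mulr_ge0//.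
      by have := uL _ _ ik ik0; rewrite ler_norml; lra.
    - by rewrite -expR0 ler_expR oppr_le0 sqr_ge0.
  rewrite Rint_exp_coeff// exprMn.
  by apply: le_trans (expR_le_linear _) _; lra.
rewrite negb_exists => /forallP noL.
have u_gt i : c i = k -> L < u i.
  by move=> /eqP ik; have := noL i; rewrite ik/= -ltNge.
have u_gt0 i : c i = k -> 0 < u i by move=> /u_gt; exact: le_lt_trans.
apply: (@le_trans _ _ (expR (9 * L ^+ 2))); last first.
  by apply: le_trans (expR_le_linear _) _; lra.
apply: (trace_class_le_divergence q0 qm qi).
- exact: expR_ge0.
- by move=> i x ik; apply: pois_gt0; exact: u_gt0.
- move=> i j ik jk.
  have := intbleZ (expR (u j ^+ 2 - 2 * u i ^+ 2))
    (@exp_coeff_intble (u i ^+ 4 / u j ^+ 2) _).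
  move=> /(_ (divr_ge0 (exprn_ge0 _ (u0 i)) (exprn_ge0 _ (u0 j)))).
  by apply: eq_integrable => // x _; rewrite /= pois_divE// u_gt0.
move=> i j ik jk; have [ui uj] := (u_gt0 _ ik, u_gt0 _ jk).
under eq_Rintegral do rewrite pois_divE//.
have a0 : 0 <= u i ^+ 4 / u j ^+ 2 by rewrite divr_ge0 ?exprn_ge0.
rewrite RintegralZl//; last exact: exp_coeff_intble.
rewrite Rint_exp_coeff// -expRD ler_expR.
have -> : u j ^+ 2 - 2 * u i ^+ 2 + u i ^+ 4 / u j ^+ 2 =
    (`|u i - u j| * ((u i + u j) / u j)) ^+ 2.
  by rewrite exprMn real_normK ?num_real//; field; rewrite gt_eqF.
rewrite (_ : 9 * L ^+ 2 = (L * 3) ^+ 2); last by ring.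
have s0 : 0 <= (u i + u j) / u j by rewrite divr_ge0 ?addr_ge0.
have H : `|u i - u j| * ((u i + u j) / u j) <= L * 3; last first.
  by apply: lerXn2r H; rewrite nnegrE mulr_ge0.
apply: ler_pM => //; first exact: uL.
rewrite ler_pdivrMr//; have := uL _ _ ik jk; have := u_gt _ jk.
by rewrite ler_norml; lra.
Qed.

End Poisson.

(** * The three regimes *)

Section Regimes.
Variable R : realType.

(** A common parametrization of the regimes: B is mu for the normal family and
    sqrt M for the Poisson family. The exponent 199/200 is the one of n^1.99
    halved; it covers n^0.99 as well. *)
Definition chi2_regimes (n : nat) (B : R) (x : \bar R) :=
  [/\ 0 <= B <= 1 ->
        ((16^-1 * B ^+ 4)%:E <= x)%E /\ (x <= (6 ^+ 4 * expR 232 * B ^+ 4)%:E)%E,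
      1 < B <= Num.sqrt (ln n%:R) ->
        ((expR (4^-1 * B ^+ 2 - ln (6 ^+ 4)))%:E <= x)%E /\
        (x <= (expR (232 * B ^+ 2))%:E)%E &
      Num.sqrt (ln n%:R) < B <= expR (199 / 200 * ln n%:R) ->
        ((expR ((64 ^+ 2)^-1 * (B * Num.sqrt (ln n%:R)) - ln (6 ^+ 4)))%:E <= x)%E
        /\ (x <= (expR (160 * (B * Num.sqrt (ln n%:R))))%:E)%E].

Lemma ln2_ge_half : 2^-1 <= ln 2 :> R.
Proof.
rewrite -ler_expR lnK ?posrE//.
have := expR_ge1Dx (- 2^-1 : R); rewrite expRN => H.
have H2 : 2^-1 <= (expR 2^-1)^-1 :> R by lra.
by rewrite -[leRHS]invrK -[leLHS]invrK lef_pV2 ?posrE ?invr_gt0 ?expR_gt0//; lra.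
Qed.

Lemma segment_family_regimes d (T : measurableType d)
    (nu : {sigma_finite_measure set T -> \bar R})
    (Pr : R -> probability T R) (p : R -> T -> R) n (B : R) :
  (forall u, has_density (Pr u) nu (p u)) ->
  (forall u v, 0 <= u -> 0 <= v ->
    \int[nu]_x Num.sqrt (p u x * p v x) = expR (- ((u - v) ^+ 2 / 2))) ->
  (forall m (u : 'I_m.+1 -> R) (K : finType) (c : 'I_m.+1 -> K) (k : K) (L : R),
    (forall i, 0 <= u i) -> 0 <= L <= 6^-1 ->
    (forall i j, c i = k -> c j = k -> `|u i - u j| <= L) ->
    \sum_(i | c i == k) overlap nu (fun i => p (u i)) c i i <= 1 + 18 * L ^+ 2) ->
  (1 < n)%N -> chi2_regimes n B (chi2_family (segment_family Pr B) n).
Proof.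
move=> Pp aff tr n1; have nR : 0 < n%:R :> R by rewrite ltr0n ltnW.
rewrite /chi2_regimes; set l := Num.sqrt _.
have ln_ge : 2^-1 <= ln n%:R :> R.
  apply: (le_trans ln2_ge_half); rewrite ler_ln ?posrE//.
  by rewrite ler_nat.
have l2 : l ^+ 2 = ln n%:R by rewrite sqr_sqrtr//; lra.
have nl : n%:R = expR (l ^+ 2) by rewrite l2 lnK.
have l0 : 0 <= l by exact: sqrtr_ge0.
have l58 : 5 / 8 <= l by rewrite leNgt; apply/negP => H; rewrite expr2 in l2; nra.
have expK (y : R) : expR (y - ln (6 ^+ 4)) = expR y / 6 ^+ 4.
  by rewrite expRD expRN lnK// posrE exprn_gt0.
split=> [B01|/andP[B1 Bl]|/andP[lB Bn]].
- split; first exact: (chi2_ge_pow4 Pp aff).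
  exact: (chi2_le_pow4 Pp aff tr).
- split; last by apply: (chi2_le_expR_sqr Pp aff tr); lra.
  rewrite expK [4^-1 * _]mulrC; apply: (chi2_ge_expR_sqr Pp aff) => //; first by lra.
  rewrite nl ler_expR -[leRHS]mulr1 ler_pM ?sqr_ge0//; last by lra.
  by rewrite lerXn2r ?nnegrE//; lra.
split; last by apply: (chi2_le_expR_lin Pp aff tr n1 nl l58); lra.
rewrite expK [_^-1 * _]mulrC; apply: (chi2_ge_expR_lin Pp aff n1 nl l58) => //.
  exact: ltW.
by rewrite l2.
Qed.

Lemma normal_family_regimes n (mu : R) : (1 < n)%N ->
  chi2_regimes n mu (chi2_family (normal_family mu) n).
Proof.
move=> n1; pose t u : R := 2 * u - mu.
have -> : normal_family mu = segment_family (fun u => normal_prob (t u) 1) mu.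
  apply/seteqP; split => P /=.
    move=> [th /=]; rewrite ler_norml => /andP[th1 th2] <-.
    exists ((th + mu) / 2); first by rewrite /=; apply/andP; split; lra.
    by rewrite /t; congr normal_prob; field.
  move=> [u /= /andP[u0 u1] <-]; exists (t u) => //=.
  by rewrite ler_norml /t; apply/andP; split; lra.
apply: (@segment_family_regimes _ _ lebesgue_measure _
  (fun u => normal_pdf (t u) 1) n mu _ _ _ n1).
- by move=> u; exact: normal_density.
- move=> u v _ _; rewrite normal_affinity; congr expR; rewrite /t; by field.
move=> m u K c k L _ L01 uL; apply: normal_trace => // i j ci cj.
rewrite /t (_ : _ - _ = 2 * (u i - u j)); last by ring.
by rewrite normrM ger0_norm// ler_wpM2l// uL.
Qed.

Lemma poisson_family_regimes n (M : R) : (1 < n)%N -> 0 <= M ->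
  chi2_regimes n (Num.sqrt M) (chi2_family (poisson_family M) n).
Proof.
move=> n1 M0.
have -> : poisson_family M =
    segment_family (fun u => poisson_prob (u ^+ 2) 0%N) (Num.sqrt M).
  apply/seteqP; split => P /=.
    move=> [la /= /andP[la0 laM] <-]; exists (Num.sqrt la); last by rewrite sqr_sqrtr.
    by rewrite /= sqrtr_ge0 ler_wsqrtr.
  move=> [u /= /andP[u0 uM] <-]; exists (u ^+ 2) => //=.
  by rewrite sqr_ge0/= -[leRHS]sqr_sqrtr// lerXn2r ?nnegrE ?sqrtr_ge0.
have := @segment_family_regimes _ _ (@counting nat R : {sigma_finite_measure set nat -> \bar R}) (fun u => poisson_prob (u ^+ 2) 0%N : probability nat R) (@pois R) n (Num.sqrt M).
apply => //.
- by move=> u; exact: pois_density.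
- by move=> u v u0 v0; exact: pois_affinity.
by move=> m u K c k L u0 L01 uL; exact: pois_trace.
Qed.

End Regimes.

Theorem corollary1p8 (R : realType) :
  let chi2_normal (n : nat) (mu : R) := chi2_family (normal_family mu) n in
  let chi2_poisson (n : nat) (M : R) := chi2_family (poisson_family M) n in
  [/\ Theta_on (fun n mu => [/\ (2 <= n)%N, 0 <= mu & mu <= 1])
        chi2_normal (fun _ mu => mu ^+ 4),
      exp_Theta_on
        (fun n mu => [/\ (2 <= n)%N, 1 < mu & mu <= Num.sqrt (ln n%:R)])
        chi2_normal (fun _ mu => mu ^+ 2) &
      exp_Theta_on
        (fun n mu => [/\ (2 <= n)%N, Num.sqrt (ln n%:R) < mu &
                         mu <= n%:R `^ (99 / 100)])
        chi2_normal (fun n mu => mu * Num.sqrt (ln n%:R))]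
  /\
  [/\ Theta_on (fun n M => [/\ (2 <= n)%N, 0 <= M & M <= 1])
        chi2_poisson (fun _ M => M ^+ 2),
      exp_Theta_on (fun n M => [/\ (2 <= n)%N, 1 < M & M <= ln n%:R])
        chi2_poisson (fun _ M => M) &
      exp_Theta_on
        (fun n M => [/\ (2 <= n)%N, ln n%:R < M & M <= n%:R `^ (199 / 100)])
        chi2_poisson (fun n M => Num.sqrt (M * ln n%:R))].
Proof.
move=> chi2_normal chi2_poisson.
have C4 : 0 < 6 ^+ 4 * expR 232 :> R by rewrite mulr_gt0 ?expR_gt0 ?exprn_gt0.
have c64 : 0 < (64 ^+ 2)^-1 :> R by rewrite invr_gt0 exprn_gt0.
have ln_ge0' n : (2 <= n)%N -> 0 <= ln n%:R :> R.
  by move=> n2; apply: ln_ge0; rewrite ler1n ltnW.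
have powRn n (a : R) : (2 <= n)%N -> n%:R `^ a = expR (a * ln n%:R).
  by move=> n2; rewrite /powR pnatr_eq0 -leqn0 leqNgt ltnW.
split; split.
- exists 16^-1, (6 ^+ 4 * expR 232); split=> // n mu [n2 mu0 mu1].
  by have [H _ _] := normal_family_regimes mu n2; apply: H; rewrite mu0.
- exists 4^-1, 232, (ln (6 ^+ 4)); split=> // n mu [n2 mu1 mul].
  by have [_ H _] := normal_family_regimes mu n2; apply: H; rewrite mu1.
- exists (64 ^+ 2)^-1, 160, (ln (6 ^+ 4)); split=> // n mu [n2 lmu mun].
  have [_ _ H] := normal_family_regimes mu n2; apply: H; rewrite lmu/=.
  apply: (le_trans mun); rewrite powRn// ler_expR ler_wpM2r ?ln_ge0'//; lra.
- exists 16^-1, (6 ^+ 4 * expR 232); split=> // n M [n2 M0 M1].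
  have [H _ _] := poisson_family_regimes n2 M0.
  have M4 : Num.sqrt M ^+ 4 = M ^+ 2 by rewrite (exprM _ 2 2) sqr_sqrtr.
  rewrite M4 in H; apply: H.
  by rewrite sqrtr_ge0/= -sqrtr1 ler_wsqrtr.
- exists 4^-1, 232, (ln (6 ^+ 4)); split=> // n M [n2 M1 Ml].
  have M0 : 0 <= M by lra.
  have [_ H _] := poisson_family_regimes n2 M0.
  rewrite sqr_sqrtr// in H; apply: H.
  by rewrite ler_wsqrtr// andbT -sqrtr1 ltr_sqrt//; lra.
exists (64 ^+ 2)^-1, 160, (ln (6 ^+ 4)); split=> // n M [n2 lM Mn].
have l0 := ln_ge0' n n2; have M0 : 0 <= M by lra.
have [_ _ H] := poisson_family_regimes n2 M0.
rewrite sqrtrM//; apply: H; rewrite ltr_sqrt ?lM/=; last exact: le_lt_trans lM.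
rewrite -(@ler_pXn2r _ 2) ?nnegrE ?sqrtr_ge0 ?expR_ge0// sqr_sqrtr//.
apply: (le_trans Mn); rewrite powRn// -expRM_natl ler_expR; lra.
Qed.
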